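(* Let $q$ be a power of an odd prime $p$, $K$ an algebraic closure of $\mathbb{F}_q$, and $\lambda\in K\setminus\{0,1,-1\}$. The plane curve $\mathcal C_\lambda$ of homogeneous equation $$Y^{q+1}-(X^{q}Z+XZ^q)-\lambda(Y^{2}-2XZ)^{(q+1)/2}=0$$ is nonsingular, and its full automorphism group $\mathrm{Aut}(\mathcal C_\lambda)$ is isomorphic to $\mathrm{PGL}(2,q)$.
   Context: $\mathrm{Aut}(\mathcal C_\lambda)$ is the group of all ($K$-)automorphisms of the curve (equivalently of its function field over $K$). *)

(* Defs.v *)
From HB Require Import structures.
From mathcomp Require Import all_boot all_order all_algebra all_fingroup.
From mathcomp Require Import mpoly.

Set Implicit Arguments.
Unset Strict Implicit.
Unset Printing Implicit Defensive.

Import GRing.Theory.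
Local Open Scope ring_scope.

Section Curve.
Variables (K : fieldType) (q : nat) (lam : K).

Definition cX : {mpoly K[3]} := 'X_(inord 0).
Definition cY : {mpoly K[3]} := 'X_(inord 1).
Definition cZ : {mpoly K[3]} := 'X_(inord 2).

Definition curveF : {mpoly K[3]} :=
  cY ^+ q.+1 - (cX ^+ q * cZ + cX * cZ ^+ q)
  - lam%:MP * (cY ^+ 2 - 2%:R * cX * cZ) ^+ (q.+1)./2.

(* Affine equation in the chart Z = 1, in K[x,y] (x = 'X_0, y = 'X_1). *)
Definition ax : {mpoly K[2]} := 'X_(inord 0).
Definition ay : {mpoly K[2]} := 'X_(inord 1).
Definition curve_aff : {mpoly K[2]} :=
  ay ^+ q.+1 - (ax ^+ q + ax) - lam%:MP * (ay ^+ 2 - 2%:R * ax) ^+ (q.+1)./2.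
End Curve.

Definition proj_nonsingular (K : fieldType) (P : {mpoly K[3]}) : Prop :=
  forall v : 'I_3 -> K, (exists i, v i != 0) ->
    ~ (meval v P = 0 /\ forall i : 'I_3, meval v (P^`M(i)) = 0).

(* Function field of the affine plane curve f(x,y) = 0 over K:
   a field F with an embedding iota : K -> F and x, y in F such that
   the evaluation K[X,Y] -> F, X |-> x, Y |-> y has kernel exactly (f)
   and F is generated as a field by iota(K), x, y.  Thus
   F = Frac(K[X,Y]/(f)) = K(x,y) = K(C). *)
Definition pt2 (F : Type) (x y : F) : 'I_2 -> F :=
  fun i => if val i == 0%N then x else y.

Definition ev2 (K F : fieldType) (iota : {rmorphism K -> F}) (x y : F)
  (g : {mpoly K[2]}) : F := mmap iota (pt2 x y) g.

Record is_function_field (K : fieldType) (f : {mpoly K[2]})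
  (F : fieldType) (iota : {rmorphism K -> F}) (x y : F) : Prop := {
  ff_root : ev2 iota x y f = 0;
  ff_ker : forall g : {mpoly K[2]}, ev2 iota x y g = 0 ->
             exists h : {mpoly K[2]}, g = f * h;
  ff_gen : forall z : F, exists a b : {mpoly K[2]},
             ev2 iota x y b != 0 /\ z = ev2 iota x y a / ev2 iota x y b }.

Definition is_Kaut (K F : fieldType) (iota : {rmorphism K -> F})
  (s : F -> F) : Prop :=
  [/\ s 1 = 1,
      forall a b, s (a + b) = s a + s b,
      forall a b, s (a * b) = s a * s b,
      bijective s &
      forall c : K, s (iota c) = iota c].

Definition iso_to_Kaut (gT : finGroupType) (G : {group gT})
  (K F : fieldType) (iota : {rmorphism K -> F}) : Prop :=
  exists phi : gT -> (F -> F),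
    [/\ forall g, g \in G -> is_Kaut iota (phi g),
        forall g h, g \in G -> h \in G ->
          forall z, phi (g * h)%g z = phi g (phi h z),
        forall g h, g \in G -> h \in G ->
          (forall z, phi g z = phi h z) -> g = h &
        forall s, is_Kaut iota s ->
          exists2 g, g \in G & forall z, phi g z = s z].

Section PGL.
Variable Fq : finFieldType.
Definition scalarsGL : {set {'GL_2[Fq]}} :=
  [set g : {'GL_2[Fq]} | is_scalar_mx (GLval g)].
Definition PGL2 := ('GL_2[Fq] / <<scalarsGL>>)%G.
End PGL.

(* Main.v *)
(** An automorphism of the function field replaces the coordinates (x, y) by another pair
    satisfying the same equation f = 0 (a "chart"), so it suffices to compare two charts.
    In a chart the regular differentials are G dx / f_y with deg G <= q - 2, hence this
    space of polynomials, up to a common factor, does not depend on the chart. At the place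
    at infinity of a chart the pole orders of x and y are q + 1 and q, so the orders of
    these differentials, counted from the least one, are never q - 1 or q. If that place is
    centred at an affine point P of another chart, this forces the tangent line at P to meet the curve with
    multiplicity q + 1, and then P is an F_q-rational point of the conic y^2 = 2x. A
    projectivity over F_q preserving f moves P to infinity. Two charts with the same place
    at infinity differ by an affine map, and as such a map permutes the rational points of
    the conic it comes from a Borel subgroup of PGL(2, q). All these substitutions are
    conjugations of the traceless matrix S = [[y, x], [-2, -y]] by elements of GL(2, q), up
    to scalars, and conversely f is invariant under them since
    y^2 - 2x = - det S and 2 (y^(q+1) - x^q - x) = tr (S S^(q)). *)

Require Import Defs.
From Stdlib Require Import ClassicalEpsilon.
From HB Require Import structures.
From mathcomp Require Import all_boot all_order all_algebra all_fingroup.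
From mathcomp Require Import all_solvable all_field.
From mathcomp Require Import ring zify.
From mathcomp Require Import mpoly.

Set Implicit Arguments.
Unset Strict Implicit.
Unset Printing Implicit Defensive.

Import Order.TTheory GRing.Theory Num.Theory.
Local Open Scope ring_scope.

(** Comparing charts requires notions that depend on none of them. Places are therefore valuations
    of F itself, and the regularity of a differential is measured against one fixed derivation of F.
    The price is a proof that functions without poles at affine points are polynomials in x and y,
    which rests on smoothness. The two missing orders suffice to control a tangent line: contact q
    is excluded directly, and a smaller contact n >= 2 is raised to q - 1 by multiplying with a
    power of a linear form of order 1, the degree staying at most q - 2. Since lam is not 1, f has
    the constant leading coefficient 1 - lam in y, so (1 : 0 : 0) is the only point at infinity. The
    condition on -1 enters because s ^ ((q - 1)/2) is 1 or -1 for nonzero s in F_q: a singular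
    point, or a line of contact q + 1 at a point off the conic, would force lam ^ 2 = 1. *)

Definition fval (A : comNzRingType) (q : nat) (l x y : A) : A :=
  y ^+ q.+1 - (x ^+ q + x) - l * (y ^+ 2 - 2%:R * x) ^+ (q.+1)./2.

Lemma rmorph_fval (A A' : comNzRingType) (g : {rmorphism A -> A'}) q l x y :
  g (fval q l x y) = fval q (g l) (g x) (g y).
Proof.
have e : g (y ^+ 2 - 2%:R * x) = g y ^+ 2 - 2%:R * g x.
  by rewrite rmorphB rmorphXn (rmorphM g 2%:R) rmorph_nat.
by rewrite /fval !rmorphB rmorphD (rmorphM g l) !rmorphXn e.
Qed.

Lemma predn_addn_eq a b n : (0 < a)%N -> n.+1 = (a + b).-1 -> (a + b)%N = n.+2.
Proof. lia. Qed.

Lemma addn_gt1_le a b c d n : (a + b)%N = n -> (c + d)%N = n ->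
  (1 < a)%N -> (1 < b)%N -> (c <= a)%N -> (d <= b)%N -> (1 < c)%N.
Proof. lia. Qed.

(** Each coefficient in y is divisible by x - a. The equality of sizes preserves the bound on the
    y-degree when a denominator is cancelled in [integral_ring]. *)
Lemma horner_eval_dvd (K : fieldType) (a : K) (G : {poly {poly K}}) :
  map_poly (horner_eval a) G = 0 ->
  exists2 H, G = ('X - a%:P)%:P * H & size H = size G.
Proof.
move=> G0; pose H := \poly_(i < size G) (G`_i %/ ('X - a%:P)).
have E : G = ('X - a%:P)%:P * H.
  apply/polyP => i; rewrite coefCM coef_poly.
  case: ltnP => [_|h]; last by rewrite mulr0 nth_default.
  have: root G`_i a by move/polyP/(_ i): G0; rewrite coef_map coef0 rootE => /eqP.
  by rewrite -dvdp_XsubCl mulrC => /divpK ->.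
exists H => //; rewrite [in RHS]E size_Cmul // polyXsubC_eq0 //.
Qed.

(** * Bivariate polynomials and the irreducibility of f *)

Section Eval.
Variables (K : fieldType) (A : comNzRingType) (phi : {rmorphism K -> A}).

(* Bivariate polynomials are elements of {poly {poly K}}: the inner
   variable is x, the outer one is y. *)
Definition evB (x y : A) : {poly {poly K}} -> A :=
  horner_eval y \o map_poly (horner_eval x \o map_poly phi).

HB.instance Definition _ x y :=
  GRing.RMorphism.copy (evB x y)
    (horner_eval y \o map_poly (horner_eval x \o map_poly phi)).

Lemma evBE x y G :
  evB x y G = \sum_(j < size G) (map_poly phi G`_j).[x] * y ^+ j.
Proof.
rewrite /evB /= /horner_eval (@horner_coef_wide _ (size G)) ?size_poly //.
by apply: eq_bigr => j _; rewrite (coef_map (horner_eval x \o map_poly phi)).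
Qed.

Lemma evB_C x y c : evB x y c%:P = (map_poly phi c).[x].
Proof. by rewrite /evB /= map_polyC [LHS]hornerC. Qed.

Lemma evB_CC x y c : evB x y c%:P%:P = phi c.
Proof. by rewrite evB_C map_polyC hornerC. Qed.

Lemma evB_x x y : evB x y 'X%:P = x.
Proof. by rewrite evB_C map_polyX hornerX. Qed.

Lemma evB_y x y : evB x y 'X = y.
Proof. by rewrite /evB /= map_polyX [LHS]hornerX. Qed.

Lemma evB_lift x y (P : {poly K}) : evB x y (map_poly polyC P) = (map_poly phi P).[y].
Proof.
rewrite /evB /= -map_poly_comp /horner_eval; congr (_.[y]).
by apply: eq_map_poly => c; rewrite /= map_polyC [LHS]hornerC.
Qed.

Lemma evBD x y G H : evB x y (G + H) = evB x y G + evB x y H.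
Proof. exact: rmorphD. Qed.

Lemma evBN x y G : evB x y (- G) = - evB x y G.
Proof. exact: rmorphN. Qed.

Lemma evBB x y G H : evB x y (G - H) = evB x y G - evB x y H.
Proof. exact: rmorphB. Qed.

Lemma evBM x y G H : evB x y (G * H) = evB x y G * evB x y H.
Proof. exact: rmorphM. Qed.

Lemma evBX x y G n : evB x y (G ^+ n) = evB x y G ^+ n.
Proof. exact: rmorphXn. Qed.

Lemma evB_nat x y n : evB x y n%:R = n%:R.
Proof. exact: rmorph_nat. Qed.

Lemma evB0 x y : evB x y 0 = 0.
Proof. exact: rmorph0. Qed.

Lemma evB1 x y : evB x y 1 = 1.
Proof. exact: rmorph1. Qed.

Lemma evB_ind (P : {poly {poly K}} -> Prop) :
  (forall c, P c%:P%:P) -> P 'X%:P -> P 'X ->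
  (forall G H, P G -> P H -> P (G + H)) ->
  (forall G H, P G -> P H -> P (G * H)) -> forall G, P G.
Proof.
move=> hC hx hy hD hM; elim/poly_ind => [|G c IH]; first by rewrite -!polyC0.
apply: (hD); first exact: hM.
elim/poly_ind: c => [|c d IHc]; first by rewrite -polyC0.
by rewrite polyCD polyCM; apply: (hD) => //; apply: hM.
Qed.

End Eval.

Section Curve.
Variables (K : fieldType) (q : nat) (lam : K).

Definition fB : {poly {poly K}} := fval q lam%:P%:P 'X%:P 'X.

Lemma evB_fB (A : comNzRingType) (phi : {rmorphism K -> A}) x y :
  evB phi x y fB = fval q (phi lam) x y.
Proof.
have := @rmorph_fval {poly {poly K}} A (evB phi x y) q lam%:P%:P 'X%:P 'X.
by rewrite /= evB_CC evB_x evB_y.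
Qed.

Hypothesis q_odd : odd q.
Hypothesis q_gt1 : (1 < q)%N.
Hypothesis lam1 : lam != 1.

Lemma half_qS : ((q.+1)./2.*2 = q.+1)%N.
Proof. by rewrite even_halfK //= q_odd. Qed.

Lemma fB_expand :
  fB = 'X^(q.+1) - ('X^q + 'X)%:P - lam%:P *: ('X^2 - (2%:R * 'X)%:P) ^+ (q.+1)./2.
Proof.
by rewrite /fB /fval -mul_polyC polyCD polyC_exp polyCM polyC_natr.
Qed.

Let mon2 : ('X^2 - (2%:R * 'X)%:P : {poly {poly K}}) \is monic.
Proof.
by rewrite monicE lead_coefDl ?lead_coefXn // size_polyN size_polyXn (leq_ltn_trans (size_polyC_leq1 _)).
Qed.

Let size_mon2 : size (('X^2 - (2%:R * 'X)%:P) ^+ (q.+1)./2 : {poly {poly K}}) = q.+2.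
Proof.
have n0 : (('X^2 - (2%:R * 'X)%:P) ^+ (q.+1)./2 : {poly {poly K}}) != 0.
  by rewrite expf_neq0 // monic_neq0.
rewrite -(prednK (n := size _)) ?size_poly_gt0 // size_exp size_polyDl ?size_polyXn.
  by rewrite mul2n half_qS.
by rewrite size_polyN (leq_ltn_trans (size_polyC_leq1 _)).
Qed.

Lemma coef_fB_top : fB`_q.+1 = (1 - lam)%:P.
Proof.
rewrite fB_expand !coefB coefXn eqxx coefC /= subr0 coefZ.
have := monic_exp (q.+1)./2 mon2; rewrite monicE lead_coefE size_mon2 /=.
by move=> /eqP ->; rewrite mulr1 polyCB.
Qed.

Lemma size_fB : size fB = q.+2.
Proof.
apply/eqP; rewrite eqn_leq; apply/andP; split; last first.
  rewrite ltnNge; apply/negP => h; move: coef_fB_top.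
  rewrite nth_default // => /esym/eqP.
  by rewrite polyC_eq0 subr_eq0 eq_sym (negPf lam1).
rewrite fB_expand (leq_trans (size_polyD _ _)) // geq_max (leq_trans (size_polyD _ _)) /=.
  by rewrite size_polyN (leq_trans (size_scale_leq _ _)) // size_mon2.
by rewrite geq_max size_polyXn leqnn size_polyN (leq_trans (size_polyC_leq1 _)).
Qed.

Lemma lead_coef_fB : lead_coef fB = (1 - lam)%:P.
Proof. by rewrite lead_coefE size_fB coef_fB_top. Qed.

Lemma lead_coef_fB_unit : lead_coef fB \is a GRing.unit.
Proof.
have d : 1 - lam != 0 by rewrite subr_eq0 eq_sym.
by rewrite lead_coef_fB poly_unitE size_polyC coefC /= unitfE d.
Qed.

Lemma fB_at a : map_poly (horner_eval a) fB = fval q lam%:P a%:P 'X.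
Proof.
have := @rmorph_fval {poly {poly K}} {poly K} (map_poly (horner_eval a)) q lam%:P%:P 'X%:P 'X.
by rewrite /= !map_polyC map_polyX /= /horner_eval hornerC hornerX.
Qed.

Lemma horner_fB_at (A : comNzRingType) (phi : {rmorphism K -> A}) a v :
  (map_poly phi (map_poly (horner_eval a) fB)).[v] = fval q (phi lam) (phi a) v.
Proof.
have := @rmorph_fval {poly K} A (horner_eval v \o map_poly phi) q lam%:P a%:P 'X.
by rewrite /= fB_at /horner_eval !map_polyC map_polyX /= !hornerC hornerX.
Qed.

Lemma fB_at0 : map_poly (horner_eval 0) fB = (1 - lam)%:P * 'X^(q.+1).
Proof.
rewrite fB_at /fval mulr0 subr0 expr0n /= addr0.
have -> : (q == 0)%N = false by lia.
by rewrite subr0 -exprM mul2n half_qS polyCB mulrBl polyC1 mul1r.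
Qed.

Lemma fB_const : exists2 c : {poly K}, fB`_0 = 'X * c & c.[0] != 0.
Proof.
have -> : fB`_0 = fval q lam%:P 'X 0.
  have := @rmorph_fval {poly {poly K}} {poly K} (horner_eval 0) q lam%:P%:P 'X%:P 'X.
  by rewrite /= /horner_eval !hornerC hornerX horner_coef0.
(* As q >= 3, the exponent (q + 1)/2 is at least 2, so neither the conic term nor x ^ q contributes
   to the coefficient of x, which is -1. *)
have [m Em] : exists m, (q.+1)./2 = m.+2.
  by exists ((q.+1)./2 - 2)%N; have := half_qS; lia.
have [n En] : exists n, q = n.+2 by exists (q - 2)%N; lia.
exists (- ('X^(n.+1) + 1) + lam%:P * 2%:R * (- (2%:R * 'X)) ^+ m.+1).
  rewrite /fval Em En expr0n /= expr0n /= !sub0r (exprS _ m.+1) (exprS _ n.+1).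
  by ring.
by rewrite !hornerE /= expr0n /= !(oppr0, mulr0, mul0r, expr0n, addr0, add0r) oppr_eq0 oner_neq0.
Qed.

(** Gauss's lemma and Eisenstein's criterion together: only the factors x of N need to be cancelled,
    for once N(0) is nonzero the polynomial N f has leading coefficient prime to x and constant term
    divisible by x exactly once. The multiplier N serves both pseudo-division in K[x][y] and
    factorisations over K(x). *)
Lemma mul_fB_factor (N : {poly K}) (p r : {poly {poly K}}) : N != 0 ->
  N%:P * fB = p * r -> (size p <= 1)%N || (size r <= 1)%N.
Proof.
have cX : forall g : {poly {poly K}}, map_poly (horner_eval 0) g = 0 ->
    exists h, g = 'X%:P * h.
  by move=> g /horner_eval_dvd[h gE _]; exists h; rewrite gE polyC0 subr0.
have domM : forall g h : {poly {poly K}},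
    map_poly (horner_eval 0) (g * h) = 0 -> map_poly (horner_eval 0) g = 0 \/ map_poly (horner_eval 0) h = 0.
  by move=> g h; rewrite rmorphM => /eqP; rewrite mulf_eq0 => /orP[]/eqP; auto.
have X0 : ('X%:P : {poly {poly K}}) != 0 by rewrite polyC_eq0 polyX_eq0.
elim: {N}(size N) {-2}N (leqnn (size N)) p r => [|n IH] N szN p r N0 E.
  by move: szN; rewrite leqn0 size_poly_eq0 (negPf N0).
have [/eqP rN|NN] := boolP (N.[0] == 0).
  have /eqP := rN; rewrite -[_ == 0]/(root N 0) -dvdp_XsubCl subr0 => /divpK.
  set N1 := N %/ 'X => EN.
  have N10 : N1 != 0 by apply: contraNneq N0 => N10; rewrite -EN N10 mul0r.
  have szN1 : (size N1 <= n)%N by move: szN; rewrite -EN size_mulX.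
  have: map_poly (horner_eval 0) (p * r) = 0.
    by rewrite -E rmorphM /= map_polyC /= /horner_eval rN mul0r.
  case/domM => /cX[h Eh].
    have := IH N1 szN1 h r N10; rewrite Eh size_Cmul ?polyX_eq0 //; apply.
    by apply: (mulfI X0); rewrite !mulrA -Eh -E -EN polyCM; congr (_ * _); rewrite mulrC.
  have := IH N1 szN1 p h N10; rewrite Eh size_Cmul ?polyX_eq0 //; apply.
  by apply: (mulfI X0); rewrite [RHS]mulrCA -Eh -E -EN polyCM mulrA; congr (_ * _); rewrite mulrC.
(* Eisenstein at the prime [x]: f is [(1 - lam) y^(q+1)] modulo x. *)
apply/negPn/negP; rewrite negb_or -!ltnNge => /andP[sp sr].
have p0 : p != 0 by rewrite -size_poly_gt0 ltnW.
have r0 : r != 0 by rewrite -size_poly_gt0 ltnW.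
pose p1 := map_poly (horner_eval 0) p; pose r1 := map_poly (horner_eval 0) r.
pose c := N.[0] * (1 - lam).
have E0 : c%:P * 'X^(q.+1) = p1 * r1.
  rewrite /p1 /r1 -rmorphM -E rmorphM /= fB_at0 map_polyC mulrA /= -polyCM.
  by rewrite /horner_eval.
have c0 : c != 0 by rewrite mulf_neq0 // subr_eq0 eq_sym.
have szE : (size p + size r)%N = q.+3.
  have := congr1 (fun g : {poly {poly K}} => size g) E; rewrite size_Cmul // size_fB size_mul //.
  by apply: predn_addn_eq; apply: ltnW.
have sp1 : (size p1 <= size p)%N by apply: size_poly.
have sr1 : (size r1 <= size r)%N by apply: size_poly.
have p1d : p1 %| 'X^(q.+1).
  by rewrite -(@dvdpZr _ c) // -mul_polyC E0 dvdp_mulIl.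
have r1d : r1 %| 'X^(q.+1).
  by rewrite -(@dvdpZr _ c) // -mul_polyC E0 dvdp_mulIr.
have E0n : p1 * r1 != 0 by rewrite -E0 mulf_neq0 ?polyC_eq0 // monic_neq0 ?monicXn.
have szE1 : (size p1 + size r1)%N = q.+3.
  move: (E0n); rewrite mulf_eq0 negb_or => /andP[a1 a2].
  have := congr1 (fun g : {poly K} => size g) E0; rewrite size_Cmul // size_polyXn size_mul //.
  by apply: predn_addn_eq; rewrite size_poly_gt0.
have div : forall g, g %| 'X^(q.+1) -> (1 < size g)%N -> g.[0] = 0 :> K.
  have XX : 'X = 'X - 0%:P :> {poly K} by rewrite polyC0 subr0.
  move=> g; rewrite XX => /dvdp_exp_XsubCP[e _ ge] sg.
  apply/eqP; rewrite -[_ == 0]/(root g 0) (eqp_root ge).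
  case: e ge => [/eqp_size|e _]; last by rewrite root_exp_XsubC.
  by rewrite expr0 size_poly1 => e; rewrite e in sg.
have h1 : (1 < size p1)%N by exact: (addn_gt1_le szE szE1 sp sr sp1 sr1).
have h2 : (1 < size r1)%N by apply: (addn_gt1_le (etrans (addnC _ _) szE) (etrans (addnC _ _) szE1)).
have hz : forall g : {poly {poly K}}, (map_poly (horner_eval 0) g).[0] = (g`_0).[0].
  by move=> g; rewrite horner_coef0 coef_map.
have /eqP q1 := div _ p1d h1; have /eqP q2 := div _ r1d h2.
move: q1 q2; rewrite !hz -![_ == 0]/(root _ 0) -!dvdp_XsubCl subr0 => d1 d2.
have [cc Ecc cc0] := fB_const.
have := congr1 (fun g : {poly {poly K}} => g`_0) E; rewrite coefCM coef0M Ecc => E2.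
have : 'X * 'X %| p`_0 * r`_0 by rewrite dvdp_mul.
rewrite -E2 mulrCA dvdp_mul2l ?polyX_eq0 // -{1}[X in X %| _]subr0 dvdp_XsubCl rootM /root.
by rewrite (negPf NN) (negPf cc0).
Qed.

Lemma fB_irreducible : irreducible_poly fB.
Proof.
split=> [|p sp]; first by rewrite size_fB.
have f0 : fB != 0 by rewrite -size_poly_gt0 size_fB.
case/Pdiv.Idomain.dvdpP => -[c r] /= c0 E.
rewrite -mul_polyC in E.
have: c%:P * fB != 0 by rewrite mulf_neq0 // polyC_eq0.
rewrite E mulf_eq0 negb_or => /andP[r0 p0].
have := mul_fB_factor c0 E; rewrite orbC.
have p1 : (0 < size p)%N by rewrite size_poly_gt0.
case/orP => s1; first by case: (size p) p1 s1 sp => [|[|]].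
have r1 : (0 < size r)%N by rewrite size_poly_gt0.
have {}s1 : size r == 1%N by rewrite eqn_leq s1.
case/size_poly1P: s1 => d d0 Er.
apply/Pdiv.Idomain.eqpP; exists (d, c); first by rewrite /= d0 c0.
by rewrite -!mul_polyC /= -Er -E.
Qed.

Lemma fB_dvd (G : {poly {poly K}}) : fB %| G -> exists H, G = fB * H.
Proof.
move=> h; exists (G %/ fB); rewrite mulrC.
by rewrite (Pdiv.IdomainUnit.divpK lead_coef_fB_unit).
Qed.

(** Irreducibility makes G coprime to f over K(x); a Bezout relation with cleared denominators then
    puts a nonzero polynomial in x alone into the ideal (f, G). *)
Lemma fB_bezout (G : {poly {poly K}}) : ~ (exists H, G = fB * H) ->
  exists U W (N : {poly K}), N != 0 /\ U * fB + W * G = N%:P.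
Proof.
move=> nd; have cop : coprimep fB G.
  rewrite irreducible_poly_coprime; last exact: fB_irreducible.
  by apply/negP => /fB_dvd.
have [[U W] /= e] := Bezoutp fB G.
have : size (U * fB + W * G) == 1%N.
  by rewrite (eqp_size e) -coprimep_def.
by case/size_poly1P => N N0 EN; exists U, W, N.
Qed.

End Curve.

(** * Discrete valuations *)

Section Places.
Variables (K F : fieldType) (iota : {rmorphism K -> F}).
Implicit Types (v : F -> int) (z : F).

(* The value of [v] at 0 is junk; [vge v n z] reads "v z >= n" with v 0 = +oo. *)
Definition vge v (n : int) z := (z == 0) || (n <= v z).

(** [place_unif] normalises the valuation to be onto the integers, and [place_res] makes K the
    residue field, so that centres have coordinates in K. *)
Record place v : Prop := Place {
  placeM : forall a b, a != 0 -> b != 0 -> v (a * b) = v a + v b;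
  placeD : forall a b n, vge v n a -> vge v n b -> vge v n (a + b);
  placeK : forall c, c != 0 -> v (iota c) = 0;
  place_unif : exists2 t, t != 0 & v t = 1;
  place_res : forall a, vge v 0 a -> exists c, vge v 1 (a - iota c) }.

Variables (v : F -> int) (pv : place v).

Lemma place1 : v 1 = 0.
Proof. by rewrite -(rmorph1 iota) (placeK pv) ?oner_neq0. Qed.

Lemma placeX a n : a != 0 -> v (a ^+ n) = v a * n%:Z.
Proof.
move=> a0; elim: n => [|n IH]; first by rewrite expr0 place1 mulr0.
by rewrite exprS (placeM pv) ?expf_neq0 // IH; lia.
Qed.

Lemma placeV a : a != 0 -> v a^-1 = - v a.
Proof.
move=> a0; have := placeM pv a0 (invr_neq0 a0).
by rewrite divff // place1; lia.
Qed.

Lemma vgeE n a : a != 0 -> vge v n a = (n <= v a).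
Proof. by move=> a0; rewrite /vge (negPf a0). Qed.

Lemma vge0 n : vge v n 0. Proof. by rewrite /vge eqxx. Qed.

Lemma vge_le m n a : n <= m -> vge v m a -> vge v n a.
Proof. by move=> nm; rewrite /vge => /orP[->//|h]; rewrite (le_trans nm h) orbT. Qed.

Lemma vgeM m n a b : vge v m a -> vge v n b -> vge v (m + n) (a * b).
Proof.
case/orP=> [/eqP->|ha]; first by rewrite mul0r vge0.
case/orP=> [/eqP->|hb]; first by rewrite mulr0 vge0.
have [->|a0] := eqVneq a 0; first by rewrite mul0r vge0.
have [->|b0] := eqVneq b 0; first by rewrite mulr0 vge0.
by rewrite vgeE ?mulf_neq0 // (placeM pv) //; lia.
Qed.

Lemma vge_iota c : vge v 0 (iota c).
Proof.
have [->|c0] := eqVneq c 0; first by rewrite rmorph0 vge0.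
by rewrite /vge (placeK pv) // lexx orbT.
Qed.

Lemma vge1 : vge v 0 1. Proof. by rewrite -(rmorph1 iota) vge_iota. Qed.

Lemma vgeMl n a b : vge v 0 a -> vge v n b -> vge v n (a * b).
Proof. by move=> ha hb; rewrite -[n]add0r vgeM. Qed.

Lemma vgeMr n a b : vge v n a -> vge v 0 b -> vge v n (a * b).
Proof. by move=> ha hb; rewrite -[n]addr0 vgeM. Qed.

Lemma vgeN n a : vge v n a -> vge v n (- a).
Proof.
move=> h; rewrite -mulN1r vgeMl //.
by rewrite -(rmorph1 iota) -rmorphN vge_iota.
Qed.

Lemma vgeB n a b : vge v n a -> vge v n b -> vge v n (a - b).
Proof. by move=> ha hb; apply: (placeD pv) => //; apply: vgeN. Qed.

Lemma vgeX n a : vge v 0 a -> vge v 0 (a ^+ n).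
Proof.
move=> h; elim: n => [|n IH]; first by rewrite expr0 vge1.
by rewrite exprS vgeMl.
Qed.

Lemma vge_sum (I : Type) (r : seq I) (P : pred I) (E : I -> F) n :
  (forall i, P i -> vge v n (E i)) -> vge v n (\sum_(i <- r | P i) E i).
Proof.
by move=> h; elim/big_rec: _ => [|i z Pi hz]; rewrite ?vge0 //; apply: (placeD pv); auto.
Qed.

Lemma place_addl a b : a != 0 -> vge v (v a + 1) b -> a + b != 0 /\ v (a + b) = v a.
Proof.
move=> a0 hb.
have ab0 : a + b != 0.
  apply/eqP => /eqP; rewrite addr_eq0 => /eqP ab; move/vgeN: hb; rewrite -ab vgeE //; lia.
split=> //; apply/eqP; rewrite eq_le; apply/andP; split; last first.
  rewrite -vgeE //; apply: (placeD pv); first by rewrite vgeE.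
  by apply: vge_le hb; lia.
rewrite leNgt; apply/negP => h.
have : vge v (v a + 1) (a + b - b).
  by apply: vgeB => //; rewrite vgeE //; lia.
by rewrite addrK vgeE //; lia.
Qed.

Lemma place_near c a : c != 0 -> vge v 1 (a - iota c) -> a != 0 /\ v a = 0.
Proof.
move=> c0 h; have c0' : iota c != 0 by rewrite fmorph_eq0.
have := @place_addl (iota c) (a - iota c) c0'.
rewrite (placeK pv) // add0r [iota c + _]addrC subrK; exact.
Qed.

(** The term of least value dominates. This reads off the pole order of a polynomial at infinity
    from its monomials. *)
Lemma place_sum_distinct (I : eqType) (r : seq I) (E : I -> F) :
  uniq r -> {in r, forall i, E i != 0} -> {in r &, injective (v \o E)} ->
  r != [::] -> exists2 i, i \in r &
    [/\ \sum_(j <- r) E j != 0, v (\sum_(j <- r) E j) = v (E i) &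
        {in r, forall j, v (E i) <= v (E j)}].
Proof.
elim: r => [//|i r IH] /= /andP[ir ur] E0 inj _.
have [r0|r0] := eqVneq r [::].
  exists i; rewrite ?r0 ?mem_seq1 // big_seq1 E0 ?mem_head //; split=> // j.
  by rewrite mem_seq1 => /eqP->.
have [||i' i'r [s0 vs min]] := IH ur _ _ r0.
- by move=> j jr; apply: E0; rewrite inE jr orbT.
- by move=> a b ar br; apply: inj; rewrite inE ?ar ?br orbT.
have Ei0 : E i != 0 by apply: E0; rewrite mem_head.
have ne : v (E i) != v (E i').
  apply/negP => /eqP e; move/negP: ir; apply; rewrite (inj i i') ?mem_head //.
  by rewrite inE i'r orbT.
rewrite big_cons; case: (ltgtP (v (E i)) (v (E i'))) ne => // lt _.
  have [|n0 vn] := @place_addl (E i) (\sum_(j <- r) E j) Ei0.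
    by rewrite vgeE // vs; lia.
  exists i; rewrite ?mem_head //; split=> // j.
  by rewrite inE => /orP[/eqP->//|/min]; lia.
have [|n0 vn] := @place_addl (\sum_(j <- r) E j) (E i) s0.
  by rewrite vgeE // vs; lia.
exists i'; first by rewrite inE i'r orbT.
rewrite addrC n0 vn vs; split=> // j.
by rewrite inE => /orP[/eqP->|/min//]; lia.
Qed.

Lemma vge_evB x y G : vge v 0 x -> vge v 0 y -> vge v 0 (evB iota x y G).
Proof.
move=> hx hy; elim/evB_ind: G => [c|||G H hG hH|G H hG hH].
- by rewrite evB_CC vge_iota.
- by rewrite evB_x.
- by rewrite evB_y.
- by rewrite rmorphD; apply: (placeD pv).
- by rewrite rmorphM vgeMl.
Qed.

Lemma vge_poly x (P : {poly K}) : vge v 0 x -> vge v 0 (map_poly iota P).[x].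
Proof. by move=> hx; rewrite -(evB_C iota x x) vge_evB. Qed.

Lemma vge_integral x a : vge v 1 (x - iota a) -> vge v 0 x.
Proof.
move=> h; rewrite -(subrK (iota a) x); apply: (placeD pv); last exact: vge_iota.
exact: vge_le h.
Qed.

(** Reduction modulo the maximal ideal is evaluation at the centre. *)
Lemma vge_evB_sub x y a b G :
  vge v 1 (x - iota a) -> vge v 1 (y - iota b) ->
  vge v 1 (evB iota x y G - iota (evB idfun a b G)).
Proof.
move=> hx hy; have ix := vge_integral hx; have iy := vge_integral hy.
elim/evB_ind: G => [c|||G H hG hH|G H hG hH].
- by rewrite !evB_CC subrr vge0.
- by rewrite !evB_x.
- by rewrite !evB_y.
- by rewrite !rmorphD opprD addrACA; apply: (placeD pv).
- rewrite !rmorphM /=.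
  rewrite (_ : _ - _ = (evB iota x y G - iota (evB idfun a b G)) * evB iota x y H +
    iota (evB idfun a b G) * (evB iota x y H - iota (evB idfun a b H))).
    apply: (placeD pv); first by rewrite vgeMr // vge_evB.
    by rewrite vgeMl // vge_iota.
  by rewrite mulrBl mulrBr addrA subrK.
Qed.

End Places.

(** * Arithmetic of the pole orders i (q + 1) + j q *)

(** The value is (i + j)(q + 1) - j with 0 <= j <= q, a division by q + 1 that determines i + j and
    j. *)
Lemma mono_val_inj q i j i' j' : (j <= q)%N -> (j' <= q)%N ->
  (i * q.+1 + j * q = i' * q.+1 + j' * q)%N -> i = i' /\ j = j'.
Proof.
move=> jq jq' E.
have e : ((i + j) * q.+1 + j' = (i' + j') * q.+1 + j)%N by nia.
have s : (i + j = i' + j')%N.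
  case: (ltngtP (i + j) (i' + j')) => // lt; nia.
by rewrite s in e; lia.
Qed.

(** If i + j >= q - 1, the value is at least (q - 1)(q + 1) - q, which exceeds (q - 2)(q + 1) by
    one. *)
Lemma mono_val_bound q i j : (2 < q)%N -> (j <= q)%N ->
  (i * q.+1 + j * q <= (q - 2) * q.+1)%N -> (i + j <= q - 2)%N.
Proof.
move=> q2 jq E; rewrite leqNgt; apply/negP => lt.
have [r Er] : exists r, q = r.+2 by exists (q - 2)%N; lia.
have le : (q.-1 <= i + j)%N by lia.
have := leq_mul le (leqnn q.+1); nia.
Qed.

(** With s = q - 2 - (i + j) one finds r = j + s (q + 1): at most q - 2 when s = 0, at least q + 1
    otherwise. *)
Lemma mono_val_gap q i j r : (2 < q)%N -> (i + j <= q - 2)%N ->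
  (i * q.+1 + j * q + r = (q - 2) * q.+1)%N -> r != q.-1 /\ r != q.
Proof.
move=> q2 le E; have [s Es] : exists s, (i + j + s = q - 2)%N.
  by exists (q - 2 - (i + j))%N; rewrite subnKC.
have Er : (r = j + s * q.+1)%N.
  by rewrite -Es !mulnDl (mulnS j) in E; move: (i * q.+1)%N (j * q)%N (s * q.+1)%N E => *; lia.
have ltr : (r <= q -> s = 0)%N.
  by case: s Er {E Es} => // s; rewrite mulSn; move: (s * q.+1)%N => u; lia.
by split; apply/eqP => h; have s0 : s = 0%N by [apply: ltr; lia]; rewrite s0 in Er; lia.
Qed.

(** * Charts and their places *)

Section Taylor.
Variables (A : comNzRingType) (q : nat) (l : A).
Hypothesis frobB : forall x y : A, (x - y) ^+ q = x ^+ q - y ^+ q.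
Hypothesis q_gt0 : (0 < q)%N.

Let m := (q.+1)./2.

(** The difference of the m-th powers of y ^ 2 - 2 x and b ^ 2 - 2 a, divided by the difference of
    the bases. *)
Definition fsum (x y a b : A) : A :=
  \sum_(i < m) (y ^+ 2 - 2%:R * x) ^+ (m.-1 - i) * (b ^+ 2 - 2%:R * a) ^+ i.

Definition ftay1 (x y a b : A) : A :=
  - (x - a) ^+ q.-1 - 1 + 2%:R * l * fsum x y a b.

Definition ftay2 (x y a b : A) : A :=
  (y - b) ^+ q.-1 * y + b ^+ q - l * (y + b) * fsum x y a b.

(** Additivity of the q-th power makes this an exact identity with no remainder. In characteristic p
    its cofactors at (x, y) = (a, b) are the partial derivatives of f. *)
Lemma fval_taylor x y a b :
  fval q l x y = fval q l a b + (x - a) * ftay1 x y a b + (y - b) * ftay2 x y a b.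
Proof.
have m0 : (0 < m)%N by rewrite /m; lia.
have Em : (y ^+ 2 - 2%:R * x) ^+ m =
    (b ^+ 2 - 2%:R * a) ^+ m + ((y - b) * (y + b) - 2%:R * (x - a)) * fsum x y a b.
  rewrite [RHS]addrC; apply/eqP; rewrite -subr_eq subrXX.
  apply/eqP; congr (_ * _); ring.
rewrite /fval -/m Em.
have Ex : x ^+ q = a ^+ q + (x - a) * (x - a) ^+ q.-1.
  by rewrite -exprS prednK // frobB addrC subrK.
have Ey : y ^+ q.+1 = b ^+ q.+1 + (y - b) * ((y - b) ^+ q.-1 * y + b ^+ q).
  rewrite mulrDr mulrA -exprS prednK // frobB !exprSr; ring.
rewrite Ex Ey /ftay1 /ftay2.
move: (fsum _ _ _ _) (b ^+ q.+1) ((y - b) ^+ q.-1) (b ^+ q) (a ^+ q) ((x - a) ^+ q.-1) (_ ^+ m) => S b1 c1 c2 c3 c4 c5.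
ring.
Qed.

End Taylor.

Section Charts.
Variables (p k q : nat) (K : fieldType) (lam : K).
Hypotheses (p_prime : prime p) (p_odd : odd p) (k_gt0 : (0 < k)%N) (q_def : q = (p ^ k)%N).
Hypothesis closedK : forall P : {poly K}, size P != 1%N -> exists x, root P x.
Hypothesis charK : p \in [pchar K].
Hypotheses (lam0 : lam != 0) (lam1 : lam != 1) (lamN1 : lam != -1).

Let m := (q.+1)./2.

Lemma q_odd : odd q. Proof. by rewrite q_def oddX p_odd orbT. Qed.

Lemma q_gt2 : (2 < q)%N.
Proof.
have p2 : (2 < p)%N by have := prime_gt1 p_prime; move: p_odd; case: p => [|[|[|]]].
by rewrite q_def (leq_trans p2) // -{1}[p]expn1 leq_pexp2l // prime_gt0.
Qed.

Lemma two_m : (2 * m = q.+1)%N.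
Proof. by rewrite mul2n even_halfK //= q_odd. Qed.

Section CharP.
Variable (R : comNzRingType) (iota : {rmorphism K -> R}).

Lemma charR : p \in [pchar R]. Proof. exact: (rmorph_pchar iota). Qed.

Lemma q_pnat : [pchar R].-nat q.
Proof.
rewrite q_def pnatX; apply/orP; left.
by rewrite (eq_pnat _ (pcharf_eq charR)) pnat_id.
Qed.

Lemma frobD (x y : R) : (x + y) ^+ q = x ^+ q + y ^+ q.
Proof. by apply: exprDn_pchar; apply: q_pnat. Qed.

Lemma frobB (x y : R) : (x - y) ^+ q = x ^+ q - y ^+ q.
Proof. by rewrite frobD (exprNn_pchar _ q_pnat). Qed.

Lemma natq0 : q%:R = 0 :> R.
Proof. by rewrite q_def natrX (pcharf0 charR) expr0n; case: k k_gt0. Qed.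

(** This removes the factor m from every derivative of f. *)
Lemma two_m1 : 2%:R * m%:R = 1 :> R.
Proof. by rewrite -natrM two_m -addn1 natrD natq0 add0r. Qed.

End CharP.

Let q1 : (1 < q)%N. Proof. exact: ltnW q_gt2. Qed.
Let q0 : (0 < q)%N. Proof. exact: ltnW q1. Qed.
Local Notation fK := (fval q lam).
Local Notation fBq := (fB q lam).

Definition slope (R : comNzRingType) (l x y : R) : R := l * (y ^+ 2 - 2%:R * x) ^+ m.-1.

(* The partial derivatives of f are [slope - 1] and [y ^+ q - y * slope]. *)
Lemma fval_smooth (a b : K) : fK a b = 0 ->
  slope lam a b != 1 \/ b ^+ q - b * slope lam a b != 0.
Proof.
move=> fab; have [W1|] := eqVneq (slope lam a b) 1; last by left.
right; rewrite W1 mulr1; apply/negP; rewrite subr_eq0 => /eqP bq.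
have m0 : (0 < m)%N by have := two_m; lia.
move: fab; rewrite /fval -/m -(prednK m0) exprSr exprSr bq mulrA -/(slope lam a b) W1.
(* With slope 1 and b ^ q = b the equation of the curve says exactly that a ^ q = a. *)
have -> : b * b - (a ^+ q + a) - 1 * (b ^+ 2 - 2%:R * a) = a - a ^+ q by ring.
move/eqP; rewrite subr_eq0 => /eqP aq.
have sq : (b ^+ 2 - 2%:R * a) ^+ q = b ^+ 2 - 2%:R * a.
  rewrite (frobB [the {rmorphism K -> K} of idfun]) exprAC bq exprMn -aq; congr (_ - _ * _).
  have -> : 2%:R = 1 + 1 :> K by ring.
  by rewrite (frobD [the {rmorphism K -> K} of idfun]) expr1n.
move: W1; rewrite /slope; set s := _ - _ in sq *.
have [s0|s0] := eqVneq s 0.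
  have m1 : (0 < m.-1)%N by have := q_gt2; have := two_m; lia.
  by rewrite s0 expr0n; case: (m.-1) m1 => // n _ /=; rewrite mulr0 => /eqP; rewrite eq_sym oner_eq0.
(* [m.-1] is (q - 1)/2 and s lies in F_q, so this power is 1 or -1, and slope 1 makes lam equal to 1
   or -1. *)
have : s ^+ m.-1 * s ^+ m.-1 = 1.
  apply: (mulIf s0); rewrite mul1r -exprD -exprSr -[RHS]sq; congr (_ ^+ _).
  by have := two_m; lia.
move/eqP; rewrite -expr2 sqrf_eq1 => /orP[]/eqP->.
  by rewrite mulr1 => /eqP; rewrite (negPf lam1).
by rewrite mulrN1 => /eqP; rewrite eqr_oppLR (negPf lamN1).
Qed.

(** * Lines meeting the curve with multiplicity q + 1 *)

Section Flex.
Let idK : {rmorphism K -> K} := [the {rmorphism K -> K} of idfun].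

Lemma two_neq0 : 2%:R != 0 :> K.
Proof. by apply/eqP => e; have := two_m1 idK; rewrite e mul0r => /esym/eqP; rewrite oner_eq0. Qed.

Lemma frob2 : 2%:R ^+ q = 2%:R :> K.
Proof. by rewrite -[2%:R]/(1 + 1 : K) (frobD idK) expr1n. Qed.

Variables (a b u1 u2 : K).
Hypothesis flat : forall i, (i < q.+1)%N ->
  (fval q lam%:P (a%:P + u1%:P * 'X) (b%:P + u2%:P * 'X))`_i = 0.

(** Coefficients along the line: [s], [2 be] and [u2 ^ 2] are those of the conic, while [A], [B],
    [C] are those of y ^ (q + 1) - x ^ q - x in degrees 0, 1 and q. *)
Let s := b ^+ 2 - 2%:R * a.
Let be := b * u2 - u1.
Let A := b ^+ q.+1 - a ^+ q - a.
Let B := b ^+ q * u2 - u1.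
Let C := b * u2 ^+ q - u1 ^+ q.
Let g : {poly K} := s%:P + (2%:R * be)%:P * 'X + (u2 ^+ 2)%:P * 'X^2.

Let frobP (c d : K) : (c%:P + d%:P * 'X) ^+ q = (c ^+ q)%:P + (d ^+ q)%:P * 'X^q.
Proof. by rewrite (frobD [the {rmorphism K -> {poly K}} of polyC]) exprMn !polyC_exp. Qed.

(* Restricting f to the line (a + u1 T, b + u2 T), [g] is the conic y^2 - 2x. Squaring
   [lam * g ^+ m] gives [lam ^+ 2 * g ^+ q * g], whose terms of degree below q
   determine g up to a constant. *)
Lemma flex_expand : exists R : {poly K},
  lam%:P * g ^+ m = A%:P + B%:P * 'X + 'X^q * (C%:P + 'X * R).
Proof.
have := flat; set P := fval _ _ _ _ => flatP.
have [R PR] : exists R, P = 'X^(q.+1) * R.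
  exists (drop_poly q.+1 P); rewrite -{1}[P](poly_take_drop q.+1) mulrC.
  rewrite (_ : take_poly _ _ = 0) ?add0r //; apply/polyP => i.
  by rewrite coef_take_poly coef0; case: ltnP => // /flatP.
have gE : (b%:P + u2%:P * 'X) ^+ 2 - 2%:R * (a%:P + u1%:P * 'X) = g.
  by rewrite /g /s /be !(polyCB, polyCM, polyC_exp, polyC_natr); ring.
have PE : P = (b%:P + u2%:P * 'X) * ((b ^+ q)%:P + (u2 ^+ q)%:P * 'X^q)
    - ((a ^+ q)%:P + (u1 ^+ q)%:P * 'X^q + (a%:P + u1%:P * 'X)) - lam%:P * g ^+ m.
  by rewrite /P /fval -/m gE exprS !frobP.
exists ((u2 * u2 ^+ q)%:P - R).
rewrite (_ : lam%:P * g ^+ m = (b%:P + u2%:P * 'X) * ((b ^+ q)%:P + (u2 ^+ q)%:P * 'X^q)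
    - ((a ^+ q)%:P + (u1 ^+ q)%:P * 'X^q + (a%:P + u1%:P * 'X)) - 'X^(q.+1) * R); last first.
  by rewrite -PR PE; move: (g ^+ m) => gm; ring.
rewrite /A /B /C !(polyCB, polyCM) exprS [b ^+ q.+1]exprS polyCM; ring.
Qed.

Let q_low i : (i < 3)%N -> (i < q)%N. Proof. by move/leq_trans; apply; apply: q_gt2. Qed.

Lemma flex_square : [/\ lam ^+ 2 * s ^+ q * s = A ^+ 2, lam ^+ 2 * s ^+ q * be = A * B
  & lam ^+ 2 * s ^+ q * u2 ^+ 2 = B ^+ 2].
Proof.
have [R E] := flex_expand.
have gq : g ^+ q = (s ^+ q)%:P + 'X^q * (((2%:R * be) ^+ q)%:P + (u2 ^+ 2 ^+ q)%:P * 'X^q).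
  have fm (P S : {poly K}) : (P * S) ^+ q = P ^+ q * S ^+ q by rewrite exprMn.
  have XX : 'X^2 ^+ q = 'X^q * 'X^q :> {poly K} by rewrite exprAC expr2.
  rewrite /g !(frobD [the {rmorphism K -> {poly K}} of polyC]).
  rewrite (fm (2%:R * be)%:P) (fm (u2 ^+ 2)%:P) XX !polyC_exp.
  by move: ('X^q) ((2%:R * be)%:P ^+ q) (u2%:P ^+ 2 ^+ q) (s%:P ^+ q) => X1 P1 P2 P3; ring.
have : lam%:P ^+ 2 * (g ^+ q * g) = (lam%:P * g ^+ m) ^+ 2.
  by rewrite -exprSr -two_m mulnC exprM -exprMn.
rewrite E gq; set Y := 'X^q; set T1 := _ + _ * Y; set T2 := C%:P + _ => EE.
have [Z EZ] : exists Z, (lam ^+ 2 * s ^+ q * s - A ^+ 2)%:P + (2%:R * (lam ^+ 2 * s ^+ q * be - A * B))%:P * 'X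
    + (lam ^+ 2 * s ^+ q * u2 ^+ 2 - B ^+ 2)%:P * 'X^2 = 'X^q * Z.
  exists (2%:R * (A%:P + B%:P * 'X) * T2 + Y * T2 ^+ 2 - lam%:P ^+ 2 * T1 * g).
  apply/eqP; rewrite -subr_eq0 -/Y; apply/eqP.
  transitivity (lam%:P ^+ 2 * (((s ^+ q)%:P + Y * T1) * g) - (A%:P + B%:P * 'X + Y * T2) ^+ 2).
    rewrite /g !(polyCB, polyCM, polyC_exp, polyC_natr); ring.
  by rewrite EE subrr.
have cf i : (i < 3)%N -> ('X^q * Z)`_i = 0 by move=> /q_low lt; rewrite coefXnM lt.
have e0 := cf 0%N isT; have e1 := cf 1%N isT; have e2 := cf 2%N isT.
move: e0 e1 e2; rewrite -EZ !coefD !coefCM !coefC !coefX !coefXn /=.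
rewrite !(mulr0, mulr1, addr0, add0r) => /eqP e0 /eqP e1 /eqP e2.
split; apply/eqP; rewrite -subr_eq0 //.
by move: e1; rewrite mulf_eq0 (negPf two_neq0).
Qed.

(** On the conic, A = 0 gives (b ^ q - b) ^ 2 = -2 A = 0. Off the conic, the three relations make g
    a constant times a square, so the line is tangent to the conic; the coefficients in degrees 0
    and q then tie the point to the tangents at the contact point and at its Frobenius image, and
    this forces lam ^ 2 = 1. *)
Lemma flex_rational : (u1, u2) != (0, 0) -> b ^+ q = b /\ 2%:R * a = b ^+ 2.
Proof.
move=> u0; have [e0 e1 e2] := flex_square.
have [s0|sn] := eqVneq s 0.
  have a2 : b ^+ 2 = 2%:R * a by apply/eqP; rewrite -subr_eq0 -/s s0.
  have A0 : A = 0.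
    by move: e0; rewrite s0 mulr0 => /esym/eqP; rewrite sqrf_eq0 => /eqP.
  split=> //; apply/eqP; rewrite -subr_eq0 -sqrf_eq0.
  have b2q : b ^+ q ^+ 2 = 2%:R * a ^+ q by rewrite exprAC a2 exprMn frob2.
  rewrite sqrrB b2q a2 -mulr_natl; apply/eqP; transitivity (- (2%:R * A)).
    by rewrite /A exprSr; ring.
  by rewrite A0 mulr0 oppr0.
exfalso.
have An : A != 0.
  by rewrite -sqrf_eq0 -e0 !mulf_neq0 ?expf_neq0.
have [r BE] : exists r, B = A * r by exists (B / A); rewrite mulrC divfK.
have A2 : A ^+ 2 != 0 by rewrite expf_neq0.
have beE : be = s * r.
  apply: (mulfI A2); transitivity (s * (lam ^+ 2 * s ^+ q * be)); last by rewrite e1 BE; ring.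
  by rewrite -e0; ring.
have gaE : u2 ^+ 2 = s * r ^+ 2.
  apply: (mulfI A2); transitivity (s * (lam ^+ 2 * s ^+ q * u2 ^+ 2)); last by rewrite e2 BE; ring.
  by rewrite -e0; ring.
have gE : g = s%:P * (1 + r%:P * 'X) ^+ 2.
  by rewrite /g beE gaE !(polyCB, polyCM, polyC_exp, polyC_natr); ring.
have [R E] := flex_expand.
have E' : lam%:P * g ^+ m = (lam * s ^+ m)%:P * ((1 + r%:P * 'X) * (1 + (r ^+ q)%:P * 'X^q)).
  have := frobP 1 r; rewrite !polyC1 expr1n polyC1 => fr.
  by rewrite gE exprMn -exprM two_m exprS fr (polyCM lam) (polyC_exp m s) !mulrA.
have [c cE] : exists c, c = lam * s ^+ m by eexists.
have {E E'} E : c%:P + (c * r)%:P * 'X + (c * r ^+ q)%:P * 'X^q + (c * r * r ^+ q)%:P * 'X^(q.+1) =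
    A%:P + B%:P * 'X + C%:P * 'X^q + 'X^(q.+1) * R.
  have := E; rewrite E' -cE => E2; rewrite !polyCM exprSr.
  transitivity (c%:P * ((1 + r%:P * 'X) * (1 + (r ^+ q)%:P * 'X^q))); first by ring.
  by rewrite E2; ring.
have cf i := congr1 (fun P : {poly K} => P`_i) E.
have q2 := q_gt2.
have cA : c = A.
  have := cf 0%N; rewrite !coefD !coefCM !coefC !coefX !coefXn coefXnM /= eq_sym.
  have -> : (q == 0)%N = false by move: q2; clear; lia.
  by rewrite !(mulr0, addr0).
have cC : c * r ^+ q = C.
  have := cf q; rewrite !coefD !coefCM !coefC !coefX !coefXn coefXnM /= eqxx ltnS leqnn.
  have -> : (q == 0)%N = false by move: q2; clear; lia.
  have -> : (q == 1)%N = false by move: q2; clear; lia.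
  have -> : (q == q.+1)%N = false by clear; lia.
  by rewrite !(mulr0, mulr1, addr0, add0r).
have rn : r != 0.
  apply: contraNneq u0 => r0; move: gaE beE; rewrite r0 expr0n !mulr0 => /eqP.
  rewrite sqrf_eq0 => /eqP u20; rewrite /be u20 mulr0 sub0r => /eqP; rewrite oppr_eq0 => /eqP->.
  by [].
(* (w1, w2) is the point of parameter -1/r, where the line touches the conic. [h1] and [h4] put (a,
   b) on the tangents at this point and at its Frobenius image; [h3] and [h5] do the same for (a ^
   q, b ^ q). *)
have [w2 u2E] : exists w2, u2 = (b - w2) * r.
  by exists (b - u2 / r); rewrite opprB addrC subrK divfK.
have [w1 u1E] : exists w1, u1 = (a - w1) * r.
  by exists (a - u1 / r); rewrite opprB addrC subrK divfK.
have canc z z' : z * r = z' * r -> z = z' by move/(mulIf rn).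
have cancq z z' : z * r ^+ q = z' * r ^+ q -> z = z' by move/(mulIf (expf_neq0 q rn)).
have h1 : b * w2 - w1 = a.
  have : (b * (b - w2) - (a - w1)) * r = s * r.
    by rewrite -beE /be u2E u1E; ring.
  move/canc; rewrite /s => h; apply/eqP; rewrite -subr_eq0; apply/eqP.
  transitivity (b ^+ 2 - 2%:R * a - (b * (b - w2) - (a - w1))); first by ring.
  by rewrite h subrr.
have h2 : w2 ^+ 2 = 2%:R * w1.
  have : (b - w2) ^+ 2 * (r ^+ 2) = s * r ^+ 2 by rewrite -gaE u2E exprMn.
  move/(mulIf (expf_neq0 2 rn)); rewrite /s -h1 => h; apply/eqP; rewrite -subr_eq0; apply/eqP.
  transitivity ((b - w2) ^+ 2 - (b ^+ 2 - 2%:R * (b * w2 - w1))); first by ring.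
  by rewrite h subrr.
have h3 : b ^+ q * w2 - w1 = a ^+ q.
  have : (b ^+ q * (b - w2) - (a - w1)) * r = A * r.
    by rewrite -BE /B u2E u1E; ring.
  move/canc; rewrite /A exprSr => h; apply/eqP; rewrite -subr_eq0; apply/eqP.
  transitivity (b ^+ q * b - a ^+ q - a - (b ^+ q * (b - w2) - (a - w1))); first by ring.
  by rewrite h subrr.
have h4 : b * w2 ^+ q - w1 ^+ q = a.
  have : (b * (b ^+ q - w2 ^+ q) - (a ^+ q - w1 ^+ q)) * r ^+ q = A * r ^+ q.
    by rewrite -cA cC /C u2E u1E !exprMn !(frobB idK); ring.
  move/cancq; rewrite /A exprS => h; apply/eqP; rewrite -subr_eq0; apply/eqP.
  transitivity (b * b ^+ q - a ^+ q - a - (b * (b ^+ q - w2 ^+ q) - (a ^+ q - w1 ^+ q))); first by ring.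
  by rewrite h subrr.
have h2q : w2 ^+ q ^+ 2 = 2%:R * w1 ^+ q by rewrite exprAC h2 exprMn frob2.
have h5 : b ^+ q * w2 ^+ q - w1 ^+ q = a ^+ q by rewrite -exprMn -(frobB idK) h1.
pose d := w2 ^+ q - w2.
have d1 : d * (2%:R * b - (w2 ^+ q + w2)) = 0.
  transitivity (2%:R * (b * w2 ^+ q - w1 ^+ q) - 2%:R * (b * w2 - w1) + (2%:R * w1 ^+ q - w2 ^+ q ^+ 2)
    - (2%:R * w1 - w2 ^+ 2)); first by rewrite /d; ring.
  by rewrite h4 h1 -h2 -h2q !subrr; ring.
have d2 : d * (2%:R * b ^+ q - (w2 ^+ q + w2)) = 0.
  transitivity (2%:R * (b ^+ q * w2 ^+ q - w1 ^+ q) - 2%:R * (b ^+ q * w2 - w1) + (2%:R * w1 ^+ q - w2 ^+ q ^+ 2)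
    - (2%:R * w1 - w2 ^+ 2)); first by rewrite /d; ring.
  by rewrite h5 h3 -h2 -h2q !subrr; ring.
have mm : s ^+ m = s * s ^+ m.-1 by rewrite -exprS prednK //; move: two_m; clear; lia.
(* If the contact point is rational, A and s are the powers q + 1 and 2 of b - w2, whence lam =
   1. *)
have [d0|dn] := eqVneq d 0.
  have w2q : w2 ^+ q = w2 by apply/eqP; rewrite -subr_eq0 -/d d0.
  have AE : A = (b - w2) ^+ q.+1.
    rewrite exprSr (frobB idK) w2q /A -h3 exprSr -{1}h1 -[in LHS](mul1r w1).
    transitivity (b ^+ q * b - b ^+ q * w2 - b * w2 + 2%:R * w1); first by ring.
    by rewrite -h2; ring.
  have sE : s = (b - w2) ^+ 2.
    by rewrite /s -h1 mulrBr -h2; ring.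
  have : lam * s ^+ m = 1 * s ^+ m by rewrite mul1r -cE cA AE sE -exprM two_m.
  by move/(mulIf (expf_neq0 m sn))/eqP; rewrite (negPf lam1).
(* Two distinct tangents meet in one point, so (a, b) equals its Frobenius image; then A = s and lam
   ^ 2 = 1. *)
move/eqP: d1; rewrite mulf_eq0 (negPf dn) subr_eq0 => /eqP b1.
move/eqP: d2; rewrite mulf_eq0 (negPf dn) subr_eq0 -b1 => /eqP b2.
have bq : b ^+ q = b by apply: (mulfI two_neq0).
have aq : a ^+ q = a by rewrite -h3 bq h1.
have sq : s ^+ q = s by rewrite /s (frobB idK) exprAC bq exprMn aq frob2.
have As : A = s by rewrite /A /s exprSr bq aq; ring.
have : (lam * s ^+ m.-1) * s = 1 * s by rewrite mul1r -{3}As -cA cE mm; ring.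
move/(mulIf sn) => l1.
have : lam ^+ 2 * s ^+ q.-1 = 1.
  rewrite -[RHS](expr1n _ 2) -l1 exprMn -exprM; congr (_ * _ ^+ _).
  by move: two_m; clear; lia.
have -> : s ^+ q.-1 = 1.
  by apply: (mulIf sn); rewrite mul1r -exprSr prednK.
move/eqP; rewrite mulr1 sqrf_eq1 => /orP[]/eqP l; first by move: lam1; rewrite l eqxx.
by move: lamN1; rewrite l eqxx.
Qed.

End Flex.

Variables (F : fieldType) (iota : {rmorphism K -> F}).
Local Notation ev := (evB iota).
Local Notation fF := (fval q (iota lam)).

(** The conditions of [is_function_field], stated for K[x][y]; [function_field_chart] links the
    two. *)
Record chart (x y : F) : Prop := Chart {
  chart_root : fF x y = 0;
  chart_ker : forall G, ev x y G = 0 -> exists H, G = fBq * H;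
  chart_gen : forall z, exists G H, ev x y H != 0 /\ z = ev x y G / ev x y H }.

Section OneChart.
Variables (x y : F) (chi : chart x y).

(** N has y-degree 0, while nonzero multiples of f have y-degree at least q + 1. *)
Lemma chart_poly_neq0 (N : {poly K}) : N != 0 -> (map_poly iota N).[x] != 0.
Proof.
move=> N0; apply/eqP; rewrite -(evB_C iota x y) => /(chart_ker chi)[H E].
have H0 : H != 0.
  by apply: contraNneq N0 => H0; move/eqP: E; rewrite H0 mulr0 polyC_eq0.
have f0 : fBq != 0 by rewrite -size_poly_gt0 (size_fB q_odd lam1).
have := congr1 (fun g : {poly {poly K}} => size g) E.
rewrite size_mul // (size_fB q_odd lam1) size_polyC N0 => e.
by move: H0; rewrite -size_poly_gt0; move: q0 e; clear; lia.
Qed.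

(** Plays the part of the norm to K(x): the order of an element of K[x, y] at a point is bounded by
    that of a polynomial in x. *)
Lemma chart_norm G : ev x y G != 0 -> exists W (N : {poly K}),
  N != 0 /\ ev x y W * ev x y G = (map_poly iota N).[x].
Proof.
move=> G0; have [|U [W [N [N0 E]]]] := @fB_bezout K q lam q_odd q1 lam1 G.
  case=> H E; move/eqP: G0; apply.
  by rewrite E evBM evB_fB (chart_root chi) mul0r.
exists W, N; split=> //; rewrite -(evB_C iota x y) -E evBD !evBM.
by rewrite evB_fB (chart_root chi) mulr0 add0r.
Qed.

(** * The local ring at an affine point and its valuation *)

Section Point.
Variables (a b : K) (fab : fK a b = 0).

(* R is the coordinate ring K[x, y]; c is the value of z at (a, b). *)
Definition valR (z : F) (c : K) := exists2 G, ev x y G = z & evB idfun a b G = c.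

Lemma valR_uniq z c c' : valR z c -> valR z c' -> c = c'.
Proof.
case=> G Gz <- [H Hz <-]; have : ev x y (G - H) = 0 by rewrite evBB Gz Hz subrr.
case/(chart_ker chi) => L E; apply/eqP; rewrite -subr_eq0 -evBB E evBM.
by rewrite evB_fB fab mul0r.
Qed.

Lemma valRD z c z' c' : valR z c -> valR z' c' -> valR (z + z') (c + c').
Proof. by case=> G <- <- [H <- <-]; exists (G + H); rewrite evBD. Qed.

Lemma valRM z c z' c' : valR z c -> valR z' c' -> valR (z * z') (c * c').
Proof. by case=> G <- <- [H <- <-]; exists (G * H); rewrite evBM. Qed.

Lemma valRK c : valR (iota c) c.
Proof. by exists c%:P%:P; rewrite evB_CC. Qed.

Lemma valRN z c : valR z c -> valR (- z) (- c).
Proof. by case=> G <- <-; exists (- G); rewrite evBN. Qed.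

Lemma valRB z c z' c' : valR z c -> valR z' c' -> valR (z - z') (c - c').
Proof. by move=> h /valRN; apply: valRD. Qed.

Lemma valRX z c n : valR z c -> valR (z ^+ n) (c ^+ n).
Proof. by case=> G <- <-; exists (G ^+ n); rewrite evBX. Qed.

Lemma valR_nat n : valR n%:R n%:R.
Proof. by exists n%:R; rewrite evB_nat. Qed.

Lemma valR_sum n (E : nat -> F) (e : nat -> K) :
  (forall i, valR (E i) (e i)) -> valR (\sum_(i < n) E i) (\sum_(i < n) e i).
Proof.
move=> h; elim: n => [|n IH]; last by rewrite !big_ord_recr; apply: valRD.
by rewrite !big_ord0; have := valRK 0; rewrite rmorph0.
Qed.

Lemma valR_x : valR x a. Proof. by exists 'X%:P; rewrite evB_x. Qed.
Lemma valR_y : valR y b. Proof. by exists 'X; rewrite evB_y. Qed.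

Lemma valR_poly (P : {poly K}) : valR (map_poly iota P).[x] P.[a].
Proof. by exists P%:P; rewrite evB_C // map_poly_id. Qed.

Lemma valR_polyy (P : {poly K}) : valR (map_poly iota P).[y] P.[b].
Proof. by exists (map_poly polyC P); rewrite evB_lift // map_poly_id. Qed.

Lemma valR_fsum u v u' v' cu cv cu' cv' : valR u cu -> valR v cv ->
  valR u' cu' -> valR v' cv' -> valR (fsum q u v u' v') (fsum q cu cv cu' cv').
Proof.
move=> hu hv hu' hv'.
apply: (@valR_sum _ (fun i => (v ^+ 2 - 2%:R * u) ^+ (m.-1 - i) * (v' ^+ 2 - 2%:R * u') ^+ i)
  (fun i => (cv ^+ 2 - 2%:R * cu) ^+ (m.-1 - i) * (cv' ^+ 2 - 2%:R * cu') ^+ i)) => i.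
have h z z' cz cz' : valR z cz -> valR z' cz' ->
    valR (z ^+ 2 - 2%:R * z') (cz ^+ 2 - 2%:R * cz').
  by move=> hz hz'; apply: valRB; [exact: valRX | apply: valRM => //; exact: valR_nat].
by apply: valRM; apply: valRX; apply: h.
Qed.

Lemma fsum_diag (R : comNzRingType) (u v : R) :
  fsum q u v u v = m%:R * (v ^+ 2 - 2%:R * u) ^+ m.-1.
Proof.
rewrite /fsum -/m (eq_bigr (fun=> (v ^+ 2 - 2%:R * u) ^+ m.-1)).
  by rewrite sumr_const card_ord [RHS]mulr_natl.
move=> i _; rewrite -exprD subnK // -ltnS prednK ?ltn_ord //.
exact: leq_ltn_trans (ltn_ord i).
Qed.

Let idK : {rmorphism K -> K} := [the {rmorphism K -> K} of idfun].

Let pred_q : (0 < q.-1)%N. Proof. by have := q_gt2; lia. Qed.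

Lemma valR_ftay1 v : valR v b ->
  valR (ftay1 q (iota lam) x y (iota a) v) (slope lam a b - 1).
Proof.
move=> vb; have h := valR_fsum valR_x valR_y (valRK a) vb.
have := valRD (valRB (valRN (valRX q.-1 (valRB valR_x (valRK a)))) (valRK 1))
  (valRM (valRM (valR_nat 2) (valRK lam)) h).
rewrite rmorph1 fsum_diag subrr expr0n -/(ftay1 q (iota lam) x y (iota a) v) mulrACA.
have -> : (q.-1 == 0)%N = false by move: pred_q; clear; lia.
by rewrite (two_m1 idK) mul1r oppr0 sub0r addrC.
Qed.

Lemma valR_ftay2 u : valR u a ->
  valR (ftay2 q (iota lam) u y (iota a) (iota b)) (b ^+ q - b * slope lam a b).
Proof.
move=> ua; have h := valR_fsum ua valR_y (valRK a) (valRK b).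
have := valRB (valRD (valRM (valRX q.-1 (valRB valR_y (valRK b))) valR_y) (valRX q (valRK b)))
  (valRM (valRM (valRK lam) (valRD valR_y (valRK b))) h).
rewrite fsum_diag subrr expr0n -/(ftay2 q (iota lam) u y (iota a) (iota b)).
have -> : (q.-1 == 0)%N = false by move: pred_q; clear; lia.
rewrite mul0r add0r; congr (valR _ (_ - _)).
rewrite /slope; move: (_ ^+ m.-1) (two_m1 idK) => W; move: (m%:R) => mm e.
by transitivity ((2%:R * mm) * (b * (lam * W))); [ring | rewrite e mul1r].
Qed.

Lemma curve_taylor v :
  fF x y = fF (iota a) v + (x - iota a) * ftay1 q (iota lam) x y (iota a) v +
   (y - v) * ftay2 q (iota lam) x y (iota a) v.
Proof. by apply: fval_taylor => // *; apply: (frobB iota). Qed.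

Lemma valR_taylor z : valR z 0 -> exists G1 g1 G2 g2,
  [/\ valR G1 g1, valR G2 g2 & z = (x - iota a) * G1 + (y - iota b) * G2].
Proof.
have T : forall G : {poly {poly K}}, exists G1 G2,
    G = (evB idfun a b G)%:P%:P + ('X%:P - a%:P%:P) * G1 + ('X - b%:P%:P) * G2.
  elim/evB_ind => [c|||G H [G1 [G2 eG]] [H1 [H2 eH]]|G H [G1 [G2 eG]] [H1 [H2 eH]]].
  - by exists 0, 0; rewrite evB_CC !mulr0 !addr0.
  - by exists 1, 0; rewrite evB_x mulr1 mulr0 addr0 addrC subrK.
  - by exists 0, 1; rewrite evB_y mulr1 mulr0 addr0 addrC subrK.
  - exists (G1 + H1), (G2 + H2); rewrite evBD !polyCD {1}eG {1}eH.
    by move: (_%:P%:P) (_%:P%:P) => ? ?; ring.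
  exists (G1 * H + (evB idfun a b G)%:P%:P * H1), (G2 * H + (evB idfun a b G)%:P%:P * H2).
  rewrite evBM !polyCM {1}eG [in LHS]mulrDl [in LHS]mulrDl {1}eH.
  by move: (_%:P%:P) => ?; ring.
case=> G <- G0; have [G1 [G2 E]] := T G.
exists (ev x y G1), (evB idfun a b G1), (ev x y G2), (evB idfun a b G2).
split; [by exists G1 | by exists G2 |].
by rewrite {1}E G0 !polyC0 add0r evBD !evBM !evBB evB_x evB_y !evB_CC.
Qed.

Lemma valR0_sub_x : valR (x - iota a) 0.
Proof. by rewrite -(subrr a); apply: valRB valR_x (valRK a). Qed.

Lemma valR0_sub_y : valR (y - iota b) 0.
Proof. by rewrite -(subrr b); apply: valRB valR_y (valRK b). Qed.

Lemma valR_neq0 z c : valR z c -> c != 0 -> z != 0.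
Proof.
move=> h; apply: contraNneq => z0; rewrite z0 in h.
by have := valRK 0; rewrite rmorph0 => /(valR_uniq h) ->.
Qed.

(** [unif_div] says that t generates the maximal ideal of the local ring, U being a denominator.
    [unif_x] gives polynomials in x a finite order, and through [chart_norm] every nonzero element
    of F. *)
Record unif (t : F) : Prop := Unif {
  unif_neq0 : t != 0;
  unif_val : valR t 0;
  unif_div : forall z, valR z 0 -> exists U u G g,
    [/\ valR U u, u != 0, valR G g & U * z = t * G];
  unif_x : exists e A ca B cb,
    [/\ valR A ca, ca != 0, valR B cb, cb != 0 & B * (x - iota a) = t ^+ e * A] }.

Lemma ev_small_neq0 (G : {poly {poly K}}) : G != 0 -> (size G < q.+2)%N -> ev x y G != 0.
Proof.
move=> G0 sG; apply/eqP => /(chart_ker chi)[H E].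
have H0 : H != 0 by apply: contraNneq G0 => H0; rewrite E H0 mulr0.
have f0 : fBq != 0 by rewrite -size_poly_gt0 (size_fB q_odd lam1).
move: sG; rewrite E size_mul // (size_fB q_odd lam1).
by move: H0; rewrite -size_poly_gt0; move: (size H) => n; clear; lia.
Qed.

Lemma sub_x_neq0 : x - iota a != 0.
Proof.
have := chart_poly_neq0 (negbT (polyXsubC_eq0 a)); rewrite rmorphB /= map_polyX map_polyC.
by rewrite hornerXsubC.
Qed.

Lemma sub_y_neq0 : y - iota b != 0.
Proof.
have := @ev_small_neq0 ('X - b%:P%:P); rewrite evBB evB_y evB_CC; apply.
  by rewrite polyXsubC_eq0.
by rewrite size_XsubC !ltnS.
Qed.

Lemma curve_eq_xy : (x - iota a) * ftay1 q (iota lam) x y (iota a) (iota b) +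
  (y - iota b) * ftay2 q (iota lam) x y (iota a) (iota b) = 0.
Proof.
have := curve_taylor (iota b); rewrite (chart_root chi).
by rewrite -rmorph_fval fab rmorph0 add0r => <-.
Qed.

(** When f_y is nonzero at the point, [curve_eq_xy] makes y - b a multiple of x - a in the local
    ring. *)
Lemma unif_sub_x : b ^+ q - b * slope lam a b != 0 -> unif (x - iota a).
Proof.
move=> d; split; [exact: sub_x_neq0 | exact: valR0_sub_x | |]; last first.
  exists 1%N, 1, 1, 1, 1; rewrite oner_neq0 expr1 mul1r mulr1.
  by have := valRK 1; rewrite rmorph1.
move=> z /valR_taylor[G1 [g1 [G2 [g2 [h1 h2 ->]]]]].
have v1 := valR_ftay1 (valRK b); have v2 := valR_ftay2 valR_x.
do 4!eexists; split; [exact: v2 | exact: d | exact: (valRB (valRM v2 h1) (valRM v1 h2)) |].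
have := curve_eq_xy.
move: (ftay1 _ _ _ _ _ _) (ftay2 _ _ _ _ _ _) (x - _) (y - _) => f1 f2 X Y e.
rewrite mulrDr mulrBr [f2 * (X * G1)]mulrCA; congr (_ + _).
by apply/eqP; rewrite -subr_eq0 opprK -(mul0r G2) -e; apply/eqP; ring.
Qed.

Lemma unif_sub_y : slope lam a b != 1 -> unif (y - iota b).
Proof.
rewrite -subr_eq0 => d; split; [exact: sub_y_neq0 | exact: valR0_sub_y | |].
  move=> z /valR_taylor[G1 [g1 [G2 [g2 [h1 h2 ->]]]]].
  have v1 := valR_ftay1 (valRK b); have v2 := valR_ftay2 valR_x.
  do 4!eexists; split; [exact: v1 | exact: d | exact: (valRB (valRM v1 h2) (valRM v2 h1)) |].
  have := curve_eq_xy.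
  move: (ftay1 _ _ _ _ _ _) (ftay2 _ _ _ _ _ _) (x - _) (y - _) => f1 f2 X Y e.
  rewrite mulrDr mulrBr [f1 * (Y * G2)]mulrCA addrC; congr (_ + _).
  by apply/eqP; rewrite -subr_eq0 opprK -(mul0r G1) -e; apply/eqP; ring.
(* Moving only x, the Taylor identity reads f(a, y) = -(x - a) times a unit, and f(a, Y) is a power
   of Y - b times a polynomial that does not vanish at b. *)
pose f0 := map_poly (horner_eval a) fBq.
have f0n : f0 != 0.
  apply/eqP => f0n; have : f0`_q.+1 = 0 by rewrite f0n coef0.
  rewrite coef_map /= (coef_fB_top lam q_odd) /horner_eval hornerC => /eqP.
  by rewrite subr_eq0 eq_sym (negPf lam1).
have [e [k0 nr E]] := multiplicity_XsubC f0 b.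
have {}nr : k0.[b] != 0 by move: nr; rewrite f0n.
exists e, (- (map_poly iota k0).[y]), (- k0.[b]), (ftay1 q (iota lam) x y (iota a) y),
  (slope lam a b - 1).
split; [exact: (valRN (valR_polyy k0)) | by rewrite oppr_eq0
       | exact: (valR_ftay1 valR_y) | exact: d |].
have := curve_taylor y; rewrite (chart_root chi) subrr mul0r addr0 -horner_fB_at -/f0 E.
rewrite rmorphM rmorphXn rmorphB /= map_polyX map_polyC /= hornerM horner_exp hornerXsubC.
move=> /esym/eqP; rewrite addr_eq0 => /eqP; rewrite mulrN mulrC => ->.
by rewrite opprK mulrC.
Qed.

(** z = t ^ (n - n') A / B with A and B units at the point; the pair of exponents avoids negative
    powers. *)
Definition ord_at (t z : F) (d : int) := exists n n' A ca B cb,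
  [/\ valR A ca, ca != 0, valR B cb, cb != 0 & t ^+ n' * B * z = t ^+ n * A /\ d = n%:Z - n'%:Z].

Section Unif.
Variables (t : F) (ut : unif t).

Lemma valRt n : valR (t ^+ n.+1) 0.
Proof. by have := valRX n.+1 (unif_val ut); rewrite expr0n. Qed.

Lemma unif_pow_eq i j A ca B cb : valR A ca -> ca != 0 -> valR B cb -> cb != 0 ->
  t ^+ i * A = t ^+ j * B -> i = j.
Proof.
have W : forall i j A ca B cb, valR A ca -> ca != 0 -> valR B cb ->
    t ^+ i * A = t ^+ j * B -> (j <= i)%N.
  move=> {}i {}j {}A {}ca {}B {}cb hA a0 hB E; rewrite leqNgt; apply/negP => lt.
  move: E; rewrite -(subnKC lt) addSnnS exprD -mulrA => /(mulfI (expf_neq0 _ (unif_neq0 ut))) E.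
  have := valRM (valRt (j - i.+1)) hB; rewrite -E => /(valR_uniq hA) e.
  by move: a0; rewrite e mul0r eqxx.
move=> hA a0 hB b0 E; apply/eqP; rewrite eqn_leq; apply/andP; split.
  exact: (W _ _ _ _ _ _ hB b0 hA (esym E)).
exact: (W _ _ _ _ _ _ hA a0 hB E).
Qed.

Lemma ord_at_uniq z d d' : z != 0 -> ord_at t z d -> ord_at t z d' -> d = d'.
Proof.
move=> z0 [n [n' [A [ca [B [cb [hA a0 hB b0 [E ->]]]]]]]].
move=> [i [i' [C [cc [D [cd [hC c0 hD d0 [E' ->]]]]]]]].
have : t ^+ (n + i') * (A * D) = t ^+ (i + n') * (C * B).
  by rewrite !exprD mulrACA -E [RHS]mulrACA -E'; ring.
move/(unif_pow_eq (valRM hA hD) (mulf_neq0 a0 d0) (valRM hC hB) (mulf_neq0 c0 b0)).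
by clear; lia.
Qed.

Lemma ord_atM z z' d d' : ord_at t z d -> ord_at t z' d' -> ord_at t (z * z') (d + d').
Proof.
move=> [n [n' [A [ca [B [cb [hA a0 hB b0 [E ->]]]]]]]].
move=> [i [i' [C [cc [D [cd [hC c0 hD d0 [E' ->]]]]]]]].
exists (n + i)%N, (n' + i')%N, (A * C), (ca * cc), (B * D), (cb * cd).
split; rewrite ?mulf_neq0 //; [exact: valRM | exact: valRM |].
split; last by clear; lia.
by rewrite !exprD (mulrACA (t ^+ n)) -E -E'; ring.
Qed.

Lemma ord_atV z d : z != 0 -> ord_at t z d -> ord_at t z^-1 (- d).
Proof.
move=> z0 [n [n' [A [ca [B [cb [hA a0 hB b0 [E ->]]]]]]]].
exists n', n, B, cb, A, ca; split=> //; split; last by clear; lia.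
by rewrite -E mulfK.
Qed.

Lemma ord_at_val z c : valR z c -> c != 0 -> ord_at t z 0.
Proof.
move=> h c0; exists 0%N, 0%N, z, c, 1, 1; rewrite oner_neq0 expr0 !mul1r subrr.
by split=> //; have := valRK 1; rewrite rmorph1.
Qed.

Lemma ord_atX z d n : ord_at t z d -> ord_at t (z ^+ n) (d * n%:Z).
Proof.
move=> h; elim: n => [|n IH].
  rewrite expr0 mulr0; apply: (@ord_at_val 1 1); rewrite ?oner_neq0 //.
  by have := valRK 1; rewrite rmorph1.
rewrite exprS (_ : d * n.+1%:Z = d + d * n%:Z); last by clear; lia.
exact: ord_atM.
Qed.

Lemma ord_at_poly_x (N : {poly K}) : N != 0 -> exists d, ord_at t (map_poly iota N).[x] d.
Proof.
move=> N0; have [e [N1 nr ->]] := multiplicity_XsubC N a.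
have {}nr : N1.[a] != 0 by move: nr; rewrite N0.
rewrite rmorphM rmorphXn rmorphB /= map_polyX map_polyC hornerM horner_exp hornerXsubC.
have [e1 [A [ca [B [cb [hA a0 hB b0 E]]]]]] := unif_x ut.
exists (0 + (e1%:Z - 0%:Z) * e%:Z); apply: ord_atM.
  exact: ord_at_val (valR_poly N1) nr.
apply: ord_atX; exists e1, 0%N, A, ca, B, cb; split=> //.
by rewrite expr0 mul1r.
Qed.

Lemma ord_at_valR_exists z c : z != 0 -> valR z c -> exists d, ord_at t z d.
Proof.
move=> z0 hz; have [G Gz _] := hz.
have [|W [N [N0 E]]] := @chart_norm G; first by rewrite Gz.
rewrite Gz in E; have hW : valR (ev x y W) (evB idfun a b W) by exists W.
have [d [n [n' [A [ca [B [cb [hA a0 hB b0 [EN _]]]]]]]]] := ord_at_poly_x N0.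
(* Divide by t until a unit remains. More than n divisions are impossible, since z divides N(x),
   whose order is n - n'. *)
have step : forall j, (exists d, ord_at t z d) \/ exists U u G' g,
    [/\ valR U u, u != 0, valR G' g & U * z = t ^+ j * G'].
  elim=> [|j [|[U [u [G' [g [hU u0 hG' EU]]]]]]]; [right | by left |].
    exists 1, 1, z, c; rewrite oner_neq0 expr0; split=> //.
    by have := valRK 1; rewrite rmorph1.
  have [g0|g0] := eqVneq g 0; last first.
    left; exists (j%:Z - 0%:Z), j, 0%N, G', g, U, u; split=> //.
    by rewrite expr0 mul1r.
  rewrite g0 in hG'; have [U1 [u1 [G1 [g1 [hU1 u10 hG1 E1]]]]] := unif_div ut hG'.
  right; exists (U1 * U), (u1 * u), G1, g1; split; rewrite ?mulf_neq0 //.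
    exact: valRM.
  by rewrite -mulrA EU mulrCA E1 exprSr mulrA.
case: (step n.+1) => // -[U [u [G' [g [hU u0 hG' EU]]]]].
have : U * A = t ^+ n'.+1 * (B * (ev x y W * G')).
  apply: (mulfI (expf_neq0 n (unif_neq0 ut))).
  rewrite mulrCA -EN -E.
  rewrite (_ : U * _ = t ^+ n' * B * ev x y W * (U * z)); last by ring.
  by rewrite EU !exprS; ring.
move=> e; have := valRM (valRt n') (valRM hB (valRM hW hG')); rewrite -e mul0r.
move/(valR_uniq (valRM hU hA))/eqP.
by rewrite mulf_eq0 (negPf u0) (negPf a0).
Qed.

Lemma ord_at_exists z : z != 0 -> exists d, ord_at t z d.
Proof.
move=> z0; have [G [H [H0 E]]] := chart_gen chi z.
have G0 : ev x y G != 0 by apply: contraNneq z0 => G0; rewrite E G0 mul0r.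
have [|d1 h1] := @ord_at_valR_exists (ev x y G) (evB idfun a b G) G0; first by exists G.
have [|d2 h2] := @ord_at_valR_exists (ev x y H) (evB idfun a b H) H0; first by exists H.
by exists (d1 - d2); rewrite E; apply: ord_atM => //; apply: ord_atV.
Qed.

Definition ord_fun (z : F) : int :=
  match excluded_middle_informative (z != 0) with
  | left z0 => proj1_sig (constructive_indefinite_description _ (ord_at_exists z0))
  | right _ => 0
  end.

Lemma ord_funP z : z != 0 -> ord_at t z (ord_fun z).
Proof.
move=> z0; rewrite /ord_fun; case: excluded_middle_informative => // h.
by case: constructive_indefinite_description.
Qed.

Lemma ord_funE z d : z != 0 -> ord_at t z d -> ord_fun z = d.
Proof. by move=> z0 h; apply: ord_at_uniq z0 (ord_funP z0) h. Qed.

Definition locR z c := exists A ca B cb,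
  [/\ valR A ca, valR B cb, cb != 0, B * z = A & c = ca / cb].

Lemma ord_fun_locR z (n : nat) : vge ord_fun n%:Z z ->
  exists2 c, locR z c & (0 < n)%N -> c = 0.
Proof.
have [->|z0] := eqVneq z 0.
  move=> _; exists 0 => //; exists 0, 0, 1, 1; rewrite oner_neq0 mul0r mulr0.
  by split=> //; [have := valRK 0; rewrite rmorph0 | have := valRK 1; rewrite rmorph1].
rewrite vgeE //; have [i [i' [A [ca [B [cb [hA a0 hB b0 [E ->]]]]]]]] := ord_funP z0.
move=> le; have li : (i' + n <= i)%N by move: le; clear; lia.
pose c := if (i - i' == 0)%N then ca else 0.
exists (c / cb); last first.
  by move=> n0; rewrite /c; case: eqP => [|_]; [move: li n0; clear; lia | rewrite mul0r].
exists (t ^+ (i - i') * A), c, B, cb; split=> //.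
  rewrite /c; case: (i - i')%N => [|j] /=; first by rewrite expr0 mul1r.
  by rewrite -(mul0r ca); apply: valRM => //; apply: valRt.
apply: (mulfI (expf_neq0 i' (unif_neq0 ut))).
by rewrite mulrA E mulrA -exprD subnKC // (leq_trans _ li) // leq_addr.
Qed.

Lemma ord_at_valR_ge A ca d : valR A ca -> ord_at t A d ->
  (ca == 0)%:Z <= d.
Proof.
move=> hA hd; have [ca0|ca0] := eqVneq ca 0; last first.
  by rewrite (ord_at_uniq (valR_neq0 hA ca0) hd (ord_at_val hA ca0)).
case: hd => [n [n' [C [cc [D [cd [hC c0 hD d0 [E ->]]]]]]]].
case: (ltnP n' n) => [|le]; first by clear; lia.
exfalso; have: C = t ^+ (n' - n) * (D * A).
  apply: (mulfI (expf_neq0 n (unif_neq0 ut))).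
  by rewrite -E [RHS]mulrA -exprD subnKC // mulrA.
move=> e; have := valRM (valRX (n' - n) (unif_val ut)) (valRM hD hA).
by rewrite -e ca0 !mulr0 => /(valR_uniq hC) /eqP; rewrite (negPf c0).
Qed.

Lemma locR_vge z c : locR z c -> vge ord_fun (c == 0)%:Z z.
Proof.
move=> [A [ca [B [cb [hA hB b0 E ->]]]]].
have [->|z0] := eqVneq z 0; first exact: vge0.
have B0 := valR_neq0 hB b0.
have A0 : A != 0 by rewrite -E mulf_neq0.
rewrite vgeE //; have [d hd] := ord_at_exists A0.
have zd : ord_at t z (d + - 0).
  rewrite (_ : z = A / B); last by rewrite -E mulrC mulKf.
  by apply: ord_atM => //; apply: ord_atV => //; apply: ord_at_val hB b0.
rewrite (ord_funE z0 zd) subr0 mulf_eq0 invr_eq0 (negPf b0) orbF.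
exact: ord_at_valR_ge hA hd.
Qed.

Lemma locRD z c z' c' : locR z c -> locR z' c' -> locR (z + z') (c + c').
Proof.
move=> [A [ca [B [cb [hA hB b0 E ->]]]]] [C [cc [D [cd [hC hD d0 E' ->]]]]].
exists (A * D + C * B), (ca * cd + cc * cb), (B * D), (cb * cd).
split; rewrite ?mulf_neq0 //; [by apply: valRD; apply: valRM | exact: valRM | |].
  by rewrite -E -E'; ring.
by rewrite addf_div.
Qed.

Lemma locR_iota c : locR (iota c) c.
Proof.
exists (iota c), c, 1, 1; rewrite oner_neq0 mul1r divr1; split=> //; first exact: valRK.
by have := valRK 1; rewrite rmorph1.
Qed.

Lemma ord_funM z z' : z != 0 -> z' != 0 -> ord_fun (z * z') = ord_fun z + ord_fun z'.
Proof.
move=> z0 z0'; apply: ord_funE; first by rewrite mulf_neq0.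
by apply: ord_atM; apply: ord_funP.
Qed.

Lemma place_ord_fun : place iota ord_fun.
Proof.
split=> [||c c0||z hz].
- exact: ord_funM.
(* z + z' = z (1 + w), where w = z' / z lies in the local ring, which is closed under addition. *)
- have half : forall z z', z != 0 -> z + z' != 0 -> vge ord_fun (ord_fun z) z' ->
      ord_fun z <= ord_fun (z + z').
    move=> z z' z0 s0 h; pose w := z' / z.
    have e : z + z' = z * (1 + w) by rewrite mulrDr mulr1 mulrCA divff ?mulr1.
    have w0 : 1 + w != 0 by apply: contraNneq s0 => w0; rewrite e w0 mulr0.
    have hw : vge ord_fun 0%N%:Z w.
      rewrite /w; have [->|z0'] := eqVneq z' 0; first by rewrite mul0r vge0.
      rewrite vgeE ?mulf_neq0 ?invr_eq0 // ord_funM ?invr_eq0 //.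
      rewrite (@ord_funE z^-1 (- ord_fun z)) ?invr_eq0 //; last exact: ord_atV (ord_funP z0).
      by move: h; rewrite vgeE //; clear; lia.
    have [c hc _] := ord_fun_locR hw.
    have := locR_vge (locRD (locR_iota 1) hc); rewrite rmorph1 vgeE //.
    by rewrite e ord_funM //; case: (_ == 0); clear; lia.
  move=> z z' n; have [->|z0] := eqVneq z 0; first by rewrite add0r.
  have [->|z0'] := eqVneq z' 0; first by rewrite addr0.
  have [->|s0] := eqVneq (z + z') 0; first by rewrite vge0.
  rewrite !vgeE // => h h'; case: (leP (ord_fun z) (ord_fun z')) => le.
    by apply: le_trans h (half _ _ z0 s0 _); rewrite vgeE.
  by apply: le_trans h' _; rewrite addrC half // ?(addrC z') // vgeE // ltW.
- by apply: ord_funE; rewrite ?fmorph_eq0 //; apply: ord_at_val (valRK c) c0.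
- exists t; first exact: unif_neq0.
  apply: ord_funE; first exact: unif_neq0.
  have h1 : valR 1 1 by have := valRK 1; rewrite rmorph1.
  exists 1%N, 0%N, 1, 1, 1, 1; rewrite oner_neq0; split=> //.
  by rewrite expr0 expr1 !mul1r mulr1.
have [c hc _] := @ord_fun_locR z 0 hz.
exists c; have := locR_vge (locRD hc (locR_iota (- c))).
by rewrite subrr eqxx rmorphN.
Qed.

End Unif.

Lemma valR_slope : valR (slope (iota lam) x y) (slope lam a b).
Proof.
apply: valRM; first exact: valRK.
apply/valRX/valRB; first exact: valRX valR_y.
by apply: valRM valR_x; apply: valR_nat.
Qed.

Lemma valR_dy : valR (y ^+ q - y * slope (iota lam) x y) (b ^+ q - b * slope lam a b).
Proof. by apply: valRB; [exact: valRX valR_y | exact: valRM valR_y valR_slope]. Qed.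

(** By smoothness, x - a or y - b is a uniformiser. *)
Lemma place_at_point : exists v,
  [/\ place iota v, vge v 1 (x - iota a) & vge v 1 (y - iota b)].
Proof.
have [t ut] : exists t, unif t.
  case: (fval_smooth fab) => h; first by exists (y - iota b); apply: unif_sub_y.
  by exists (x - iota a); apply: unif_sub_x.
have L z : valR z 0 -> locR z 0.
  move=> h; exists z, 0, 1, 1; rewrite oner_neq0 mul1r mul0r; split=> //.
  by have := valRK 1; rewrite rmorph1.
exists (ord_fun ut); split; first exact: place_ord_fun.
  by have := locR_vge ut (L _ valR0_sub_x); rewrite eqxx.
by have := locR_vge ut (L _ valR0_sub_y); rewrite eqxx.
Qed.

Section Center.
Variables (v : F -> int) (pv : place iota v).
Hypotheses (vx : vge v 1 (x - iota a)) (vy : vge v 1 (y - iota b)).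

Lemma center_val z c : valR z c -> vge v 1 (z - iota c).
Proof. by case=> G <- <-; apply: vge_evB_sub. Qed.

Lemma center_unit z c : valR z c -> c != 0 -> z != 0 /\ v z = 0.
Proof. by move=> h c0; apply: (place_near pv c0); apply: center_val. Qed.

Lemma center_integral z c : valR z c -> vge v 0 z.
Proof. by move=> h; apply: (vge_integral pv (center_val h)). Qed.

Lemma center_ord_at t z d : unif t -> z != 0 -> ord_at t z d -> v z = d * v t.
Proof.
move=> ut z0 [n [n' [A [ca [B [cb [hA a0 hB b0 [E ->]]]]]]]].
have [A0 vA] := center_unit hA a0; have [B0 vB] := center_unit hB b0.
have t0 := unif_neq0 ut; have := congr1 v E.
rewrite !(placeM pv) ?mulf_neq0 ?expf_neq0 // vA vB !(placeX pv) //; move: (v t) (v z).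
by clear; lia.
Qed.

(** v is v(t) times the order at the point and takes the value 1, so v(t) = 1: a place is determined
    by its affine centre. *)
Lemma center_unif t : unif t -> v t = 1.
Proof.
move=> ut; have [z z0 vz] := place_unif pv.
have [d hd] := ord_at_exists ut z0; have := center_ord_at ut z0 hd; rewrite vz.
have := center_val (unif_val ut); rewrite rmorph0 subr0 vgeE ?(unif_neq0 ut) //.
move: (v t); clear => n e n1; suff : n <= 1 by lia.
by case: (lerP d 0) => d0; nia.
Qed.

Lemma center_sub_x : b ^+ q - b * slope lam a b != 0 -> v (x - iota a) = 1.
Proof. by move/unif_sub_x/center_unif. Qed.

Lemma center_sub_y : slope lam a b != 1 -> v (y - iota b) = 1.
Proof. by move/unif_sub_y/center_unif. Qed.

Lemma center_locR z : vge v 0 z -> exists c, locR z c.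
Proof.
have [t ut] : exists t, unif t.
  case: (fval_smooth fab) => h; first by exists (y - iota b); apply: unif_sub_y.
  by exists (x - iota a); apply: unif_sub_x.
move=> hz; suff : vge (ord_fun ut) 0%N%:Z z by case/ord_fun_locR => c; exists c.
have [->|z0] := eqVneq z 0; first exact: vge0.
move: hz; rewrite !vgeE // (center_ord_at ut z0 (ord_funP ut z0)).
by rewrite (center_unif ut) mulr1.
Qed.

Lemma locR_integral z c : locR z c -> vge v 0 z.
Proof.
move=> [A [ca [B [cb [hA hB b0 E _]]]]]; have [B0 vB] := center_unit hB b0.
have -> : z = A * B^-1 by rewrite -E mulrC mulKf.
apply: (vgeMr pv (center_integral hA)).
by rewrite vgeE ?invr_eq0 // (placeV pv) // vB.
Qed.

End Center.

End Point.
End OneChart.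

(** * Changes of chart and the place at infinity *)

Lemma transc_neq0 z (N : {poly K}) : (forall c, z != iota c) -> N != 0 -> (map_poly iota N).[z] != 0.
Proof.
move=> zc; elim: {N}(size N) {-2}N (leqnn (size N)) => [|n IH] N sN N0.
  by move: sN; rewrite leqn0 size_poly_eq0 (negPf N0).
have [/eqP/size_poly1P[c c0 ->]|sz] := eqVneq (size N) 1%N.
  by rewrite map_polyC hornerC fmorph_eq0.
have [r /factor_theorem[N1 E]] := closedK sz.
have N10 : N1 != 0 by apply: contraNneq N0 => N10; rewrite E N10 mul0r.
rewrite E rmorphM rmorphB /= map_polyX map_polyC hornerM hornerXsubC mulf_neq0 //; last by rewrite subr_eq0 zc.
by apply: IH => //; move: sN; rewrite E size_Mmonic ?monicXsubC // size_XsubC addn2.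
Qed.

(** A relation between x' and y' outside the ideal of f would give, by [fB_bezout], a nonzero
    polynomial vanishing at x'; but a nonconstant element is transcendental over the algebraically
    closed K. *)
Lemma chart_change x y x' y' : chart x y -> fF x' y' = 0 -> (forall c, x' != iota c) ->
  (exists G H, ev x' y' H != 0 /\ x = ev x' y' G / ev x' y' H) ->
  (exists G H, ev x' y' H != 0 /\ y = ev x' y' G / ev x' y' H) ->
  chart x' y'.
Proof.
move=> chi f0 xc Sx Sy; split=> // [G G0|z].
  have [//|h] := excluded_middle_informative (exists H, G = fBq * H).
  have [U [W [N [N0 E]]]] := fB_bezout q_odd q1 lam1 h.
  have /eqP[] := transc_neq0 xc N0.
  by rewrite -(evB_C iota x' y') -E evBD !evBM evB_fB f0 G0 !mulr0 addr0.
pose S z := exists G H, ev x' y' H != 0 /\ z = ev x' y' G / ev x' y' H.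
have SM a b : S a -> S b -> S (a * b).
  move=> [G [H [H0 ->]]] [G1 [H1 [H10 ->]]]; exists (G * G1), (H * H1).
  by rewrite !evBM mulf_neq0 // mulf_div.
have SD a b : S a -> S b -> S (a + b).
  move=> [G [H [H0 ->]]] [G1 [H1 [H10 ->]]]; exists (G * H1 + G1 * H), (H * H1).
  by rewrite evBD !evBM mulf_neq0 // addf_div.
have Sev G : S (ev x y G).
  elim/evB_ind: G => [c|||G H hG hH|G H hG hH].
  - by exists c%:P%:P, 1%:P%:P; rewrite !evB_CC rmorph1 oner_neq0 divr1.
  - by rewrite evB_x.
  - by rewrite evB_y.
  - by rewrite evBD; apply: SD.
  - by rewrite evBM; apply: SM.
have [G [H [H0 ->]]] := chart_gen chi z.
apply: (SM) (Sev G) _; case: (Sev H) H0 => A [B [B0 ->]] h.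
exists B, A; rewrite invf_div; split=> //.
by apply: contraNneq h => ->; rewrite mul0r.
Qed.

Lemma chart_x_transc x y : chart x y -> forall c, x != iota c.
Proof.
move=> chi c; have := chart_poly_neq0 chi (negbT (polyXsubC_eq0 c)).
by rewrite rmorphB /= map_polyX map_polyC hornerXsubC subr_eq0.
Qed.

Lemma chart_x_neq0 x y : chart x y -> x != 0.
Proof. by move/chart_x_transc/(_ 0); rewrite rmorph0. Qed.

Lemma chart_y_neq0 x y : chart x y -> y != 0.
Proof.
move=> chi; have /= := @ev_small_neq0 x y chi 'X; rewrite evB_y; apply.
  by rewrite polyX_eq0.
by rewrite size_polyX.
Qed.

(** The symmetry exchanging X and Z in the homogeneous equation. It carries the point at infinity to
    the origin. *)
Lemma chart_swap x y : chart x y -> chart x^-1 (y / x).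
Proof.
move=> chi; have x0 := chart_x_neq0 chi.
apply: (chart_change chi).
- have := chart_root chi; rewrite /fval => E.
  apply: (mulfI (expf_neq0 q.+1 x0)); rewrite mulr0 -[RHS]E !mulrBr; congr (_ - _ - _).
  + by rewrite -exprMn mulrCA divff ?mulr1.
  + by rewrite mulrDr exprVn {1}exprS exprSr !mulfK ?expf_neq0 // addrC.
  have -> : x ^+ q.+1 = (x ^+ 2) ^+ m by rewrite -exprM two_m.
  by rewrite mulrCA -exprMn; congr (_ * _ ^+ _); field.
- move=> c; rewrite -(inj_eq (@invr_inj F)) invrK -fmorphV; exact: chart_x_transc chi _.
- by exists 1%:P%:P, 'X%:P; rewrite evB_x evB_CC rmorph1 invr_eq0 invrK mul1r.
- by exists 'X, 'X%:P; rewrite evB_x evB_y invr_eq0 invrK divfK.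
Qed.

Lemma fK00 : fK 0 0 = 0.
Proof.
have qf : (q == 0)%N = false by move: q0; clear; lia.
have mf : (m == 0)%N = false by move: two_m; clear; lia.
by rewrite /fval -/m mulr0 !expr0n qf /= subr0 expr0n mf mulr0 addr0 !subr0.
Qed.

Lemma slope00 : slope lam 0 0 = 0 :> K.
Proof.
have mf : (m.-1 == 0)%N = false by move: two_m q_gt2; clear; lia.
by rewrite /slope expr0n mulr0 subr0 expr0n mf mulr0.
Qed.

Lemma origin_val_y x y v : chart x y -> place iota v -> vge v 1 x -> vge v 1 y -> v y = 1.
Proof.
move=> chi pv vx vy; have := @center_sub_y x y chi 0 0 fK00 v pv.
by rewrite rmorph0 !subr0; apply; rewrite // slope00 eq_sym oner_neq0.
Qed.

(** On the tangent x = 0 the equation reduces to (1 - lam) y ^ (q + 1), so this power of y is x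
    times a unit. *)
Lemma origin_val_x x y v : chart x y -> place iota v -> vge v 1 x -> vge v 1 y -> v x = q.+1%:Z.
Proof.
move=> chi pv vx vy; have vy1 := origin_val_y chi pv vx vy.
have x0 := chart_x_neq0 chi; have y0 := chart_y_neq0 chi.
have vx' : vge v 1 (x - iota 0) by rewrite rmorph0 subr0.
have vy' : vge v 1 (y - iota 0) by rewrite rmorph0 subr0.
have hy : valR x y 0 0 y 0 by apply: valR_y.
have [|n1 v1] := center_unit pv vx' vy' (valR_ftay1 hy).
  by rewrite slope00 sub0r oppr_eq0 oner_neq0.
have := curve_taylor x y 0 y; rewrite (chart_root chi) subrr mul0r addr0.
move: (ftay1 _ _ _ _ _ _) n1 v1 => f1 n1 v1.
rewrite rmorph0 subr0 {1}/fval -/m expr0n mulr0 subr0 addr0.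
have -> : (q == 0)%N = false by move: q0; clear; lia.
rewrite subr0 -exprM two_m -{1}[y ^+ q.+1]mul1r -mulrBl => /esym/eqP.
rewrite addr_eq0 => /eqP E.
have l0 : 1 - iota lam != 0 by rewrite -(rmorph1 iota) -rmorphB fmorph_eq0 subr_eq0 eq_sym.
have vl : v (1 - iota lam) = 0.
  by rewrite -(rmorph1 iota) -rmorphB (placeK pv) // subr_eq0 eq_sym.
have := congr1 v E; rewrite (placeM pv l0) ?expf_neq0 // vl (placeX pv) // vy1.
have vN : v (- (x * f1)) = v x.
  rewrite -mulN1r (placeM pv) ?mulf_neq0 ?oppr_eq0 ?oner_neq0 // (placeM pv) // v1 addr0.
  by rewrite -(rmorph1 iota) -rmorphN (placeK pv) ?oppr_eq0 ?oner_neq0 ?add0r.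
by rewrite vN; clear; lia.
Qed.

Definition at_inf (v : F -> int) (x y : F) := vge v 1 x^-1 /\ vge v 1 (y / x).
Definition at_pt (v : F -> int) (x y : F) (a b : K) := [/\ fK a b = 0, vge v 1 (x - iota a) & vge v 1 (y - iota b)].

Lemma place_center x y v : chart x y -> place iota v ->
  (exists a b, at_pt v x y a b) \/ at_inf v x y.
Proof.
move=> chi pv; have x0 := chart_x_neq0 chi; have y0 := chart_y_neq0 chi.
have [/andP[vx vy]|aff] := boolP (vge v 0 x && vge v 0 y).
  left; have [a ha] := place_res pv vx; have [b hb] := place_res pv vy.
  exists a, b; split=> //; apply/eqP; apply/negPn/negP => f0.
  have := vge_evB_sub pv fBq ha hb.
  rewrite !evB_fB (chart_root chi) sub0r => /(vgeN pv).
  by rewrite opprK vgeE ?fmorph_eq0 // (placeK pv).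
(* Otherwise y has a pole and x / y is integral; dividing f by y ^ (q + 1) and reducing with 1 / y
   at 0 leaves 1 - lam = 0. *)
have lt : v x < v y.
  rewrite ltNge; apply/negP => le.
  have vy : v y < 0 by move: aff; rewrite !vgeE //; move: le; clear; lia.
  have hr : vge v 1 y^-1 by rewrite vgeE ?invr_eq0 // (placeV pv) //; move: vy; clear; lia.
  have hs : vge v 0 (x / y).
    by rewrite vgeE ?mulf_neq0 ?invr_eq0 // (placeM pv) ?invr_eq0 // (placeV pv) //; move: le; clear; lia.
  pose r := y^-1; pose s := x / y.
  have E : 1 - (s ^+ q * r + s * r ^+ q) - iota lam * (1 - 2%:R * s * r) ^+ m = 0.
    have := chart_root chi; rewrite /fval -/m => E.
    apply: (mulfI (expf_neq0 q.+1 y0)); rewrite mulr0 -[RHS]E !mulrBr mulr1; congr (_ - _ - _).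
      rewrite mulrDr /s /r !exprMn !exprVn; congr (_ + _).
        by rewrite exprS; move: (y ^+ q) (expf_neq0 q y0) (x ^+ q) => Y Y0 X; field; rewrite y0 Y0.
      by rewrite exprS; move: (y ^+ q) (expf_neq0 q y0) => Y Y0; field; rewrite y0 Y0.
    have -> : y ^+ q.+1 = (y ^+ 2) ^+ m by rewrite -exprM two_m.
    by rewrite mulrCA -exprMn /s /r; congr (_ * _ ^+ _); field.
  have [s1 hs1] := place_res pv hs.
  pose G : {poly {poly K}} := 1%:P%:P - ('X%:P ^+ q * 'X + 'X%:P * 'X ^+ q) - lam%:P%:P * (1%:P%:P - 2%:R%:P%:P * 'X%:P * 'X) ^+ m.
  have GE (A : comNzRingType) (phi : {rmorphism K -> A}) s' r' : evB phi s' r' G =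
      1 - (s' ^+ q * r' + s' * r' ^+ q) - phi lam * (1 - 2%:R * s' * r') ^+ m.
    by rewrite /G !(evBB, evBD, evBM, evBX, evB_CC, evB_x, evB_y) rmorph1 rmorph_nat.
  have hr0 : vge v 1 (r - iota 0) by rewrite rmorph0 subr0.
  have := vge_evB_sub pv G hs1 hr0; rewrite !GE E sub0r => /(vgeN pv).
  rewrite opprK expr0n.
  have -> : (q == 0)%N = false by move: q0; clear; lia.
  rewrite !mulr0 addr0 !subr0 expr1n mulr1.
  have l0 : 1 - lam != 0 by rewrite subr_eq0 eq_sym.
  by rewrite vgeE ?fmorph_eq0 // (placeK pv).
have vx : v x < 0 by move: aff; rewrite !vgeE //; move: lt; clear; lia.
right; split; rewrite vgeE ?mulf_neq0 ?invr_eq0 // ?(placeM pv) ?invr_eq0 // (placeV pv) //.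
  by move: vx; clear; lia.
by move: lt; clear; lia.
Qed.

Lemma inf_val_x x y v : chart x y -> place iota v -> at_inf v x y -> v x = - q.+1%:Z.
Proof.
move=> chi pv [hu hw]; have := origin_val_x (chart_swap chi) pv hu hw.
by rewrite (placeV pv) ?(chart_x_neq0 chi) // => <-; rewrite opprK.
Qed.

Lemma inf_val_y x y v : chart x y -> place iota v -> at_inf v x y -> v y = - q%:Z.
Proof.
move=> chi pv h; have vx := inf_val_x chi pv h; case: h => hu hw.
have := origin_val_y (chart_swap chi) pv hu hw; have x0 := chart_x_neq0 chi.
by rewrite (placeM pv) ?invr_eq0 ?(chart_y_neq0 chi) // (placeV pv) // vx; clear; lia.
Qed.

Lemma place_at_inf x y : chart x y -> exists2 v, place iota v & at_inf v x y.
Proof.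
move=> chi; have [v [pv hu hw]] := place_at_point (chart_swap chi) fK00.
by exists v => //; split; [move: hu | move: hw]; rewrite rmorph0 subr0.
Qed.

(** * Regular differentials *)

Record kder (D : F -> F) : Prop := Kder {
  kderD : forall a b, D (a + b) = D a + D b;
  kderM : forall a b, D (a * b) = D a * b + a * D b;
  kderK : forall c, D (iota c) = 0 }.

Section Derivation.
Variables (D : F -> F) (dD : kder D).
Local Notation W := (slope (iota lam)).

Lemma kder0 : D 0 = 0.
Proof. by have := kderK dD 0; rewrite rmorph0. Qed.

Lemma kder1 : D 1 = 0.
Proof. by have := kderK dD 1; rewrite rmorph1. Qed.

Lemma kderN z : D (- z) = - D z.
Proof. by apply/eqP; rewrite -addr_eq0 -(kderD dD) addNr kder0. Qed.

Lemma kderX z n : D (z ^+ n) = n%:R * z ^+ n.-1 * D z.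
Proof.
elim: n => [|n IH]; first by rewrite expr0 kder1 !mul0r.
rewrite exprS (kderM dD) IH /=; case: n {IH} => [|n] /=.
  by rewrite expr0; ring.
by rewrite -[in RHS]natr1 exprS; ring.
Qed.

Lemma kderX1 z n : D (z ^+ n.+1) = n.+1%:R * z ^+ n * D z.
Proof. by rewrite kderX. Qed.

Lemma kderXq z : D (z ^+ q) = 0.
Proof. by rewrite kderX (natq0 iota) !mul0r. Qed.

Lemma kderV z : z != 0 -> D z^-1 = - D z / z ^+ 2.
Proof.
move=> z0; have : D (z * z^-1) = 0 by rewrite divff // kder1.
rewrite (kderM dD) => /eqP; rewrite addr_eq0 => /eqP e.
by apply: (mulfI z0); rewrite -[LHS]opprK -e; field.
Qed.

(* [D] is [c] times the derivation f_y d/dx - f_x d/dy, where f_y is [y ^+ q - y * W] and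
   f_x is [W - 1]; so dx / f_y is [c] times the differential dual to [D]. *)
Definition dcoef x y c := D x = c * (y ^+ q - y * W x y) /\ D y = c * (1 - W x y).

(** This function takes the value 1 at the origin. *)
Lemma slope_neq1 x y : chart x y -> 1 - W x y != 0.
Proof.
move=> chi; have h := valR_slope x y 0 0.
have h1 : valR x y 0 0 1 1 by have := valRK x y 0 0 1; rewrite rmorph1.
have := valR_neq0 chi fK00 (valRB h1 h); apply.
by rewrite slope00 subr0 oner_neq0.
Qed.

(** Apply D to f(x, y) = 0: it kills q-th powers, and 2 m = 1, which leaves f_x Dx + f_y Dy = 0. *)
Lemma dcoef_exists x y : chart x y -> exists c, dcoef x y c.
Proof.
move=> chi; have w1 := slope_neq1 chi; exists (D y / (1 - W x y)).
split; last by rewrite divfK.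
apply: (mulfI w1); rewrite mulrCA mulrA divfK //; apply/esym/eqP; rewrite -subr_eq0; apply/eqP.
have := congr1 D (chart_root chi); rewrite /fval -/m kder0.
have m1 : m = m.-1.+1 by move: two_m; clear; lia.
rewrite !((kderD dD), kderN) exprS (kderM dD) !kderXq.
rewrite (kderM dD (iota lam)) (kderK dD) m1 kderX1 -m1 !((kderD dD), kderN).
rewrite (kderM dD 2%:R) kderX1.
have D2 : D 2%:R = 0 by rewrite -(rmorph_nat iota) (kderK dD).
rewrite D2 /slope; have := two_m1 iota; move: (m%:R) ((y ^+ 2 - 2%:R * x) ^+ m.-1) => mm S e <-.
transitivity (D y * y ^+ q - D x - (2%:R * mm) * (iota lam * S * (y * D y - D x))).
  by rewrite e; ring.
by rewrite expr1; ring.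
Qed.

Section Dcoef.
Variables (x y c : F) (chi : chart x y) (cE : dcoef x y c).

(** The derivation f_y d/dx - f_x d/dy preserves K[x, y], so its multiple D maps this ring into c
    K[x, y]. *)
Lemma kder_valR a b z e : valR x y a b z e -> exists z' e', D z = c * z' /\ valR x y a b z' e'.
Proof.
case=> G <- _; suff [G' E] : exists G', D (ev x y G) = c * ev x y G'.
  by exists (ev x y G'), (evB idfun a b G'); split=> //; exists G'.
have [Dx Dy] := cE.
elim/evB_ind: G => [d|||G H [G' hG] [H' hH]|G H [G' hG] [H' hH]].
- by exists 0%:P%:P; rewrite !evB_CC (kderK dD) rmorph0 mulr0.
- exists ('X ^+ q - 'X * (lam%:P%:P * ('X^2 - 2%:R%:P%:P * 'X%:P) ^+ m.-1)).
  rewrite !(evBB, evBD, evBM, evBX, evB_CC, evB_x, evB_y) rmorph_nat; exact: Dx.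
- exists (1%:P%:P - (lam%:P%:P * ('X^2 - 2%:R%:P%:P * 'X%:P) ^+ m.-1)).
  rewrite !(evBB, evBD, evBM, evBX, evB_CC, evB_x, evB_y) rmorph_nat rmorph1; exact: Dy.
- by exists (G' + H'); rewrite !evBD (kderD dD) hG hH mulrDr.
exists (G' * H + G * H'); rewrite evBD !evBM (kderM dD) hG hH; ring.
Qed.

Lemma kder_locR a b z e : fK a b = 0 -> locR x y a b z e -> exists z' e', D z = c * z' /\ locR x y a b z' e'.
Proof.
move=> fab [A [ca [B [cb [hA hB b0 E _]]]]]; have B0 := valR_neq0 chi fab hB b0.
have [A' [ca' [EA hA']]] := kder_valR hA; have [B' [cb' [EB hB']]] := kder_valR hB.
exists ((B * A' - A * B') / B ^+ 2), ((cb * ca' - ca * cb') / cb ^+ 2).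
have zE : z = A / B by rewrite -E mulrC mulKf.
split; first by rewrite zE (kderM dD) kderV // EA EB; field.
exists (B * A' - A * B'), (cb * ca' - ca * cb'), (B ^+ 2), (cb ^+ 2).
split; rewrite ?expf_neq0 //; [apply: valRB; apply: valRM => // | exact: valRX |].
by rewrite mulrC divfK ?expf_neq0.
Qed.

Lemma dcoef_neq0 : (exists z, D z != 0) -> c != 0.
Proof.
case=> z; apply: contraNneq => c0.
have [G [H [H0 ->]]] := chart_gen chi z.
have D0 G' : D (ev x y G') = 0.
  have [|z' [e' [-> _]]] := @kder_valR 0 0 (ev x y G') (evB idfun 0 0 G'); first by exists G'.
  by rewrite c0 mul0r.
by rewrite (kderM dD) kderV // !D0 oppr0 !mul0r mulr0 addr0.
Qed.

(** The exponent q - 2 is the degree of the curve minus 3. As x has a pole of order q + 1 at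
    infinity, dx / f_y has there a zero of order (q - 2)(q + 1). *)
Lemma dcoef_swap : dcoef x^-1 (y / x) (- c * x ^+ (q - 2)).
Proof.
have x0 := chart_x_neq0 chi; have [Dx Dy] := cE.
have Xq : x ^+ q = x ^+ (q - 2) * x ^+ 2 by rewrite -exprD subnK // ltnW // q_gt2.
have Wm : W x^-1 (y / x) * x ^+ q = W x y * x.
  have -> : x ^+ q = (x ^+ 2) ^+ m.-1 * x.
    by rewrite -exprM -exprSr; congr (_ ^+ _); move: two_m; clear; lia.
  rewrite /slope mulrA; congr (_ * _); rewrite -mulrA -exprMn.
  by congr (_ * _ ^+ _); field.
have fr : y ^+ q * y - x ^+ q - x - W x y * (y ^+ 2 - 2%:R * x) = 0.
  have := chart_root chi; rewrite /fval -/m /slope -mulrA -(exprSr _ m.-1) prednK; last first.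
    by move: two_m; clear; lia.
  by rewrite exprSr opprD addrA.
split.
  rewrite kderV // Dx; apply: (mulfI (expf_neq0 2 x0)).
  rewrite mulrCA divff ?expf_neq0 // mulr1.
  rewrite (_ : x ^+ 2 * _ = - c * (x ^+ q * ((y / x) ^+ q) - (y / x) * (W x^-1 (y / x) * x ^+ q))).
    by rewrite Wm -exprMn (mulrCA x) divff // mulr1; field.
  by rewrite Xq; ring.
rewrite (kderM dD) kderV // Dx Dy; apply: (mulfI (expf_neq0 2 x0)).
rewrite (_ : x ^+ 2 * (- c * _ * _) = - c * (x ^+ q - W x^-1 (y / x) * x ^+ q)); last by rewrite Xq; ring.
rewrite Wm; apply/eqP; rewrite -subr_eq0; apply/eqP.
transitivity (c * - (y ^+ q * y - x ^+ q - x - W x y * (y ^+ 2 - 2%:R * x))).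
  by move: (W x y) (y ^+ q) (x ^+ q) => w Y X; field.
by rewrite fr oppr0 mulr0.
Qed.

End Dcoef.

(* With w the differential dual to [D]: h w is regular at v, since dz is [D z] times w. *)
Definition reg v h := exists z, [/\ vge v 0 z, D z != 0 & vge v (v (D z)) h].

(** At an affine point dx / f_y has neither pole nor zero: D maps the local ring into c times
    itself, and by smoothness Dx or Dy is c times a unit. *)
Lemma reg_pt x y c v a b h : chart x y -> dcoef x y c -> c != 0 -> place iota v ->
  at_pt v x y a b -> reg v h <-> vge v (v c) h.
Proof.
move=> chi cE c0 pv [fab vx vy]; split.
  case=> z [hz Dz0 hD]; have [e hze] := center_locR chi fab pv vx vy hz.
  have [z' [e' [E hz']]] := kder_locR chi cE fab hze.
  have z'0 : z' != 0 by apply: contraNneq Dz0 => z'0; rewrite E z'0 mulr0.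
  have := locR_integral pv vx vy hz'; rewrite vgeE // => vz'.
  by apply: (vge_le _ hD); rewrite E (placeM pv) //; move: vz'; clear; lia.
have [Dx Dy] := cE.
have int w e : valR x y a b w e -> vge v 0 w by apply: center_integral.
case: (fval_smooth fab) => d hc.
  have [|n1 v1] := center_unit pv vx vy (valRB (valRK x y a b 1) (valR_slope x y a b)).
    by rewrite subr_eq0 eq_sym.
  rewrite rmorph1 in n1 v1; exists y; split; first exact: int (valR_y x y a b).
    by rewrite Dy mulf_neq0.
  by rewrite Dy (placeM pv) // v1 addr0.
have [n1 v1] := center_unit pv vx vy (valR_dy x y a b) d.
exists x; split; first exact: int (valR_x x y a b).
  by rewrite Dx mulf_neq0.
by rewrite Dx (placeM pv) // v1 addr0.
Qed.

Lemma at_pt_origin v x y : at_inf v x y -> at_pt v x^-1 (y / x) 0 0.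
Proof. by case=> hu hw; split; rewrite ?fK00 // rmorph0 subr0. Qed.

(** Infinity is the origin of the swapped chart, where the coefficient is - c x ^ (q - 2). *)
Lemma reg_inf x y c v h : chart x y -> dcoef x y c -> c != 0 -> place iota v ->
  at_inf v x y -> reg v h <-> vge v (v c - ((q - 2) * q.+1)%N%:Z) h.
Proof.
move=> chi cE c0 pv hinf; have x0 := chart_x_neq0 chi.
have Nc0 : - c != 0 by rewrite oppr_eq0.
have -> : v c - ((q - 2) * q.+1)%N%:Z = v (- c * x ^+ (q - 2)).
  rewrite (placeM pv) ?expf_neq0 // (placeX pv) // (inf_val_x chi pv hinf) PoszM.
  rewrite -[- c]mulN1r (placeM pv) ?oppr_eq0 ?oner_neq0 // -(rmorph1 iota) -rmorphN.
  by rewrite (placeK pv) ?oppr_eq0 ?oner_neq0 //; move: (v c); clear; lia.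
apply: (reg_pt _ (chart_swap chi) (dcoef_swap chi cE) _ pv (at_pt_origin hinf)).
by rewrite mulf_neq0 ?expf_neq0.
Qed.

Definition tdeg n (G : {poly {poly K}}) := forall i j, (n < i + j)%N -> G`_j`_i = 0.

Lemma tdegD n G H : tdeg n G -> tdeg n H -> tdeg n (G + H).
Proof. by move=> hG hH i j lt; rewrite !coefD hG // hH // addr0. Qed.

Lemma tdegM n n' G H : tdeg n G -> tdeg n' H -> tdeg (n + n') (G * H).
Proof.
move=> hG hH i j lt; rewrite coefM coef_sum big1 // => u _.
rewrite coefM big1 // => w _.
have [le|gt] := leqP (w + u) n; last by rewrite hG // mul0r.
rewrite [X in _ * X]hH ?mulr0 //.
by move: (ltn_ord u) (ltn_ord w) le lt; clear; lia.
Qed.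

Lemma tdeg_CC c n : tdeg n c%:P%:P.
Proof. by move=> [|i] [|j] //=; rewrite !coefC ?coef0. Qed.

Lemma tdeg_x : tdeg 1 'X%:P.
Proof. by move=> [|[|i]] [|j] //=; rewrite coefC /= ?coefX ?coef0. Qed.

Lemma tdeg_y : tdeg 1 'X.
Proof. by move=> [|i] [|[|j]] //=; rewrite coefX /= ?coef1 ?coef0. Qed.

Lemma tdegX n G e : tdeg n G -> tdeg (n * e) (G ^+ e).
Proof.
move=> h; elim: e => [|e IH]; first by rewrite expr0 muln0; apply: (@tdeg_CC 1).
by rewrite exprS mulnS; apply: tdegM.
Qed.

Lemma ev_mono x y (G : {poly {poly K}}) n N : (size G <= n)%N -> (forall j, (size (G`_j)%R <= N)%N) ->
  ev x y G = \sum_(p : 'I_N * 'I_n) iota G`_p.2`_p.1 * (x ^+ p.1 * y ^+ p.2).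
Proof.
move=> sG sN.
rewrite -(pair_bigA _ (fun (i : 'I_N) (j : 'I_n) => iota G`_j`_i * (x ^+ i * y ^+ j))) exchange_big /=.
rewrite evBE (big_ord_widen n (fun j => (map_poly iota G`_j).[x] * y ^+ j)) // big_mkcond.
apply: eq_bigr => j _; transitivity ((map_poly iota G`_j).[x] * y ^+ j).
  by case: ltnP => // le; rewrite (nth_default _ le) rmorph0 horner0 mul0r.
rewrite (@horner_coef_wide _ N) ?size_map_poly ?sN // mulr_suml.
by apply: eq_bigr => i _; rewrite coef_map mulrA.
Qed.

Lemma tdeg_size n G : tdeg n G -> (size G <= n.+1)%N /\ forall j, (size (G`_j)%R <= n.+1)%N.
Proof.
move=> h; split=> [|j].
  by apply/leq_sizeP => j lt; apply/polyP => i; rewrite coef0 h //; move: lt; clear; lia.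
by apply/leq_sizeP => i lt; rewrite h //; move: lt; clear; lia.
Qed.

Lemma inf_val_mono x y v i j : chart x y -> place iota v -> at_inf v x y ->
  v (x ^+ i * y ^+ j) = - (i * q.+1 + j * q)%N%:Z.
Proof.
move=> chi pv h; have x0 := chart_x_neq0 chi; have y0 := chart_y_neq0 chi.
rewrite (placeM pv) ?expf_neq0 // !(placeX pv) // (inf_val_x chi pv h) (inf_val_y chi pv h).
by rewrite PoszD !PoszM; clear; lia.
Qed.

Lemma tdeg_reg x y c G : chart x y -> dcoef x y c -> c != 0 -> tdeg (q - 2) G ->
  forall v, place iota v -> reg v (c * ev x y G).
Proof.
move=> chi cE c0 hG v pv; have vc : vge v (v c) c by rewrite vgeE.
case: (place_center chi pv) => [[a [b hab]]|hinf].
  apply/(reg_pt _ chi cE c0 pv hab); case: hab => fab vx vy.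
  rewrite -[v c]addr0 (vgeM pv) //; apply: (vge_evB pv).
    exact: (vge_integral pv vx).
  exact: (vge_integral pv vy).
apply/(reg_inf _ chi cE c0 pv hinf); apply: (vgeM pv) => //.
have [sG sN] := tdeg_size hG; rewrite (ev_mono x y sG sN).
apply: (vge_sum pv) => -[i j] _ /=.
have [lt|le] := ltnP (q - 2) (i + j); first by rewrite hG // rmorph0 mul0r vge0.
apply: (vgeMl pv); first exact: vge_iota.
rewrite vgeE ?mulf_neq0 ?expf_neq0 ?(chart_x_neq0 chi) ?(chart_y_neq0 chi) //.
rewrite (inf_val_mono _ _ chi pv hinf) lerN2 lez_nat.
apply: leq_trans (_ : (i + j) * q.+1 <= _)%N; last by rewrite leq_mul2r le orbT.
by rewrite mulnDl leq_add2l leq_mul2l leqnSn orbT.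
Qed.

Lemma ev_poly_y_neq0 x y (P : {poly K}) : chart x y -> P != 0 -> (map_poly iota P).[y] != 0.
Proof. by move=> chi; apply: transc_neq0 => c; rewrite -subr_eq0 (sub_y_neq0 chi c). Qed.

(* A pole on the line x = x0: the fibre polynomials f(x0, Y) and R(x0, Y) are
   compared through their gcd; Y - y0 divides the first one more often. *)
Lemma integral_fiber x y h (N : {poly K}) (R : {poly {poly K}}) x0 :
  chart x y -> (forall v a b, place iota v -> at_pt v x y a b -> vge v 0 h) ->
  (size R < q.+2)%N -> h * (map_poly iota (N * ('X - x0%:P))).[x] = ev x y R ->
  map_poly (horner_eval x0) R = 0.
Proof.
move=> chi hint sR E; apply/eqP; apply/negPn/negP; set a0 := map_poly _ R => a0n.
pose f0 := map_poly (horner_eval x0) fBq.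
have f0c : f0`_q.+1 = 1 - lam.
  by rewrite /f0 coef_map /= (coef_fB_top lam q_odd) /horner_eval hornerC.
have f0n : f0 != 0.
  apply/eqP => f0n; move: f0c; rewrite f0n coef0 => /esym/eqP.
  by rewrite subr_eq0 eq_sym (negPf lam1).
have sf0 : (q.+1 < size f0)%N.
  rewrite ltnNge; apply/negP => le; move: f0c; rewrite nth_default // => /esym/eqP.
  by rewrite subr_eq0 eq_sym (negPf lam1).
have sa0 : (size a0 <= q.+1)%N by apply: leq_trans (size_poly _ _) _.
pose g := gcdp f0 a0.
have gn : g != 0 by rewrite gcdp_eq0 negb_and f0n.
have [kk Ek] := dvdpP _ _ (dvdp_gcdl f0 a0); rewrite -/g in Ek.
have [ll El] := dvdpP _ _ (dvdp_gcdr f0 a0); rewrite -/g in El.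
have kn : kk != 0 by apply: contraNneq f0n => k0'; rewrite Ek k0' mul0r.
have ln : ll != 0 by apply: contraNneq a0n => l0'; rewrite El l0' mul0r.
have sg : (size g <= q.+1)%N by apply: leq_trans (dvdp_leq a0n (dvdp_gcdr _ _)) sa0.
(* f(x0, Y) has degree q + 1 and R(x0, Y) degree at most q, so the gcd cannot exhaust the former. *)
have sk : size kk != 1%N.
  apply: contraTneq sf0 => sk; rewrite -leqNgt; apply: leq_trans sg.
  by rewrite Ek size_mul // sk.
have [y0 rk] := closedK sk.
have cop : coprimep kk ll.
  have := coprimep_div_gcd (p := f0) (q := a0); rewrite f0n => /(_ isT).
  by rewrite -/g {1}Ek {1}El !mulpK.
have lv : ll.[y0] != 0 by apply: coprimep_root cop rk.
have fP : fK x0 y0 = 0.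
  have := horner_fB_at q lam [the {rmorphism K -> K} of idfun] x0 y0.
  by rewrite map_poly_id // -/f0 Ek hornerM (eqP rk) mul0r.
have f0y : (map_poly iota f0).[y] = fF (iota x0) y by exact: horner_fB_at.
have [v [pv vx vy]] := place_at_point chi fP.
have hv := hint v _ _ pv (And3 fP vx vy).
have ix := vge_integral pv vx; have iy := vge_integral pv vy.
pose gy := (map_poly iota g).[y]; pose ky := (map_poly iota kk).[y].
have kg : ky * gy = fF (iota x0) y by rewrite -f0y Ek rmorphM hornerM.
have gy0 : gy != 0 by apply: (ev_poly_y_neq0 chi gn).
have X0 : x - iota x0 != 0 by apply: (sub_x_neq0 chi x0).
have hyy := valR_y x y x0 y0; have hxx := valR_x x y x0 y0.
have h1 := valR_ftay1 hyy; have := curve_taylor x y x0 y.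
rewrite (chart_root chi) subrr mul0r addr0 -kg; move: (ftay1 _ _ _ _ _ _) h1 => f1 h1 E1.
have lu := center_unit pv vx vy (valR_polyy x y x0 y0 ll) lv.
have [R2 ER _] : exists2 R2, R - map_poly polyC a0 = ('X - x0%:P)%:P * R2 & size R2 = size (R - map_poly polyC a0).
  apply: horner_eval_dvd; rewrite rmorphB /= -map_poly_comp map_poly_id ?subrr //.
  by move=> c _; rewrite /= /horner_eval hornerC.
have ER' : (map_poly iota ll).[y] * gy = (x - iota x0) * (h * (map_poly iota N).[x] - ev x y R2).
  have mX : (map_poly iota ('X - x0%:P)).[x] = x - iota x0.
    by rewrite rmorphB /= map_polyX map_polyC hornerXsubC.
  have E2 : ev x y R = h * ((map_poly iota N).[x] * (x - iota x0)).
    by rewrite -E rmorphM hornerM mX.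
  have : ev x y R - (map_poly iota ll).[y] * gy = (x - iota x0) * ev x y R2.
    have := congr1 (ev x y) ER; rewrite evBB evBM evB_lift evB_C mX => <-.
    by rewrite El rmorphM hornerM.
  by rewrite E2 => e; rewrite mulrBr -e opprB addrC [(x - _) * _]mulrCA [(x - _) * _]mulrC subrK.
(* The integrality of h enters here: ll(y) g(y) is x - x0 times an integral element, and ll(y) is a
   unit. *)
have vg : v (x - iota x0) <= v gy.
  have [ln0 lv0] := lu.
  have : vge v (v (x - iota x0)) ((map_poly iota ll).[y] * gy).
    rewrite ER' -[v _]addr0; apply: (vgeM pv); first by rewrite vgeE.
    apply: (vgeB pv); last exact: (vge_evB pv).
    by apply: (vgeMl pv) => //; apply: (vge_poly pv).
  by rewrite vgeE ?mulf_neq0 // (placeM pv) // lv0 add0r.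
have ky0 : ky != 0 by apply: (ev_poly_y_neq0 chi kn).
have [k1 Ek1] := factor_theorem _ _ rk.
have vroot (P1 : {poly K}) : (map_poly iota (P1 * ('X - y0%:P))).[y] != 0 ->
    v (y - iota y0) <= v (map_poly iota (P1 * ('X - y0%:P))).[y].
  move=> n0; rewrite -vgeE //; rewrite rmorphM rmorphB /= map_polyX map_polyC hornerM hornerXsubC.
  by apply: (vgeMl pv); [apply: (vge_poly pv) | rewrite vgeE // (sub_y_neq0 chi y0)].
have vk : v (y - iota y0) <= v ky by rewrite /ky Ek1 vroot // -Ek1.
have vy1 : 1 <= v (y - iota y0) by rewrite -vgeE // (sub_y_neq0 chi y0).
have vx1 : 1 <= v (x - iota x0) by rewrite -vgeE.
have kg0 : ky * gy != 0 by rewrite mulf_neq0.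
have [f10 f1E] : f1 != 0 /\ v (ky * gy) = v (x - iota x0) + v f1.
  have f10 : f1 != 0 by apply: contraNneq kg0 => f10; move: E1; rewrite f10 mulr0 addr0 => <-.
  split=> //; move/esym/eqP: E1; rewrite addr_eq0 => /eqP ->.
  rewrite -mulN1r (placeM pv) ?oppr_eq0 ?oner_neq0 ?mulf_neq0 // (placeM pv) //.
  by rewrite -(rmorph1 iota) -rmorphN (placeK pv) ?oppr_eq0 ?oner_neq0 ?add0r.
rewrite (placeM pv) // in f1E.
(* The orders of kk(y) and g(y) add up to more than that of x - x0, so f_x vanishes at the point. By
   smoothness f_y does not, and f(x0, y) has exactly the order of y - y0, already reached by kk(y)
   alone, although g(y) vanishes too. *)
have s1 : slope lam x0 y0 = 1.
  apply/eqP; apply/negPn/negP => s1; have [|_ v1] := center_unit pv vx vy h1.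
    by rewrite subr_eq0.
  by move: f1E; rewrite v1; move: vg vk vy1; clear; lia.
have dy : y0 ^+ q - y0 * slope lam x0 y0 != 0.
  by case: (fval_smooth fP) => //; rewrite s1 eqxx.
have hxa : valR x y x0 y0 (iota x0) x0 := valRK x y x0 y0 x0.
have [n2 v2] := center_unit pv vx vy (valR_ftay2 hxa) dy.
have fr (u w : F) : (u - w) ^+ q = u ^+ q - w ^+ q by apply: (frobB iota).
have := fval_taylor (iota lam) fr q0 (iota x0) y (iota x0) (iota y0).
rewrite -kg -rmorph_fval fP rmorph0 subrr mul0r addr0 add0r => /(congr1 v).
rewrite !(placeM pv) ?(sub_y_neq0 chi y0) // v2 addr0 => vkg.
have [rg|rg] := boolP (root g y0); last first.
  have [_ ] := center_unit pv vx vy (valR_polyy x y x0 y0 g) rg.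
  by rewrite -/gy; move: vg vx1; clear; lia.
have [g1 Eg1] := factor_theorem _ _ rg.
have : v (y - iota y0) <= v gy by rewrite /gy Eg1 vroot // -Eg1.
by move: vkg vk vy1; move: (v ky) (v gy) (v (y - iota y0)); clear=> *; lia.
Qed.

(** Write h as R / N(x) with y-degree of R at most q; [integral_fiber] then cancels the roots of N
    one at a time. *)
Lemma integral_ring x y h : chart x y ->
  (forall v a b, place iota v -> at_pt v x y a b -> vge v 0 h) ->
  exists2 R : {poly {poly K}}, (size R < q.+2)%N & h = ev x y R.
Proof.
move=> chi hint; have fu := lead_coef_fB_unit q_odd lam1.
have [N [R [N0 sR E]]] : exists (N : {poly K}) (R : {poly {poly K}}),
    [/\ N != 0, (size R < q.+2)%N & h * (map_poly iota N).[x] = ev x y R].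
  have [G [H [H0 hE]]] := chart_gen chi h; have [U [N [N0 E]]] := chart_norm chi H0.
  exists N, ((U * G) %% fBq); split=> //.
    by rewrite -(size_fB q_odd lam1) ltn_modp -size_poly_gt0 (size_fB q_odd lam1).
  have := congr1 (ev x y) (Pdiv.IdomainUnit.divp_eq fu (U * G)).
  rewrite evBD [in RHS]evBM evB_fB (chart_root chi) mulr0 add0r => <-.
  by rewrite evBM -E hE; field.
elim: {N}(size N) {-2}N (leqnn (size N)) R N0 sR E => [|n IH] N sN R N0 sR E.
  by move: sN; rewrite leqn0 size_poly_eq0 (negPf N0).
have [/eqP/size_poly1P[c c0 Nc]|sz] := eqVneq (size N) 1%N.
  exists (c^-1%:P *: R); first by rewrite (leq_ltn_trans (size_scale_leq _ _)).
  rewrite -mul_polyC evBM evB_CC -E Nc map_polyC hornerC fmorphV mulrC mulfK //.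
  by rewrite fmorph_eq0.
have [x0 /factor_theorem[N1 NE]] := closedK sz.
have N10 : N1 != 0 by apply: contraNneq N0 => N10; rewrite NE N10 mul0r.
rewrite NE in E; have R0 := integral_fiber chi hint sR E.
have [R1 RE sR1] := horner_eval_dvd R0.
apply: (IH N1 _ R1) => //.
- by move: sN; rewrite NE size_Mmonic ?monicXsubC // size_XsubC addn2.
- by rewrite sR1.
have mX : (map_poly iota ('X - x0%:P)).[x] = x - iota x0.
  by rewrite rmorphB /= map_polyX map_polyC hornerXsubC.
move: E; rewrite RE evBM evB_C rmorphM hornerM mX.
move=> e; apply: (mulfI (sub_x_neq0 chi x0)); rewrite -e.
by rewrite mulrCA; congr (_ * _); rewrite mulrC.
Qed.

(* The monomials of y-degree at most q have pairwise distinct pole orders. *)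
Lemma inf_val_ev x y (G : {poly {poly K}}) v : chart x y -> place iota v -> at_inf v x y ->
  (size G < q.+2)%N -> G != 0 -> exists i j,
  [/\ G`_j`_i != 0, (j <= q)%N, v (ev x y G) = - (i * q.+1 + j * q)%N%:Z &
      forall i' j', G`_j'`_i' != 0 -> (i' * q.+1 + j' * q <= i * q.+1 + j * q)%N].
Proof.
move=> chi pv hinf sG Gn.
pose n := (size G).
pose N := \max_(j < n) size (G`_j)%R.
have sN j : (size (G`_j)%R <= N)%N.
  have [lt|le] := ltnP j n; first exact: (@leq_bigmax _ (fun j : 'I_n => size (G`_j)%R) (Ordinal lt)).
  by rewrite nth_default // size_poly0.
pose T (w : 'I_N * 'I_n) := iota G`_w.2`_w.1 * (x ^+ w.1 * y ^+ w.2).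
have x0 := chart_x_neq0 chi; have y0 := chart_y_neq0 chi.
have T0 w : (T w != 0) = (G`_w.2`_w.1 != 0).
  by rewrite mulf_eq0 fmorph_eq0 mulf_eq0 !expf_eq0 (negPf x0) (negPf y0) !andbF !orbF.
have vT w : T w != 0 -> v (T w) = - (w.1 * q.+1 + w.2 * q)%N%:Z.
  move=> Tn; have h := Tn; rewrite T0 in h.
  rewrite (placeM pv) ?fmorph_eq0 ?mulf_neq0 ?expf_neq0 // (placeK pv) // add0r.
  exact: inf_val_mono.
have jq (w : 'I_N * 'I_n) : (w.2 <= q)%N by rewrite -ltnS; apply: (leq_trans (ltn_ord w.2) sG).
pose r := [seq w <- index_enum ('I_N * 'I_n)%type | T w != 0].
have sE : ev x y G = \sum_(w <- r) T w.
  rewrite (ev_mono x y (leqnn _) sN) big_filter [RHS]big_mkcond; apply: eq_bigr => w _.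
  by rewrite /T; case: eqP.
have inr i j : G`_j`_i != 0 -> exists2 w, w \in r & (i = w.1 :> nat) /\ (j = w.2 :> nat).
  move=> Gij; have jn : (j < n)%N.
    by rewrite ltnNge; apply: contra Gij => le; rewrite (nth_default _ le) coef0.
  have iN : (i < N)%N.
    by rewrite ltnNge; apply: contra Gij => le; rewrite nth_default // (leq_trans (sN j) le).
  by exists (Ordinal iN, Ordinal jn); rewrite // mem_filter T0 Gij mem_index_enum.
have rn : r != [::].
  have : lead_coef (lead_coef G) != 0 by rewrite !lead_coef_eq0.
  by rewrite !lead_coefE => /inr[w wr _]; apply: contraTneq wr => ->.
have rT w : w \in r -> T w != 0 by rewrite mem_filter => /andP[].
have [||w wr [s0 vs min]] := @place_sum_distinct _ _ iota v pv _ r T (filter_uniq _ (index_enum_uniq _)) _ _ rn.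
- exact: rT.
- move=> w w' /rT wr /rT wr'; rewrite /= !vT // => /oppr_inj[] /(mono_val_inj (jq w) (jq w'))[].
  by case: w {wr} => i j; case: w' {wr'} => i' j' /= /val_inj-> /val_inj->.
exists w.1, w.2; split; rewrite ?jq //; first by rewrite -T0 rT.
  by rewrite sE vs vT ?rT.
move=> i' j' /inr[w' wr' [-> ->]]; have := min _ wr'.
by rewrite !vT ?rT // lerN2 lez_nat.
Qed.

(** Terms cannot cancel at infinity, so each monomial obeys the bound on the pole order, and
    [mono_val_bound] turns this into a bound on its degree. *)
Lemma tdeg_of_inf x y (G : {poly {poly K}}) v : chart x y -> place iota v -> at_inf v x y ->
  (size G < q.+2)%N -> vge v (- ((q - 2) * q.+1)%N%:Z) (ev x y G) -> tdeg (q - 2) G.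
Proof.
move=> chi pv hinf sG hG i' j' lt; apply/eqP; apply/negPn/negP => Gij.
have Gn : G != 0 by apply: contraNneq Gij => ->; rewrite !coef0.
have [i [j [_ jq vE max]]] := inf_val_ev chi pv hinf sG Gn.
rewrite vgeE ?(ev_small_neq0 chi) // vE lerN2 lez_nat in hG.
have j'q : (j' <= q)%N.
  rewrite leqNgt; apply: contra Gij => lt'.
  by rewrite (nth_default _ (leq_trans (sG : (size G <= q.+1)%N) lt')) coef0.
have := mono_val_bound q_gt2 j'q (leq_trans (max _ _ Gij) hG).
by rewrite leqNgt lt.
Qed.

Lemma reg_tdeg x y c h : chart x y -> dcoef x y c -> c != 0 ->
  (forall v, place iota v -> reg v h) -> exists2 G, tdeg (q - 2) G & h = c * ev x y G.
Proof.
move=> chi cE c0 hr.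
have vc v : place iota v -> vge v (- v c) c^-1.
  by move=> pv; rewrite vgeE ?invr_eq0 // (placeV pv).
have [v a b pv hab|G sG E] := @integral_ring x y (h / c) chi.
  have /(reg_pt _ chi cE c0 pv hab) hh := hr v pv.
  by rewrite -(subrr (v c)); apply: (vgeM pv hh (vc v pv)).
exists G; last by rewrite -E mulrC divfK.
have [v pv hinf] := place_at_inf chi.
apply: (tdeg_of_inf chi pv hinf sG); rewrite -E.
have /(reg_inf _ chi cE c0 pv hinf) hh := hr v pv.
have := vgeM pv hh (vc v pv); congr (vge _ _ _).
by move: (v c) (Posz _); clear; lia.
Qed.

(** * Comparison of two charts at a common place *)

Lemma tdeg_le n n' G : (n <= n')%N -> tdeg n G -> tdeg n' G.
Proof. by move=> le h i j lt; apply: h; apply: leq_ltn_trans le lt. Qed.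

Lemma tdegN n G : tdeg n G -> tdeg n (- G).
Proof. by move=> h i j lt; rewrite !coefN h // oppr0. Qed.

(** [reg] refers to no chart, so the description of the regular differentials passes from one chart
    to the other. *)
Lemma tdeg_transfer x y c x' y' c' G : chart x y -> dcoef x y c -> c != 0 ->
  chart x' y' -> dcoef x' y' c' -> c' != 0 -> tdeg (q - 2) G ->
  exists2 G', tdeg (q - 2) G' & c * ev x y G = c' * ev x' y' G'.
Proof.
move=> chi cE c0 chi' cE' c0' hG; apply: (reg_tdeg chi' cE' c0').
exact: (tdeg_reg chi cE c0 hG).
Qed.

Lemma vge_ext v (n n' : int) : place iota v -> (forall h, vge v n h <-> vge v n' h) -> n = n'.
Proof.
move=> pv e.
have lem d : exists2 h, h != 0 & v h = d.
  have [t t0 vt] := place_unif pv; case: d => d.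
    by exists (t ^+ d); rewrite ?expf_neq0 // (placeX pv) // vt mul1r.
  exists (t ^+ d.+1)^-1; rewrite ?invr_eq0 ?expf_neq0 // (placeV pv) ?expf_neq0 //.
  by rewrite (placeX pv) // vt mul1r NegzE.
have [h h0 vh] := lem n; have [h' h0' vh'] := lem n'.
apply: le_anti; apply/andP; split.
  by rewrite -vh' -vgeE //; apply/e; rewrite vgeE // vh'.
by rewrite -vh -vgeE //; apply/e; rewrite vgeE // vh.
Qed.

Section TwoCharts.
Variables (x y c x' y' c' : F) (v : F -> int) (a b : K).
Hypotheses (chi : chart x y) (cE : dcoef x y c) (c0 : c != 0).
Hypotheses (chi' : chart x' y') (cE' : dcoef x' y' c') (c0' : c' != 0).
Hypotheses (pv : place iota v) (hinf : at_inf v x' y').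

Section AtPoint.
Hypothesis hab : at_pt v x y a b.

(** Regularity at v, read in both charts, gives v(c) = v(c') - (q - 2)(q + 1). The order of G is
    thus (q - 2)(q + 1) less the pole order of a monomial, and [mono_val_gap] applies. *)
Lemma order_gap G : tdeg (q - 2) G -> ev x y G != 0 ->
  v (ev x y G) != q.-1%:Z /\ v (ev x y G) != q%:Z.
Proof.
move=> hG G0; have [G' hG' E] := tdeg_transfer chi cE c0 chi' cE' c0' hG.
have vcc : v c = v c' - ((q - 2) * q.+1)%N%:Z.
  apply: (vge_ext pv) => h; have r1 := reg_pt h chi cE c0 pv hab.
  by have r2 := reg_inf h chi' cE' c0' pv hinf; rewrite -r1 -r2.
have G0' : ev x' y' G' != 0.
  by apply: contraNneq (mulf_neq0 c0 G0) => e; rewrite E e mulr0.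
have Gn : G' != 0 by apply: contraNneq G0' => ->; rewrite -!polyC0 evB_CC rmorph0.
have [sG _] := tdeg_size hG'.
have [|i [j [Gij _ vE _]]] := inf_val_ev chi' pv hinf _ Gn.
  by rewrite ltnS (leq_trans sG) //; move: q_gt2; clear; lia.
have le : (i + j <= q - 2)%N by rewrite leqNgt; apply: contra Gij => /hG' ->.
have := congr1 v E; rewrite !(placeM pv) // vcc vE => e.
have gap r : (i * q.+1 + j * q + r = (q - 2) * q.+1)%N -> r != q.-1 /\ r != q.
  exact: mono_val_gap q_gt2 le.
split; apply/eqP => h; rewrite h in e.
  have [] := gap q.-1; last by rewrite eqxx.
  by move: e; move: (v c') (i * q.+1)%N (j * q)%N ((q - 2) * q.+1)%N (q.-1); clear => *; lia.
have [] := gap q; last by rewrite eqxx.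
by move: e; move: (v c') (i * q.+1)%N (j * q)%N ((q - 2) * q.+1)%N; clear => *; lia.
Qed.

(** Order q contradicts the gap for L itself; an order n with 2 <= n <= q - 1 contradicts it for L T
    ^ (q - 1 - n), which has order q - 1 and degree at most q - n. *)
Lemma flex_order T L : tdeg 1 T -> tdeg 1 L -> ev x y T != 0 -> v (ev x y T) = 1 ->
  vge v 2 (ev x y L) -> vge v q.+1%:Z (ev x y L).
Proof.
move=> hT hL T0 vT vL; have [l0|l0] := eqVneq (ev x y L) 0; first by rewrite l0 vge0.
rewrite vgeE // in vL; rewrite vgeE //.
have [n vn] : exists n : nat, v (ev x y L) = n%:Z.
  by exists `|v (ev x y L)|%N; move: (v _) vL => u; clear; lia.
have n2 : (2 <= n)%N by move: vL; rewrite vn.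
rewrite vn lez_nat ltnNge; apply/negP => le.
have q2 := q_gt2; have one : (1 <= q - 2)%N by move: q2; clear; lia.
move: le; rewrite leq_eqVlt => /orP[/eqP nq|lt].
  by have [_] := order_gap (tdeg_le one hL) l0; rewrite vn nq eqxx.
have hG : tdeg (q - 2) (L * T ^+ (q.-1 - n)).
  apply: (@tdeg_le (1 + 1 * (q.-1 - n))%N); first by move: lt n2; clear; lia.
  by apply: tdegM => //; apply: tdegX.
have [|] := order_gap hG; first by rewrite evBM evBX mulf_neq0 ?expf_neq0.
rewrite evBM evBX (placeM pv) ?expf_neq0 // (placeX pv) // vT mul1r vn -PoszD subnKC ?eqxx //.
by move: lt; clear; lia.
Qed.

(** The order of P(t) at v is the index of the first nonzero coefficient of P, as t is a
    uniformiser. *)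
Lemma poly_low_coef (P : {poly K}) t n : t != 0 -> v t = 1 -> vge v n%:Z (map_poly iota P).[t] ->
  forall i, (i < n)%N -> P`_i = 0.
Proof.
move=> t0 vt; elim/poly_ind: P n => [|P d IH] n hn i lt; first by rewrite coef0.
have it : vge v 0 t by rewrite vgeE // vt.
move: hn; rewrite rmorphD rmorphM /= map_polyX map_polyC hornerMXaddC => hn.
have n1 : (0 < n)%N by apply: leq_ltn_trans lt.
have d0 : d = 0.
  apply/eqP; apply/negPn/negP => dn; have : vge v 1 (iota d).
    rewrite -[iota d](addKr ((map_poly iota P).[t] * t)); apply: (placeD pv).
      by apply: (vgeN pv); apply: (vgeMl pv); [apply: (vge_poly pv) | rewrite vgeE // vt].
    by apply: vge_le hn; rewrite lez_nat.
  by rewrite vgeE ?fmorph_eq0 // (placeK pv).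
rewrite d0 addr0 coefMX; case: i lt => [//|i] lt /=.
apply: (IH n.-1); last by move: lt; clear; lia.
move: hn; rewrite d0 raddf0 addr0 => hn.
rewrite -[(map_poly iota P).[t]](mulfK t0).
have -> : n.-1%:Z = n%:Z - 1 by move: n1; clear; lia.
by apply: (vgeM pv hn); rewrite vgeE ?invr_eq0 // (placeV pv) // vt.
Qed.

Lemma vge_ftay u1 w1 u2 w2 : vge v 0 u1 -> vge v 0 w1 -> vge v 0 u2 -> vge v 0 w2 ->
  vge v 0 (ftay1 q (iota lam) u1 w1 u2 w2) /\ vge v 0 (ftay2 q (iota lam) u1 w1 u2 w2).
Proof.
move=> h1 h2 h3 h4; have n2 : vge v 0 2%:R by rewrite -(rmorph_nat iota) (vge_iota pv).
have X u n : vge v 0 u -> vge v 0 (u ^+ n) by apply: (vgeX pv).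
have M u w : vge v 0 u -> vge v 0 w -> vge v 0 (u * w) by apply: (vgeMl pv).
have B u w : vge v 0 u -> vge v 0 w -> vge v 0 (u - w) by apply: (vgeB pv).
have A u w : vge v 0 u -> vge v 0 w -> vge v 0 (u + w) by apply: (placeD pv).
have I := vge_iota pv; have O := vge1 pv.
have N u : vge v 0 u -> vge v 0 (- u) by apply: (vgeN pv).
have S : vge v 0 (fsum q u1 w1 u2 w2).
  by apply: (vge_sum pv) => i _; apply: (M); apply: (X); apply: (B); auto.
by split; rewrite /ftay1 /ftay2; auto 10.
Qed.

(** The point (a + u1 t, b + u2 t) of the line differs from (x, y) by multiples of l, so f has order
    at least q + 1 there, and [flex_rational] applies. *)
Lemma flex_direction t l u1 u2 n1 n2 : t != 0 -> v t = 1 -> vge v q.+1%:Z l ->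
  x = iota a + iota u1 * t + iota n1 * l -> y = iota b + iota u2 * t + iota n2 * l ->
  (u1, u2) != (0, 0) -> b ^+ q = b /\ 2%:R * a = b ^+ 2.
Proof.
move=> t0 vt vl xE yE; apply: flex_rational.
apply: (poly_low_coef t0 vt).
have -> : (map_poly iota (fval q lam%:P (a%:P + u1%:P * 'X) (b%:P + u2%:P * 'X))).[t] =
    fF (iota a + iota u1 * t) (iota b + iota u2 * t).
  have := @rmorph_fval {poly K} F (horner_eval t \o map_poly iota) q lam%:P
    (a%:P + u1%:P * 'X) (b%:P + u2%:P * 'X).
  rewrite /= /horner_eval !rmorphD !rmorphM /= !map_polyC map_polyX /= !hornerD !hornerM.
  by rewrite !hornerC hornerX.
set x0 := iota a + _; set y0 := iota b + _.
have it : vge v 0 t by rewrite vgeE // vt.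
have il : vge v 0 l by apply: vge_le vl.
have ix0 : vge v 0 x0 by apply: (placeD pv); rewrite ?(vge_iota pv) // (vgeMl pv) // (vge_iota pv).
have iy0 : vge v 0 y0 by apply: (placeD pv); rewrite ?(vge_iota pv) // (vgeMl pv) // (vge_iota pv).
have ix : vge v 0 x by rewrite xE; apply: (placeD pv) => //; rewrite (vgeMl pv) // (vge_iota pv).
have iy : vge v 0 y by rewrite yE; apply: (placeD pv) => //; rewrite (vgeMl pv) // (vge_iota pv).
have fr (u w : F) : (u - w) ^+ q = u ^+ q - w ^+ q by apply: (frobB iota).
have [h1 h2] := vge_ftay ix iy ix0 iy0.
have := fval_taylor (iota lam) fr q0 x y x0 y0; rewrite (chart_root chi) -addrA => /esym/eqP.
rewrite addr_eq0 => /eqP ->; apply: (vgeN pv).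
have ex : x - x0 = iota n1 * l by rewrite xE addrC addKr.
have ey : y - y0 = iota n2 * l by rewrite yE addrC addKr.
by rewrite ex ey; apply: (placeD pv); apply: (vgeMr pv) => //; rewrite (vgeMl pv) // (vge_iota pv).
Qed.

Lemma center_flex : b ^+ q = b /\ 2%:R * a = b ^+ 2.
Proof.
have [fab vx vy] := hab.
have two T L t l : ev x y T = t -> ev x y L = l -> tdeg 1 T -> tdeg 1 L -> t != 0 -> v t = 1 ->
    vge v 2 l -> vge v q.+1%:Z l.
  by move=> <- <-; apply: flex_order.
have dx : tdeg 1 ('X%:P - a%:P%:P).
  by apply: tdegD; [exact: tdeg_x | apply/tdegN/tdeg_CC].
have dy : tdeg 1 ('X - b%:P%:P).
  by apply: tdegD; [exact: tdeg_y | apply/tdegN/tdeg_CC].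
have xE : ev x y ('X%:P - a%:P%:P) = x - iota a by rewrite evBB evB_x evB_CC.
have yE : ev x y ('X - b%:P%:P) = y - iota b by rewrite evBB evB_y evB_CC.
have dC d G : tdeg 1 G -> tdeg 1 (d%:P%:P * G).
  by move=> h; rewrite -[1%N]add0n; apply: tdegM => //; apply: tdeg_CC.
(* d is the residue of z / t. Applied to the other coordinate, it gives the tangent line. *)
have slopeK t z : t != 0 -> v t = 1 -> vge v 1 z -> exists d, vge v 2 (z - iota d * t).
  move=> t0 vt hz; have [|d hd] := place_res pv (a := z / t).
    rewrite -[0]/(1 + -1 : int); apply: (vgeM pv hz).
    by rewrite vgeE ?invr_eq0 // (placeV pv) // vt.
  exists d; have -> : z - iota d * t = (z / t - iota d) * t by rewrite mulrBl divfK.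
  by rewrite -[2]/(1 + 1 : int); apply: (vgeM pv hd); rewrite vgeE // vt.
case: (fval_smooth fab) => h.
  have vt := center_sub_y chi fab pv vx vy h; have t0 := sub_y_neq0 chi b.
  have [d hd] := slopeK _ _ t0 vt vx.
  have hl := two _ (('X%:P - a%:P%:P) - d%:P%:P * ('X - b%:P%:P)) _ _ yE (erefl _) dy
    (tdegD dx (tdegN (dC d _ dy))) t0 vt.
  rewrite evBB xE evBM evB_CC yE in hl.
  apply: (@flex_direction _ _ d 1 1 0 t0 vt (hl hd)).
  - by rewrite (rmorph1 iota) mul1r; ring.
  - by rewrite (rmorph1 iota) (rmorph0 iota) mul1r mul0r; ring.
  by rewrite xpair_eqE oner_eq0 andbF.
have vt := center_sub_x chi fab pv vx vy h; have t0 := sub_x_neq0 chi a.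
have [d hd] := slopeK _ _ t0 vt vy.
have hl := two _ (('X - b%:P%:P) - d%:P%:P * ('X%:P - a%:P%:P)) _ _ xE (erefl _) dx
  (tdegD dy (tdegN (dC d _ dx))) t0 vt.
rewrite evBB yE evBM evB_CC xE in hl.
apply: (@flex_direction _ _ 1 d 0 1 t0 vt (hl hd)).
- by rewrite (rmorph1 iota) (rmorph0 iota) mul1r mul0r; ring.
- by rewrite (rmorph1 iota) mul1r; ring.
by rewrite xpair_eqE oner_eq0.
Qed.

End AtPoint.
End TwoCharts.

Lemma tdeg1_ev x y G : tdeg 1 G ->
  ev x y G = iota G`_0`_0 + iota G`_0`_1 * x + iota G`_1`_0 * y.
Proof.
move=> h; have [s1 s2] := tdeg_size h; rewrite (ev_mono x y s1 s2).
rewrite -(pair_bigA _ (fun (i : 'I_2) (j : 'I_2) => iota G`_j`_i * (x ^+ i * y ^+ j))) /=.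
rewrite !big_ord_recl !big_ord0 /= /bump /= !addr0 addn0 (h 1%N 1%N) //.
by rewrite !expr0 !expr1 !mulr1 mul1r rmorph0 !mul0r addr0; ring.
Qed.

(** Monomials of degree at least 2 have pole order at least 2 q > q + 1, while x and y have pole
    orders q + 1 and q. *)
Lemma at_inf_tdeg1 x y v G n : chart x y -> place iota v -> at_inf v x y ->
  tdeg (q - 2) G -> (n <= q.+1)%N -> vge v (- n%:Z) (ev x y G) ->
  [/\ tdeg 1 G, (n < q.+1)%N -> G`_0`_1 = 0 & (n < q)%N -> G`_1`_0 = 0].
Proof.
move=> chi pv hinf hG nq hn; have [sG _] := tdeg_size hG.
have sG' : (size G < q.+2)%N by rewrite ltnS (leq_trans sG) //; move: q_gt2; clear; lia.
have bound i j : G`_j`_i != 0 -> (i * q.+1 + j * q <= n)%N.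
  move=> Gij; have Gn : G != 0 by apply: contraNneq Gij => ->; rewrite !coef0.
  have [i0 [j0 [_ _ vE max]]] := inf_val_ev chi pv hinf sG' Gn.
  rewrite vgeE ?(ev_small_neq0 chi) // vE lerN2 lez_nat in hn.
  exact: leq_trans (max _ _ Gij) hn.
have q2 := q_gt2; split=> [i j lt|lt|lt]; apply/eqP; apply/negPn/negP => /bound h.
- have := leq_trans h nq; have := leq_mul lt (leqnn q); rewrite mulnDl (mulnS i).
  by move: (i * q)%N (j * q)%N q2; clear => *; lia.
- by move: h; rewrite mul1n mul0n addn0 leqNgt lt.
by move: h; rewrite mul1n mul0n add0n leqNgt lt.
Qed.

Hypothesis Dn : exists z, D z != 0.

Lemma dcoefP x y : chart x y -> exists2 c, dcoef x y c & c != 0.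
Proof. by move=> chi; have [c cE] := dcoef_exists chi; exists c => //; apply: dcoef_neq0 chi cE Dn. Qed.

(** Both charts filter one space of differentials by the pole order at v. Its lowest step shows that
    c' / c lies in K; the steps q and q + 1 then express y' by 1, y and x' by 1, y, x. *)
Lemma same_inf_affine x y x' y' v : chart x y -> chart x' y' -> place iota v ->
  at_inf v x y -> at_inf v x' y' -> exists al be ga de ep : K,
  y' = iota al * y + iota be /\ x' = iota ga * x + iota de * y + iota ep.
Proof.
move=> chi chi' pv hinf hinf'; have [c cE c0] := dcoefP chi; have [c' cE' c0'] := dcoefP chi'.
have q2 := q_gt2; have one : (1 <= q - 2)%N by move: q2; clear; lia.
have vcc : v c' = v c.
  have : v c' - ((q - 2) * q.+1)%N%:Z = v c - ((q - 2) * q.+1)%N%:Z.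
    apply: (vge_ext pv) => h; have r1 := reg_inf h chi cE c0 pv hinf.
    by have r2 := reg_inf h chi' cE' c0' pv hinf'; rewrite -r1 -r2.
  by move: (Posz _); clear; lia.
have step G' n : tdeg (q - 2) G' -> v (ev x' y' G') = - n%:Z -> ev x' y' G' != 0 -> (n <= q.+1)%N ->
    exists2 G, [/\ tdeg 1 G, (n < q.+1)%N -> G`_0`_1 = 0 & (n < q)%N -> G`_1`_0 = 0] &
      c' * ev x' y' G' = c * ev x y G.
  move=> hG' vG' n0 nq; have [G hG E] := tdeg_transfer chi' cE' c0' chi cE c0 hG'.
  exists G => //; apply: (at_inf_tdeg1 chi pv hinf hG nq).
  have G0 : ev x y G != 0.
    by apply: contraNneq (mulf_neq0 c0' n0) => e; rewrite E e mulr0.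
  rewrite vgeE //; move: (congr1 v E); rewrite !(placeM pv) // vG' vcc.
  by move: (v c) (v _); clear => *; lia.
have [||G1 [hG1 hx hy]] := step 1%:P%:P 0%N (@tdeg_CC 1 _) _ _ isT.
- by rewrite evB_CC rmorph1 (place1 pv).
- by rewrite evB_CC rmorph1 oner_neq0.
rewrite (tdeg1_ev _ _ hG1) hx // hy; last by move: q2; clear; lia.
rewrite evB_CC !rmorph0 !mul0r !addr0 rmorph1 mulr1; set ka := G1`_0`_0 => cc.
have ka0 : iota ka != 0 by apply: contraNneq c0' => e; rewrite cc e mulr0.
have kaE : c' / c = iota ka by rewrite cc mulrC mulKf.
have y0 := chart_y_neq0 chi'; have x0 := chart_x_neq0 chi'.
have div z G : c' * z = c * ev x y G -> z = ev x y G / iota ka.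
  by move=> e; apply: (mulfI c0'); rewrite e cc; field.
have [|||Gy [hGy hxy _]] := step 'X q _ _ _ (leqnSn q).
- by apply: tdeg_le one _; apply: tdeg_y.
- by rewrite evB_y (inf_val_y chi' pv hinf').
- by rewrite evB_y.
rewrite evB_y => /div; rewrite (tdeg1_ev _ _ hGy) hxy // rmorph0 mul0r addr0 => yE.
have [|||Gx [hGx _ _]] := step 'X%:P q.+1 _ _ _ (leqnn _).
- by apply: tdeg_le one _; apply: tdeg_x.
- by rewrite evB_x (inf_val_x chi' pv hinf').
- by rewrite evB_x.
rewrite evB_x => /div; rewrite (tdeg1_ev _ _ hGx) => xE.
exists (Gy`_1`_0 / ka), (Gy`_0`_0 / ka), (Gx`_0`_1 / ka), (Gx`_1`_0 / ka), (Gx`_0`_0 / ka).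
by rewrite !fmorph_div; split; [rewrite yE | rewrite xE]; field.
Qed.

Lemma flex_center x y x' y' v : chart x y -> chart x' y' -> place iota v ->
  at_inf v x' y' -> at_inf v x y \/
  exists a b, [/\ b ^+ q = b, 2%:R * a = b ^+ 2 & at_pt v x y a b].
Proof.
move=> chi chi' pv hinf'; have [c cE c0] := dcoefP chi; have [c' cE' c0'] := dcoefP chi'.
case: (place_center chi pv) => [[a [b hab]]|]; last by left.
right; exists a, b.
by have [b1 b2] := center_flex chi cE c0 chi' cE' c0' pv hinf' hab.
Qed.

(** * Substitutions over F_q that preserve f *)

(** In both parts of f the extra terms add up to b ^ 2 - 2 a, because Frobenius fixes b and hence
    a. *)
Lemma fval_translate (R : fieldType) (io : {rmorphism K -> R}) a b (x y : R) :
  b ^+ q = b -> 2%:R * a = b ^+ 2 ->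
  fval q (io lam) (x - io b * y + io a) (y - io b) = fval q (io lam) x y.
Proof.
move=> bq ab; have a2 : 2%:R * io a = io b ^+ 2 by rewrite -(rmorph_nat io) -rmorphM ab rmorphXn.
have aq : a ^+ q = a.
  apply: (mulfI two_neq0); rewrite -{1}frob2 -exprMn ab exprAC bq //.
rewrite /fval -/m; congr (_ - _ * _ ^+ _); last first.
  transitivity (y ^+ 2 - 2%:R * x + (io b ^+ 2 - 2%:R * io a)); first by ring.
  by rewrite a2 subrr addr0.
have e1 : (x - io b * y + io a) ^+ q = x ^+ q - io b * y ^+ q + io a.
  by rewrite (frobD io) (frobB io) exprMn -!rmorphXn bq aq.
have e2 : (y - io b) ^+ q = y ^+ q - io b by rewrite (frobB io) -rmorphXn bq.
rewrite exprS [y ^+ q.+1]exprS e1 e2.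
transitivity (y * y ^+ q - (x ^+ q + x) + (io b ^+ 2 - 2%:R * io a)); first by ring.
by rewrite a2 subrr addr0.
Qed.

Lemma chart_translate x y a b : chart x y -> b ^+ q = b -> 2%:R * a = b ^+ 2 ->
  chart (x - iota b * y + iota a) (y - iota b).
Proof.
move=> chi bq ab; apply: (chart_change chi).
- by rewrite fval_translate // (chart_root chi).
- move=> d; apply/eqP => e.
  have : ev x y ('X%:P - b%:P%:P * 'X + (a - d)%:P%:P) = 0.
    by rewrite evBD evBB evBM evB_x evB_y !evB_CC rmorphB addrA e subrr.
  apply/eqP; apply: (ev_small_neq0 chi).
    apply/eqP => /(congr1 (fun P : {poly {poly K}} => P`_0`_1)).
    rewrite !(coefD, coefN, coefCM, coefC, coefX) /= !(mulr0, coefD, coefN, coefCM, coefC, coefX, coef0) /=.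
    by rewrite ?(oppr0, addr0, subr0) => /eqP; rewrite oner_eq0.
  apply: (@leq_ltn_trans 2); last by move: q_gt2; clear; lia.
  apply/leq_sizeP => j j2; rewrite !coefD !coefN coefCM !coefC !coefX.
  by case: j j2 => [|[|j]] //= _; rewrite mulr0 subr0 addr0.
- pose u := x - iota b * y + iota a; pose w := y - iota b.
  exists ('X%:P + b%:P%:P * ('X + b%:P%:P) - a%:P%:P), 1%:P%:P.
  rewrite evBB evBD evBM evBD evB_x evB_y !evB_CC rmorph1 oner_neq0 divr1; split=> //; ring.
exists ('X + b%:P%:P), 1%:P%:P.
by rewrite evBD evB_y !evB_CC rmorph1 oner_neq0 divr1 subrK.
Qed.

(* Sends the F_q-rational point (a, b) of the conic y^2 = 2x to the point at infinity. *)
Definition recenter x y a b := ((x - iota b * y + iota a)^-1, (y - iota b) / (x - iota b * y + iota a)).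

Lemma chart_recenter x y a b : chart x y -> b ^+ q = b -> 2%:R * a = b ^+ 2 ->
  chart (recenter x y a b).1 (recenter x y a b).2.
Proof. by move=> chi bq ab; apply/chart_swap/chart_translate. Qed.

Lemma at_pt_recenter x y a b v : chart x y -> place iota v -> b ^+ q = b -> 2%:R * a = b ^+ 2 ->
  at_pt v x y a b -> at_inf v (recenter x y a b).1 (recenter x y a b).2.
Proof.
move=> chi pv bq ab [fab vx vy].
have x0 := chart_x_neq0 (chart_translate chi bq ab).
rewrite /recenter /=; split; rewrite invrK ?divfK //.
rewrite (_ : x - iota b * y + iota a = (x - iota a) - iota b * (y - iota b)); last first.
  have : 2%:R * iota a = iota b ^+ 2 by rewrite -(rmorph_nat iota) -rmorphM ab rmorphXn.
  move=> e; apply/eqP; rewrite -subr_eq0; apply/eqP.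
  transitivity (2%:R * iota a - iota b ^+ 2); first by ring.
  by rewrite e subrr.
by apply: (vgeB pv) => //; apply: (vgeMl pv) => //; apply: (vge_iota pv).
Qed.

(** Recentring at (a, b) puts the place at infinity in a third chart, so [flex_center] applies to
    it: all charts single out the same places, over the rational points of the conic and
    infinity. *)
Lemma flex_point_image x y x' y' v a b : chart x y -> chart x' y' -> place iota v ->
  b ^+ q = b -> 2%:R * a = b ^+ 2 -> at_pt v x y a b ->
  at_inf v x' y' \/ exists a' b', [/\ b' ^+ q = b', 2%:R * a' = b' ^+ 2 & at_pt v x' y' a' b'].
Proof.
move=> chi chi' pv bq ab h.
exact: flex_center chi' (chart_recenter chi bq ab) pv (at_pt_recenter chi pv bq ab h).
Qed.

Lemma place_val_uniq v z (a b : K) : place iota v -> vge v 1 (z - iota a) -> vge v 1 (z - iota b) -> a = b.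
Proof.
move=> pv ha hb; apply/eqP; rewrite -subr_eq0; apply/negPn/negP => n0.
have := vgeB pv hb ha; have -> : (z - iota b) - (z - iota a) = iota (a - b).
  by rewrite rmorphB; ring.
by rewrite vgeE ?fmorph_eq0 // (placeK pv).
Qed.

Lemma same_inf_borel x y x' y' v : chart x y -> chart x' y' -> place iota v ->
  at_inf v x y -> at_inf v x' y' -> exists al be ep : K,
  [/\ al != 0, al ^+ q = al, be ^+ q = be & 2%:R * ep = be ^+ 2] /\
  y' = iota al * y + iota be /\ x' = iota (al ^+ 2) * x + iota (al * be) * y + iota ep.
Proof.
move=> chi chi' pv hinf hinf'.
have [al [be [ga [de [ep [yE xE]]]]]] := same_inf_affine chi chi' pv hinf hinf'.
(* The rational point (t ^ 2 / 2, t) of the conic is sent to another one; it cannot go to infinity,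
   since x' is integral there. *)
have pt t : t ^+ q = t -> (al * t + be) ^+ q = al * t + be /\
    ga * t ^+ 2 + 2%:R * de * t + 2%:R * ep = (al * t + be) ^+ 2.
  move=> tq; pose s := t ^+ 2 / 2%:R.
  have ts : 2%:R * s = t ^+ 2 by rewrite /s mulrC divfK // two_neq0.
  have sq : s ^+ q = s by rewrite /s exprMn exprVn frob2 exprAC tq.
  have fst : fK s t = 0.
    rewrite /fval -/m ts subrr expr0n exprS tq sq -expr2 -ts -mulr_natr.
    have -> : (m == 0)%N = false by move: two_m; clear; lia.
    by rewrite mulr0 subr0; ring.
  have [w [pw wx wy]] := place_at_point chi fst.
  have hy : vge w 1 (y' - iota (al * t + be)).
    have -> : y' - iota (al * t + be) = iota al * (y - iota t).
      by rewrite yE rmorphD rmorphM; ring.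
    by apply: (vgeMl pw) => //; apply: (vge_iota pw).
  have hx : vge w 1 (x' - iota (ga * s + de * t + ep)).
    have -> : x' - iota (ga * s + de * t + ep) = iota ga * (x - iota s) + iota de * (y - iota t).
      by rewrite xE !rmorphD !rmorphM; ring.
    by apply: (placeD pw); apply: (vgeMl pw) => //; apply: (vge_iota pw).
  case: (flex_point_image chi chi' pw tq ts (And3 fst wx wy)) => [[hu _]|].
    have x0 := chart_x_neq0 chi'; have := vgeM pw hu (vge_integral pw hx).
    by rewrite addr0 mulVf // vgeE ?oner_neq0 // (place1 pw).
  move=> [a' [b' [bq' ab' [_ vx' vy']]]].
  have eb := place_val_uniq pw hy vy'; have ea := place_val_uniq pw hx vx'.
  rewrite eb; split=> //; rewrite -ab' -ea -ts; ring.
(* The parameters 0, 1 and -1 suffice to determine the quadratic polynomial in t. *)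
have one_q : (1 : K) ^+ q = 1 by rewrite expr1n.
have zero_q : (0 : K) ^+ q = 0 by rewrite expr0n; case: q q0.
have m1_q : (-1 : K) ^+ q = -1 by rewrite (exprNn_pchar _ (q_pnat [the {rmorphism K -> K} of idfun])) expr1n.
have [b1 b2] := pt 0 zero_q; have [c1 c2] := pt 1 one_q; have [_ d2] := pt (-1) m1_q.
rewrite mulr0 add0r in b1; rewrite expr0n !mulr0 !add0r in b2.
rewrite mulr1 in c1; rewrite expr1n !mulr1 b2 in c2; rewrite sqrrN expr1n !mulr1 b2 !mulrN1 in d2.
have alq : al ^+ q = al.
  by move: c1; rewrite (frobD [the {rmorphism K -> K} of idfun]) b1 => /addIr.
have e2 : 2%:R * (ga - al ^+ 2) = 0.
  transitivity ((ga + 2%:R * de + be ^+ 2) - (al + be) ^+ 2 + ((ga - 2%:R * de + be ^+ 2) - (- al + be) ^+ 2)).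
    by ring.
  by rewrite c2 d2 !subrr addr0.
have e3 : 2%:R * (2%:R * (de - al * be)) = 0.
  transitivity ((ga + 2%:R * de + be ^+ 2) - (al + be) ^+ 2 - ((ga - 2%:R * de + be ^+ 2) - (- al + be) ^+ 2)).
    by ring.
  by rewrite c2 d2 !subrr.
have gaE : ga = al ^+ 2.
  by move/eqP: e2; rewrite mulf_eq0 (negPf two_neq0) subr_eq0 => /eqP.
have deE : de = al * be.
  by move/eqP: e3; rewrite !mulf_eq0 (negPf two_neq0) subr_eq0 => /eqP.
exists al, be, ep; split; last by rewrite -gaE -deE.
(* With al = 0, y' would be constant, whereas it has a pole of order q. *)
split=> //; apply/eqP => al0.
have := inf_val_y chi' pv hinf'; have := chart_y_neq0 chi'; rewrite yE al0 rmorph0 mul0r add0r.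
move=> be0; rewrite (placeK pv) -?(fmorph_eq0 iota) //.
by move: q0; clear; lia.
Qed.

End Derivation.

(** * A nonzero derivation of the function field *)

Section DerivExists.
Variables (x y : F) (chi : chart x y).
Local Notation W := (slope (iota lam)).

Definition dx (G : {poly {poly K}}) : {poly {poly K}} := map_poly (fun c : {poly K} => c^`()) G.

Lemma coef_dx G j : (dx G)`_j = (G`_j)^`().
Proof. by rewrite /dx coef_map_id0 // deriv0. Qed.

Lemma dxD G H : dx (G + H) = dx G + dx H.
Proof. by apply/polyP => j; rewrite coefD !coef_dx coefD derivD. Qed.

Lemma dxM G H : dx (G * H) = dx G * H + G * dx H.
Proof.
apply/polyP => j; rewrite coefD coef_dx !coefM raddf_sum -big_split /=.
by apply: eq_bigr => i _; rewrite derivM !coef_dx.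
Qed.

Lemma dxC c : dx c%:P = c^`()%:P.
Proof. by apply/polyP => -[|j]; rewrite coef_dx !coefC //= deriv0. Qed.

(** The derivation f_y d/dx - f_x d/dy followed by evaluation at (x, y). It vanishes on f, so it
    descends to K[x, y], and the quotient rule extends it to F. *)
Definition ev_der (G : {poly {poly K}}) : F :=
  ev x y (dx G) * (y ^+ q - y * W x y) + ev x y G^`() * (1 - W x y).

Lemma ev_derD G H : ev_der (G + H) = ev_der G + ev_der H.
Proof. by rewrite /ev_der dxD derivD !evBD; ring. Qed.

Lemma ev_derM G H : ev_der (G * H) = ev_der G * ev x y H + ev x y G * ev_der H.
Proof. by rewrite /ev_der dxM derivM !evBD !evBM; ring. Qed.

Lemma ev_derC c : ev_der c%:P%:P = 0.
Proof. by rewrite /ev_der dxC !derivC polyC0 evB0 !mul0r addr0. Qed.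

Lemma ev_der_x : ev_der 'X%:P = y ^+ q - y * W x y.
Proof. by rewrite /ev_der dxC derivX derivC evB0 polyC1 evB1 mul1r mul0r addr0. Qed.

Lemma ev_der_y : ev_der 'X = 1 - W x y.
Proof.
rewrite /ev_der; have -> : dx 'X = 0.
  by apply/polyP => j; rewrite coef_dx coefX coef0; case: (j == _); rewrite ?deriv0 // -polyC1 derivC.
by rewrite derivX evB0 evB1 mul0r add0r mul1r.
Qed.

Lemma ev_derN G : ev_der (- G) = - ev_der G.
Proof.
by apply/eqP; rewrite -addr_eq0 -ev_derD addNr; have := ev_derC 0; rewrite !polyC0 => ->.
Qed.

Lemma ev_derX G n : ev_der (G ^+ n.+1) = n.+1%:R * ev x y G ^+ n * ev_der G.
Proof.
elim: n => [|n IH]; first by rewrite expr1 expr0; ring.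
rewrite exprS ev_derM IH evBX -[in RHS]natr1 exprS; ring.
Qed.

Lemma ev_derXq G : ev_der (G ^+ q) = 0.
Proof. by rewrite -(prednK q0) ev_derX prednK // (natq0 iota) !mul0r. Qed.

Lemma ev_der_fB : ev_der fBq = 0.
Proof.
have m1 : m = m.-1.+1 by move: two_m; clear; lia.
rewrite /fB /fval -/m !(ev_derD, ev_derN) exprS ev_derM !ev_derXq.
rewrite ev_derM ev_derC m1 (ev_derX ('X^2 - 2%:R * 'X%:P) m.-1) -m1 !(ev_derD, ev_derN).
rewrite (ev_derM 2%:R) (ev_derX 'X 1).
have -> : ev_der 2%:R = 0 by rewrite -!polyC_natr ev_derC.
have gE : ev x y ('X^2 - 2%:R * 'X%:P) = y ^+ 2 - 2%:R * x.
  by rewrite evBB evBX (evBM iota x y 2%:R) evB_nat evB_x evB_y.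
rewrite ev_der_x ev_der_y gE evB_nat evBX evB_x evB_y evB_CC.
have := two_m1 iota; rewrite /slope; move: (m%:R) ((y ^+ 2 - 2%:R * x) ^+ m.-1) => mm S e.
set T := iota lam * S.
transitivity ((1 - T) * (y ^+ q) - (y ^+ q - y * T)
  - (2%:R * mm) * (T * (y * (1 - T) - (y ^+ q - y * T)))).
  by rewrite /T; ring.
by rewrite e; ring.
Qed.

Lemma ev_der_eq G H : ev x y G = ev x y H -> ev_der G = ev_der H.
Proof.
move=> e; apply/eqP; rewrite -subr_eq0 -ev_derN -ev_derD.
have [|L ->] := chart_ker chi (G := G - H); first by rewrite evBB e subrr.
by rewrite ev_derM ev_der_fB evB_fB (chart_root chi) !mul0r addr0.
Qed.

Lemma kder_exists : exists2 D, kder D & exists z, D z != 0.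
Proof.
have repr z : exists GH : {poly {poly K}} * {poly {poly K}},
    ev x y GH.2 != 0 /\ z = ev x y GH.1 / ev x y GH.2.
  by have [G [H GH]] := chart_gen chi z; exists (G, H).
pose R z := proj1_sig (constructive_indefinite_description _ (repr z)).
have RP z : ev x y (R z).2 != 0 /\ z = ev x y (R z).1 / ev x y (R z).2.
  exact: (proj2_sig (constructive_indefinite_description _ (repr z))).
pose Q G H := (ev_der G * ev x y H - ev x y G * ev_der H) / ev x y H ^+ 2.
have QE G H G1 H1 : ev x y H != 0 -> ev x y H1 != 0 ->
    ev x y G / ev x y H = ev x y G1 / ev x y H1 -> Q G H = Q G1 H1.
  move=> h0 h10 e; have e1 : ev x y G * ev x y H1 = ev x y G1 * ev x y H.
    by apply/eqP; rewrite -eqr_div // e.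
  have := ev_der_eq (G := G * H1) (H := G1 * H); rewrite !evBM => /(_ e1).
  rewrite !ev_derM /Q; move: e1 h0 h10.
  move: (ev x y G) (ev x y H) (ev x y G1) (ev x y H1) (ev_der G) (ev_der H) (ev_der G1) (ev_der H1).
  move=> g h g1 h1 dg dh dg1 dh1 e1 h0 h10 e2.
  apply/eqP; rewrite eqr_div ?expf_neq0 // -subr_eq0; apply/eqP.
  transitivity (h * h1 * ((dg * h1 + g * dh1) - (dg1 * h + g1 * dh)) -
    (g * h1 - g1 * h) * (h1 * dh + h * dh1)); first by ring.
  by rewrite e1 e2 !subrr mul0r mulr0 subrr.
pose D z := Q (R z).1 (R z).2.
have DE z G H : ev x y H != 0 -> z = ev x y G / ev x y H -> D z = Q G H.
  move=> h0 e; have [r0 r] := RP z; apply: QE => //; rewrite -r //.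
exists D.
  split=> [u w|u w|c].
  - have [u0 uE] := RP u; have [w0 wE] := RP w; rewrite /(D u) /(D w).
    rewrite (DE (u + w) ((R u).1 * (R w).2 + (R w).1 * (R u).2) ((R u).2 * (R w).2)).
    + rewrite /D /Q ev_derD !ev_derM evBD !evBM; move: u0 w0.
      move: (ev x y _) (ev x y _) (ev x y _) (ev x y _) => a1 a2 a3 a4 u0 w0.
      by field; rewrite ?u0 ?w0.
    + by rewrite evBM mulf_neq0.
    by rewrite {1}uE {1}wE evBD !evBM addf_div.
  - have [u0 uE] := RP u; have [w0 wE] := RP w.
    rewrite (DE (u * w) ((R u).1 * (R w).1) ((R u).2 * (R w).2)).
    + rewrite [X in _ = _ + X * _]uE [X in _ = _ * X + _]wE /D /Q !ev_derM !evBM; move: u0 w0.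
      move: (ev x y _) (ev x y _) (ev x y _) (ev x y _) => a1 a2 a3 a4 u0 w0.
      by field; rewrite ?u0 ?w0.
    + by rewrite evBM mulf_neq0.
    by rewrite {1}uE {1}wE !evBM mulf_div.
  rewrite (DE (iota c) c%:P%:P 1%:P%:P) ?evB_CC ?rmorph1 ?oner_neq0 ?divr1 //.
  by rewrite /Q !ev_derC mul0r mulr0 subrr mul0r.
exists y; rewrite (DE y 'X 1%:P%:P) ?evB_y ?evB_CC ?rmorph1 ?oner_neq0 ?divr1 //.
rewrite /Q ev_derC ev_der_y mulr0 subr0 evB_CC rmorph1 mulr1 expr1n divr1.
exact: slope_neq1 chi.
Qed.

End DerivExists.

Definition borel x y x' y' := exists al be ep : K,
  [/\ al != 0, al ^+ q = al, be ^+ q = be & 2%:R * ep = be ^+ 2] /\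
  y' = iota al * y + iota be /\ x' = iota (al ^+ 2) * x + iota (al * be) * y + iota ep.

Lemma charts_related x y x' y' : chart x y -> chart x' y' -> borel x y x' y' \/
  exists a b, [/\ b ^+ q = b, 2%:R * a = b ^+ 2 &
    borel (recenter x y a b).1 (recenter x y a b).2 x' y'].
Proof.
move=> chi chi'; have [D dD Dn] := kder_exists chi.
have [v pv hinf'] := place_at_inf chi'.
case: (flex_center dD Dn chi chi' pv hinf') => [hinf|[a [b [bq ab hab]]]].
  by left; apply: (same_inf_borel dD Dn chi chi' pv hinf hinf').
right; exists a, b; split=> //.
apply: (same_inf_borel dD Dn (chart_recenter chi bq ab) chi' pv _ hinf').
exact: at_pt_recenter chi pv bq ab hab.
Qed.

Lemma chart_lin_indep x y (al be ga : K) : chart x y ->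
  iota al * x + iota be * y + iota ga = 0 -> [/\ al = 0, be = 0 & ga = 0].
Proof.
move=> chi e.
pose G : {poly {poly K}} := al%:P%:P * 'X%:P + be%:P%:P * 'X + ga%:P%:P.
have Gc j : G`_j = if j == 0%N then al%:P * 'X + ga%:P else if j == 1%N then be%:P else 0.
  rewrite /G -polyCM !coefD coefCM !coefC coefX.
  by case: j => [|[|j]] /=; rewrite ?(mulr0, mulr1, add0r, addr0).
have G0 : G = 0.
  apply/eqP; apply/negPn/negP => Gn.
  have sG : (size G < q.+2)%N.
    apply: (@leq_ltn_trans 2); last by move: q_gt2; clear; lia.
    by apply/leq_sizeP => j j2; rewrite Gc; case: j j2 => [|[|j]].
  have := ev_small_neq0 chi Gn sG.
  by rewrite /G !evBD !evBM evB_x evB_y !evB_CC e eqxx.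
have g0 := Gc 0%N; have g1 := Gc 1%N; rewrite G0 coef0 /= in g0; rewrite G0 coef0 /= in g1.
split.
- by have := congr1 (fun P : {poly K} => P`_1) g0; rewrite coefD coefCM coefX coefC coef0 /= mulr1 addr0.
- by apply/eqP; rewrite -polyC_eq0 -g1.
by have := congr1 (fun P : {poly K} => P`_0) g0; rewrite coefD coefCM coefX coefC coef0 /= mulr0 add0r.
Qed.

(** * The conjugation action of PGL(2, q) *)

Definition mx2 (R : Type) (a b c d : R) : 'M[R]_2 :=
  \matrix_(i, j) if i == 0 then (if j == 0 then a else b) else (if j == 0 then c else d).

Lemma mx2_eta (R : Type) (A : 'M[R]_2) : A = mx2 (A 0 0) (A 0 1) (A 1 0) (A 1 1).
Proof.
apply/matrixP => i j; rewrite mxE.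
have two (u : 'I_2) : u = 0 \/ u = 1 by case: u => [[|[|u]] lt] //; [left | right]; apply/val_inj.
by case: (two i) => ->; case: (two j) => ->.
Qed.

Lemma mx2_inj (R : Type) (a b c d a' b' c' d' : R) :
  mx2 a b c d = mx2 a' b' c' d' -> [/\ a = a', b = b', c = c' & d = d'].
Proof.
move/matrixP => h; split.
- by have := h 0 0; rewrite !mxE.
- by have := h 0 1; rewrite !mxE.
- by have := h 1 0; rewrite !mxE.
by have := h 1 1; rewrite !mxE.
Qed.

Lemma mx2M (R : comNzRingType) (a b c d a' b' c' d' : R) :
  mx2 a b c d *m mx2 a' b' c' d' =
  mx2 (a * a' + b * c') (a * b' + b * d') (c * a' + d * c') (c * b' + d * d').
Proof.
by rewrite [LHS]mx2_eta; congr mx2; rewrite !mxE !big_ord_recl big_ord0 !mxE /= addr0.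
Qed.

Lemma mx2Z (R : comNzRingType) (l a b c d : R) :
  l *: mx2 a b c d = mx2 (l * a) (l * b) (l * c) (l * d).
Proof. by rewrite [LHS]mx2_eta !mxE. Qed.

Lemma det_mx2 (R : comNzRingType) (a b c d : R) : \det (mx2 a b c d) = a * d - b * c.
Proof.
rewrite (expand_det_row _ 0) !big_ord_recl big_ord0 /cofactor !det_mx11 !mxE /= addr0 /bump /=.
by rewrite !expr0 !mul1r expr1; ring.
Qed.

Lemma map_mx2 (R R' : Type) (f : R -> R') a b c d :
  map_mx f (mx2 a b c d) = mx2 (f a) (f b) (f c) (f d).
Proof. by rewrite [LHS]mx2_eta !mxE. Qed.

(* The chart as a traceless matrix: [- \det (Smx x y) = y ^+ 2 - 2 x]. *)
Definition Smx (x y : F) : 'M[F]_2 := mx2 y x (- 2%:R) (- y).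

(** S' = mu g^-1 S g without the inverse. The scalar mu is what restores the entry -2 after
    conjugation. *)
Definition conj_rel (g : 'M[K]_2) x y x' y' := exists2 mu : F, mu != 0 &
  map_mx iota g *m Smx x' y' = mu *: (Smx x y *m map_mx iota g).

Definition frob_fixed (g : 'M[K]_2) := forall i j, g i j ^+ q = g i j.

Lemma frob_fixed_mx2 a b c d : a ^+ q = a -> b ^+ q = b -> c ^+ q = c -> d ^+ q = d ->
  frob_fixed (mx2 a b c d).
Proof. by move=> ha hb hc hd i j; rewrite mxE; case: ifP; case: ifP. Qed.

Lemma frob_fixedM g h : frob_fixed g -> frob_fixed h -> frob_fixed (g *m h).
Proof.
move=> hg hh i j; rewrite !mxE !big_ord_recl big_ord0 addr0.
by rewrite (frobD [the {rmorphism K -> K} of idfun]) !exprMn !hg !hh.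
Qed.

Lemma conj_rel_trans g h x y x' y' x'' y'' :
  conj_rel g x y x' y' -> conj_rel h x' y' x'' y'' -> conj_rel (g *m h) x y x'' y''.
Proof.
move=> [mu mu0 e] [nu nu0 e']; exists (nu * mu); rewrite ?mulf_neq0 // map_mxM.
by rewrite -[LHS]mulmxA e' -scalemxAr [in LHS]mulmxA e -scalemxAl scalerA !mulmxA.
Qed.

Lemma conj_rel_borel x y x' y' : borel x y x' y' ->
  exists g, [/\ frob_fixed g, \det g != 0 & conj_rel g x y x' y'].
Proof.
move=> [al [be [ep [[al0 alq beq epE] [yE xE]]]]].
have e2 : 2%:R * iota ep = iota be ^+ 2 by rewrite -(rmorph_nat iota) -rmorphM epE rmorphXn.
pose e := be / 2%:R; have eE : be = 2%:R * e by rewrite /e mulrC divfK // two_neq0.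
have z0 : (0 : K) ^+ q = 0 by rewrite expr0n; case: q q0.
exists (mx2 1 e 0 al); split.
- apply: frob_fixed_mx2; rewrite ?expr1n //.
  by rewrite /e exprMn exprVn frob2 beq.
- by rewrite det_mx2 mul1r mulr0 subr0.
exists (iota al); first by rewrite fmorph_eq0.
have epE' : iota ep = 2%:R * iota e ^+ 2.
  apply: (mulfI (_ : 2%:R != 0)); first by rewrite -(rmorph_nat iota) fmorph_eq0 two_neq0.
  by rewrite e2 eE rmorphM rmorph_nat; ring.
rewrite /Smx !map_mx2 !mx2M mx2Z rmorph0 rmorph1 yE xE epE' eE !rmorphM rmorph_nat.
by congr mx2; ring.
Qed.

Lemma conj_rel_swap x y : chart x y -> exists g,
  [/\ frob_fixed g, \det g != 0 & conj_rel g x y x^-1 (y / x)].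
Proof.
move=> chi; have x0 := chart_x_neq0 chi.
have z0 : (0 : K) ^+ q = 0 by rewrite expr0n; case: q q0.
exists (mx2 0 1 2%:R 0); split.
- by apply: frob_fixed_mx2; rewrite ?expr1n ?frob2.
- by rewrite det_mx2 mul0r sub0r mul1r oppr_eq0 two_neq0.
exists (- x^-1); first by rewrite oppr_eq0 invr_eq0.
rewrite /Smx !map_mx2 !mx2M mx2Z rmorph0 rmorph1 rmorph_nat.
by congr mx2; field.
Qed.

Lemma charts_conj x y x' y' : chart x y -> chart x' y' ->
  exists g, [/\ frob_fixed g, \det g != 0 & conj_rel g x y x' y'].
Proof.
move=> chi chi'; case: (charts_related chi chi') => [|[a [b [bq ab h]]]].
  exact: conj_rel_borel.
have [|g1 [f1 d1 r1]] := @conj_rel_borel x y (x - iota b * y + iota a) (y - iota b).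
  exists 1, (- b), a; rewrite oner_neq0 expr1n sqrrN ab expr1n; split.
    split=> //; rewrite (exprNn_pchar _ (q_pnat [the {rmorphism K -> K} of idfun])) bq //.
  by rewrite !mul1r rmorphN rmorph1 !mul1r mulNr.
have [g2 [f2 d2 r2]] := conj_rel_swap (chart_translate chi bq ab).
have [g3 [f3 d3 r3]] := conj_rel_borel h.
exists (g1 *m g2 *m g3); split; rewrite ?det_mulmx ?mulf_neq0 //.
  by do !apply: frob_fixedM.
by apply: conj_rel_trans r3; apply: conj_rel_trans r2.
Qed.

(** Comparing the entries -2 of the two matrices shows that their scalars agree. *)
Lemma conj_rel_uniq g c x y x' y' x'' y'' : \det g != 0 -> c != 0 ->
  conj_rel g x y x' y' -> conj_rel (c *: g) x y x'' y'' -> x' = x'' /\ y' = y''.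
Proof.
move=> dg c0 [mu mu0 e] [nu nu0 e'].
have u : map_mx iota g \in unitmx by rewrite map_unitmx unitmxE unitfE.
have ic0 : iota c != 0 by rewrite fmorph_eq0.
have {}e' : map_mx iota g *m Smx x'' y'' = nu *: (Smx x y *m map_mx iota g).
  have ez : map_mx iota (c *: g) = iota c *: map_mx iota g by rewrite map_mxZ.
  apply: (scalerI ic0); rewrite [LHS]scalemxAl -ez e' ez -scalemxAr.
  by rewrite !scalerA mulrC.
have E : nu *: Smx x' y' = mu *: Smx x'' y''.
  apply: (can_inj (mulKmx u)); rewrite -!scalemxAr e e' !scalerA mulrC //.
rewrite /Smx !mx2Z in E; have [ey ex e2 _] := mx2_inj E.
have n2 : - 2%:R != 0 :> F by rewrite oppr_eq0 -(rmorph_nat iota) fmorph_eq0 two_neq0.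
have mn : nu = mu by apply: (mulIf n2).
by rewrite mn in ey ex; split; [apply: (mulfI mu0) | apply: (mulfI mu0)].
Qed.

(** Determinants give ro = 1 or ro = -1. By the linear independence of 1, x, y, the first makes [k0]
    scalar and the second makes it singular. *)
Lemma conj_rel_scalar k0 x y (ro : F) : chart x y -> \det k0 != 0 ->
  map_mx iota k0 *m Smx x y = ro *: (Smx x y *m map_mx iota k0) -> exists c, k0 = c%:M.
Proof.
move=> chi dk e.
have two0 : 2%:R != 0 :> F by rewrite -(rmorph_nat iota) fmorph_eq0 two_neq0.
have ds : \det (Smx x y) != 0.
  rewrite /Smx det_mx2; apply/eqP => h; have : ev x y (2%:R%:P%:P * 'X%:P - 'X^2) = 0.
    by rewrite evBB evBM evB_CC evB_x evBX evB_y -h rmorph_nat; ring.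
  apply/eqP; apply: (ev_small_neq0 chi).
    rewrite -polyCM -opprB oppr_eq0 -size_poly_gt0 size_polyDl ?size_polyXn //.
    by rewrite size_polyN (leq_ltn_trans (size_polyC_leq1 _)).
  rewrite -polyCM -size_polyN opprB size_polyDl ?size_polyXn; first by move: q_gt2; clear; lia.
  by rewrite size_polyN (leq_ltn_trans (size_polyC_leq1 _)).
have ro2 : ro ^+ 2 = 1.
  have := congr1 (fun A : 'M[F]_2 => \det A) e; rewrite detZ !det_mulmx [in RHS]mulrC det_map_mx => h.
  apply: (mulIf (mulf_neq0 ds (_ : iota (\det k0) != 0))); first by rewrite fmorph_eq0.
  by rewrite mul1r mulrC -h mulrC.
have [rk roE] : exists r : K, (r == 1) || (r == -1) /\ ro = iota r.
  move/eqP: ro2; rewrite sqrf_eq1 => /orP[]/eqP->; [exists 1 | exists (-1)].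
    by rewrite eqxx rmorph1.
  by rewrite eqxx orbT rmorphN rmorph1.
case: roE => rk1 roE.
move: e dk; rewrite [k0]mx2_eta; move: (k0 0 0) (k0 0 1) (k0 1 0) (k0 1 1) => a b c d.
rewrite /Smx map_mx2 !mx2M mx2Z det_mx2 roE => e dk; have [e1 e2 _ _] := mx2_inj e.
have [|i1 i2 i3] := @chart_lin_indep x y (- (rk * c)) (a - rk * a) (- 2%:R * b) chi.
  by rewrite !(rmorphN, rmorphB, rmorphM) rmorph_nat; move/eqP: e1; rewrite -subr_eq0 => /eqP e1; rewrite -[RHS]e1; ring.
have [|j1 j2 j3] := @chart_lin_indep x y (a - rk * d) (- b - rk * b) 0 chi.
  by rewrite !(rmorphN, rmorphB, rmorphM) rmorph0; move/eqP: e2; rewrite -subr_eq0 => /eqP e2; rewrite -[RHS]e2; ring.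
case/orP: rk1 => /eqP rk1; rewrite rk1 in i1 i2 i3 j1 j2 j3.
  have c0 : c = 0 by apply/eqP; move/eqP: i1; rewrite mul1r oppr_eq0.
  have b0 : b = 0 by apply/eqP; move/eqP: i3; rewrite mulf_eq0 oppr_eq0 (negPf two_neq0).
  have ad : d = a by apply/eqP; move/eqP: j1; rewrite mul1r subr_eq0 eq_sym.
  exists a; rewrite c0 b0 ad; rewrite [RHS]mx2_eta; congr mx2; by rewrite !mxE.
exfalso; move/eqP: dk; apply.
have c0 : c = 0 by apply/eqP; move/eqP: i1; rewrite mulN1r opprK.
have a0 : a = 0.
  by apply/eqP; move/eqP: i2; rewrite mulN1r opprK -mulr2n -mulr_natl mulf_eq0 (negPf two_neq0).
by rewrite c0 a0 mul0r mulr0 subrr.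
Qed.

Lemma conj_rel_inj g h x y x' y' : chart x y -> \det g != 0 -> \det h != 0 ->
  conj_rel g x y x' y' -> conj_rel h x y x' y' -> exists c, h = c *: g.
Proof.
move=> chi dg dh [mu mu0 e] [nu nu0 e'].
have ug : g \in unitmx by rewrite unitmxE unitfE.
have ug' : map_mx iota g \in unitmx by rewrite map_unitmx.
have [||c E] := @conj_rel_scalar (h *m invmx g) x y (nu / mu) chi.
- by rewrite det_mulmx det_inv mulf_neq0 ?invr_eq0.
- rewrite map_mxM map_invmx.
  have S'E : Smx x' y' = mu *: (invmx (map_mx iota g) *m Smx x y *m map_mx iota g).
    by apply: (can_inj (mulKmx ug')); rewrite e -scalemxAr !mulmxA mulmxV // mul1mx.
  have SE : invmx (map_mx iota g) *m Smx x y = mu^-1 *: (Smx x' y' *m invmx (map_mx iota g)).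
    by rewrite S'E -scalemxAl scalerA mulVf // scale1r mulmxK.
  by rewrite -[LHS]mulmxA SE -scalemxAr [in LHS]mulmxA e' -scalemxAl scalerA [in RHS]mulmxA [_^-1 * _]mulrC.
by exists c; rewrite -mul_scalar_mx -E mulmxKV.
Qed.

Lemma ev_affine x y (al be ga : K) :
  ev x y (al%:P%:P * 'X%:P + be%:P%:P * 'X + ga%:P%:P) = iota al * x + iota be * y + iota ga.
Proof. by rewrite !evBD !evBM evB_x evB_y !evB_CC. Qed.

Lemma conj_chart g x y : chart x y -> frob_fixed g -> \det g != 0 ->
  exists x' y', chart x' y' /\ conj_rel g x y x' y'.
Proof.
move=> chi; rewrite [g]mx2_eta; move: (g 0 0) (g 0 1) (g 1 0) (g 1 1) => a b c d ff dg.
have := ff 0 0; have := ff 0 1; have := ff 1 0; have := ff 1 1; rewrite !mxE /= => dq cq bq aq.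
rewrite det_mx2 in dg.
pose A := iota a; pose B := iota b; pose C := iota c; pose E := iota d.
have Aq : A ^+ q = A by rewrite /A -rmorphXn aq.
have Bq : B ^+ q = B by rewrite /B -rmorphXn bq.
have Cq : C ^+ q = C by rewrite /C -rmorphXn cq.
have Eq : E ^+ q = E by rewrite /E -rmorphXn dq.
have De : iota (a * d - b * c) = A * E - B * C by rewrite rmorphB !rmorphM.
have D0 : A * E - B * C != 0 by rewrite -De fmorph_eq0.
have two0 : 2%:R != 0 :> F by rewrite -(rmorph_nat iota) fmorph_eq0 two_neq0.
have q2 : 2%:R ^+ q = 2%:R :> F by rewrite -(rmorph_nat iota) -rmorphXn frob2.
(* The entries of adj(g) S g are Y, X, -Z and -Y; multiplying by 2 / Z restores the entry -2. *)
pose Z := C ^+ 2 * x + 2%:R * A * C * y + 2%:R * A ^+ 2.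
pose X := E ^+ 2 * x + 2%:R * B * E * y + 2%:R * B ^+ 2.
pose Y := C * E * x + (A * E + B * C) * y + 2%:R * A * B.
have Z0 : Z != 0.
  apply/eqP => e; have [|c2 ac a2] := @chart_lin_indep x y (c ^+ 2) (2%:R * a * c) (2%:R * a ^+ 2) chi.
    by rewrite !rmorphM !rmorph_nat -[RHS]e /Z /A /C; ring.
  have c0 : c = 0 by apply/eqP; rewrite -sqrf_eq0 c2.
  have a0 : a = 0.
    by apply/eqP; rewrite -sqrf_eq0; move/eqP: a2; rewrite mulf_eq0 (negPf two_neq0).
  by move/eqP: dg; apply; rewrite a0 c0 mul0r mulr0 subrr.
have frobL (u v w : F) : u ^+ q = u -> v ^+ q = v -> w ^+ q = w ->
    (u * x + v * y + w) ^+ q = u * x ^+ q + v * y ^+ q + w.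
  by move=> hu hv hw; rewrite !(frobD iota) !exprMn hu hv hw.
have Xq : X ^+ q = E ^+ 2 * x ^+ q + 2%:R * B * E * y ^+ q + 2%:R * B ^+ 2.
  by apply: frobL; rewrite ?exprMn ?q2 ?Bq ?Eq // exprAC ?Eq ?Bq.
have Yq : Y ^+ q = C * E * x ^+ q + (A * E + B * C) * y ^+ q + 2%:R * A * B.
  by apply: frobL; rewrite ?(frobD iota) ?exprMn ?q2 ?Aq ?Bq ?Eq ?Cq.
have Zq : Z ^+ q = C ^+ 2 * x ^+ q + 2%:R * A * C * y ^+ q + 2%:R * A ^+ 2.
  by apply: frobL; rewrite ?exprMn ?q2 ?Aq ?Cq // exprAC ?Aq ?Cq.
have Dq : (A * E - B * C) ^+ q = A * E - B * C by rewrite (frobB iota) !exprMn Aq Bq Cq Eq.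
pose x' := 2%:R * X / Z; pose y' := 2%:R * Y / Z.
have disc : Y ^+ 2 - X * Z = (A * E - B * C) ^+ 2 * (y ^+ 2 - 2%:R * x).
  by rewrite /X /Y /Z; ring.
have herm : 2%:R * Y ^+ q * Y - X ^+ q * Z - X * Z ^+ q =
    (A * E - B * C) ^+ 2 * (2%:R * (y ^+ q * y - (x ^+ q + x))).
  by rewrite Xq Yq Zq /X /Y /Z; move: (x ^+ q) (y ^+ q) => xq yq; ring.
exists x', y'; split; last first.
  exists (2%:R * (A * E - B * C) / Z); first by rewrite !mulf_neq0 ?invr_eq0.
  rewrite /Smx map_mx2 !mx2M mx2Z -/A -/B -/C -/E /x' /y'.
  by congr mx2; rewrite /X /Y; move: Z0; rewrite /Z => Z0; field.
(* The denominator of the inverse substitution: the form Z for the adjugate of g. *)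
pose H : {poly {poly K}} := (c ^+ 2)%:P%:P * 'X%:P + (- (2%:R * c * d))%:P%:P * 'X + (2%:R * d ^+ 2)%:P%:P.
have HE : ev x' y' H = 2%:R ^+ 2 * (A * E - B * C) ^+ 2 / Z.
  rewrite /H ev_affine !(rmorphN, rmorphM, rmorphXn) !rmorph_nat -/A -/B -/C -/E.
  by rewrite /x' /y' /X /Y; move: Z0; rewrite /Z => Z0; field.
have H0 : ev x' y' H != 0 by rewrite HE !mulf_neq0 ?invr_eq0 ?expf_neq0.
apply: (chart_change chi).
- have f0 := chart_root chi; rewrite /fval -/m exprSr in f0.
  apply: (mulfI (expf_neq0 q.+1 Z0)); rewrite mulr0.
  have e1 : Z ^+ q.+1 * y' ^+ q.+1 = 2%:R ^+ 2 * (Y ^+ q * Y).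
    by rewrite -exprMn /y' mulrCA divff // mulr1 exprMn !exprSr q2; ring.
  have e2 : Z ^+ q.+1 * (x' ^+ q + x') = 2%:R * (X ^+ q * Z + X * Z ^+ q).
    rewrite mulrDr {1}exprSr [Z ^+ q * Z]mulrC -mulrA -exprMn /x' mulrCA divff // mulr1 exprMn q2.
    by rewrite exprSr; field.
  have e3 : Z ^+ q.+1 * (y' ^+ 2 - 2%:R * x') ^+ m = 2%:R ^+ 2 * (A * E - B * C) ^+ 2 * (y ^+ 2 - 2%:R * x) ^+ m.
    have -> : Z ^+ q.+1 = (Z ^+ 2) ^+ m by rewrite -exprM two_m.
    rewrite -exprMn (_ : Z ^+ 2 * _ = 2%:R ^+ 2 * (Y ^+ 2 - X * Z)); last by rewrite /x' /y'; field.
    (* For u fixed by Frobenius, (u ^ 2) ^ m = u ^ (q + 1) = u ^ 2, so both parts of f acquire the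
       same factor. *)
    have p2m (u : F) : u ^+ q = u -> (u ^+ 2) ^+ m = u ^+ 2.
      by move=> uq; rewrite -exprM two_m exprS uq.
    by rewrite disc (exprMn m (2%:R ^+ 2)) (exprMn m ((A * E - B * C) ^+ 2)) !p2m // mulrA.
  rewrite /fval -/m !mulrBr e1 e2 (mulrCA _ (iota lam)) e3.
  transitivity (2%:R * (2%:R * Y ^+ q * Y - X ^+ q * Z - X * Z ^+ q) -
    2%:R ^+ 2 * (A * E - B * C) ^+ 2 * (iota lam * (y ^+ 2 - 2%:R * x) ^+ m)); first by ring.
  rewrite herm.
  transitivity (2%:R ^+ 2 * (A * E - B * C) ^+ 2 *
    (y ^+ q * y - (x ^+ q + x) - iota lam * (y ^+ 2 - 2%:R * x) ^+ m)); first by ring.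
  by rewrite f0 mulr0.
(* If x' were the constant r, all coefficients of 2 X - r Z would vanish; 2 (a d - b c) ^ 2 is a
   combination of them. *)
- move=> r; apply/eqP => e.
  have e1 : 2%:R * X - iota r * Z = 0 by rewrite -e /x' divfK // subrr.
  have [|r1 r2 r3] := @chart_lin_indep x y (2%:R * d ^+ 2 - r * c ^+ 2) (2%:R * (2%:R * b * d - r * a * c))
      (2%:R * (2%:R * b ^+ 2 - r * a ^+ 2)) chi.
    by rewrite !(rmorphB, rmorphM, rmorphXn) !rmorph_nat -[RHS]e1 /X /Z /A /B /C /E; ring.
  have {}r2 : 2%:R * b * d - r * a * c = 0.
    by apply/eqP; move/eqP: r2; rewrite mulf_eq0 (negPf two_neq0).
  have {}r3 : 2%:R * b ^+ 2 - r * a ^+ 2 = 0.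
    by apply/eqP; move/eqP: r3; rewrite mulf_eq0 (negPf two_neq0).
  have : 2%:R * (a * d - b * c) ^+ 2 = 0.
    transitivity (a ^+ 2 * (2%:R * d ^+ 2 - r * c ^+ 2) - 2%:R * a * c * (2%:R * b * d - r * a * c)
      + c ^+ 2 * (2%:R * b ^+ 2 - r * a ^+ 2)); first by ring.
    by rewrite r1 r2 r3 !mulr0 subrr addr0.
  by move/eqP; rewrite mulf_eq0 (negPf two_neq0) sqrf_eq0 (negPf dg).
- pose G : {poly {poly K}} := (2%:R * a ^+ 2)%:P%:P * 'X%:P + (- (2%:R * (2%:R * a * b)))%:P%:P * 'X
    + (2%:R * (2%:R * b ^+ 2))%:P%:P.
  exists G, H; split=> //; apply: (canRL (mulfK H0)); rewrite HE.
  rewrite /G ev_affine !(rmorphN, rmorphM, rmorphXn) !rmorph_nat -/A -/B -/C -/E.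
  by rewrite /x' /y' /X /Y; move: Z0; rewrite /Z => Z0; field.
pose G : {poly {poly K}} := (- (2%:R * (a * c)))%:P%:P * 'X%:P + (2%:R * (a * d + b * c))%:P%:P * 'X
  + (- (2%:R * (2%:R * b * d)))%:P%:P.
exists G, H; split=> //; apply: (canRL (mulfK H0)); rewrite HE.
have adE : iota (2%:R * (a * d + b * c)) = 2%:R * (A * E + B * C).
  by rewrite rmorphM rmorph_nat rmorphD !rmorphM.
rewrite /G ev_affine adE !(rmorphN, rmorphM, rmorphXn) !rmorph_nat -/A -/B -/C -/E.
by rewrite /x' /y' /X /Y; move: Z0; rewrite /Z => Z0; field.
Qed.

(** * K-automorphisms as changes of chart *)

Section Kaut.
Variables (s : F -> F) (sK : is_Kaut iota s).

Lemma Kaut_ev x y G : s (ev x y G) = ev (s x) (s y) G.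
Proof.
case: sK => s1 sD sM _ sc.
elim/evB_ind: G => [c|||G H hG hH|G H hG hH].
- by rewrite !evB_CC sc.
- by rewrite !evB_x.
- by rewrite !evB_y.
- by rewrite !evBD sD hG hH.
by rewrite !evBM sM hG hH.
Qed.

Lemma Kaut0 : s 0 = 0.
Proof. by case: sK => _ _ _ _ sc; rewrite -(rmorph0 iota) sc. Qed.

Lemma Kaut_eq0 z : (s z == 0) = (z == 0).
Proof. by case: sK => _ _ _ /bij_inj si _; rewrite -[in LHS]Kaut0 (inj_eq si). Qed.

Lemma Kaut_div u w : s (u / w) = s u / s w.
Proof.
case: sK => s1 sD sM _ _.
have [->|w0] := eqVneq w 0; first by rewrite Kaut0 !invr0 !mulr0 Kaut0.
have sw0 : s w != 0 by rewrite Kaut_eq0.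
by apply: (mulIf sw0); rewrite -sM !divfK.
Qed.

Lemma Kaut_opp u : s (- u) = - s u.
Proof.
case: sK => _ sD _ _ _; apply/eqP.
by rewrite -addr_eq0 -sD addNr Kaut0.
Qed.

Lemma Kaut_chart x y : chart x y -> chart (s x) (s y).
Proof.
move=> chi; case: sK => s1 sD sM [s' sK1 sK2] sc; split=> [|G|z].
- by rewrite -(evB_fB q lam iota) -Kaut_ev evB_fB (chart_root chi) Kaut0.
- by move=> e; apply: (chart_ker chi); apply/eqP; rewrite -Kaut_eq0 Kaut_ev e.
have [G [H [H0 e]]] := chart_gen chi (s' z); exists G, H.
by rewrite -!Kaut_ev Kaut_eq0 H0 -Kaut_div -e sK2.
Qed.

End Kaut.

Lemma Kaut_uniq x y s s' : chart x y -> is_Kaut iota s -> is_Kaut iota s' ->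
  s x = s' x -> s y = s' y -> s =1 s'.
Proof.
move=> chi sK sK' ex ey z; have [G [H [_ ->]]] := chart_gen chi z.
by rewrite (Kaut_div sK) (Kaut_div sK') !(Kaut_ev sK) !(Kaut_ev sK') ex ey.
Qed.

Lemma Kaut_comp s s' : is_Kaut iota s -> is_Kaut iota s' -> is_Kaut iota (s \o s').
Proof.
move=> [a1 aD aM ab ac] [b1 bD bM bb bc].
split=> [|u w|u w||c] /=; first by rewrite b1.
- by rewrite bD.
- by rewrite bM.
- exact: bij_comp.
by rewrite bc.
Qed.

(** Both charts present F as the fraction field of K[X, Y] / (f), so a quotient G / H at one pair
    may be sent to G / H at the other. Exchanging the charts gives the inverse. *)
Lemma chart_aut x y x' y' : chart x y -> chart x' y' ->
  exists2 s, is_Kaut iota s & s x = x' /\ s y = y'.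
Proof.
have hom u w u' w' : chart u w -> chart u' w' -> exists s : F -> F,
    forall G H, ev u w H != 0 -> s (ev u w G / ev u w H) = ev u' w' G / ev u' w' H.
  move=> chi chi'.
  have ker G : ev u w G = 0 -> ev u' w' G = 0.
    by move/(chart_ker chi) => [H ->]; rewrite evBM evB_fB (chart_root chi') mul0r.
  have ker' G : ev u w G != 0 -> ev u' w' G != 0.
    apply: contraNneq => /(chart_ker chi')[H ->].
    by rewrite evBM evB_fB (chart_root chi) mul0r.
  have repr z : exists GH : {poly {poly K}} * {poly {poly K}},
      ev u w GH.2 != 0 /\ z = ev u w GH.1 / ev u w GH.2.
    by have [G [H GH]] := chart_gen chi z; exists (G, H).
  pose R z := proj1_sig (constructive_indefinite_description _ (repr z)).
  have RP z : ev u w (R z).2 != 0 /\ z = ev u w (R z).1 / ev u w (R z).2.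
    exact: (proj2_sig (constructive_indefinite_description _ (repr z))).
  exists (fun z => ev u' w' (R z).1 / ev u' w' (R z).2) => G H H0.
  move: (RP (ev u w G / ev u w H)); move: (R _) => [G1 H1] /= [H10 /eqP].
  rewrite eqr_div // -subr_eq0 -!evBM -evBB => /eqP/ker/eqP.
  by rewrite evBB !evBM subr_eq0 -eqr_div ?ker' // => /eqP.
move=> chi chi'; have [s sE] := hom _ _ _ _ chi chi'; have [s' sE'] := hom _ _ _ _ chi' chi.
have ev1 u w : ev u w 1%:P%:P = 1 by rewrite evB_CC rmorph1.
have s_ev G : s (ev x y G) = ev x' y' G.
  by have := sE G 1%:P%:P; rewrite !ev1 !divr1 oner_neq0 => /(_ isT).
have ker' G : ev x y G != 0 -> ev x' y' G != 0.
  apply: contraNneq => /(chart_ker chi')[H ->].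
  by rewrite evBM evB_fB (chart_root chi) mul0r.
have ker'' G : ev x' y' G != 0 -> ev x y G != 0.
  apply: contraNneq => /(chart_ker chi)[H ->].
  by rewrite evBM evB_fB (chart_root chi') mul0r.
exists s; last by have := s_ev 'X%:P; have := s_ev 'X; rewrite !evB_x !evB_y.
split=> [|u w|u w||c].
- by have := s_ev 1%:P%:P; rewrite !ev1.
- have [G [H [H0 ->]]] := chart_gen chi u; have [G1 [H1 [H10 ->]]] := chart_gen chi w.
  rewrite addf_div // -!evBM -evBD !sE ?evBM ?mulf_neq0 // evBD !evBM.
  by rewrite addf_div ?ker'.
- have [G [H [H0 ->]]] := chart_gen chi u; have [G1 [H1 [H10 ->]]] := chart_gen chi w.
  by rewrite mulf_div -!evBM !sE ?evBM ?mulf_neq0 // mulf_div.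
- exists s' => z.
    by have [G [H [H0 ->]]] := chart_gen chi z; rewrite sE // sE' // ker'.
  by have [G [H [H0 ->]]] := chart_gen chi' z; rewrite sE' // sE // ker''.
by have := s_ev c%:P%:P; rewrite !evB_CC.
Qed.

(** s fixes the entries of g, which lie in K, so it can be applied entrywise. *)
Lemma conj_rel_map s g u w u' w' : is_Kaut iota s -> conj_rel g u w u' w' ->
  conj_rel g (s u) (s w) (s u') (s w').
Proof.
move=> sK [mu mu0 e]; case: (sK) => s1 sD sM _ sc; exists (s mu); first by rewrite Kaut_eq0.
have sS a b : map_mx s (Smx a b) = Smx (s a) (s b).
  by rewrite /Smx map_mx2 !(Kaut_opp sK) (_ : 2%:R = iota 2%:R) ?sc // rmorph_nat.
have sG : map_mx s (map_mx iota g) = map_mx iota g by apply/matrixP => i j; rewrite !mxE sc.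
have mulE (A B : 'M[F]_2) : map_mx s (A *m B) = map_mx s A *m map_mx s B.
  by apply/matrixP => i j; rewrite !mxE !big_ord_recl !big_ord0 !mxE !addr0 sD !sM.
rewrite -sS -{1}sG -mulE e; apply/matrixP => i j; rewrite -sS -{2}sG -mulE.
by rewrite !mxE sM.
Qed.

(** * The isomorphism from PGL(2, q) *)

Section PGLAction.
Variables (Fq : finFieldType) (j : {rmorphism Fq -> K}).
Hypothesis j_frob : forall z : Fq, j z ^+ q = j z.
Hypothesis j_fixed : forall t : K, t ^+ q = t -> exists z, t = j z.
Variables (x y : F) (chi : chart x y).

Local Notation GL := {'GL_2[Fq]}.
Local Notation H := <<scalarsGL Fq>>%g.
Local Notation gmx g := (map_mx j (GLval g) : 'M[K]_2).

Lemma gmxM (g h : GL) : gmx (g * h)%g = gmx g *m gmx h.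
Proof. by rewrite -map_mxM. Qed.

Lemma det_gmx (g : GL) : \det (gmx g) != 0.
Proof.
rewrite det_map_mx fmorph_eq0 -unitfE; have := GL_unitmx g.
by rewrite unitmxE.
Qed.

Lemma frob_fixed_gmx (g : GL) : frob_fixed (gmx g).
Proof. by move=> i i'; rewrite mxE j_frob. Qed.

Lemma gmx_surj (g : 'M[K]_2) : frob_fixed g -> \det g != 0 -> exists h : GL, g = gmx h.
Proof.
move=> fg dg.
have E i i' : exists z, g i i' == j z by have [z ->] := j_fixed (fg i i'); exists z.
pose A : 'M[Fq]_2 := \matrix_(i, i') xchoose (E i i').
have gA : g = map_mx j A.
  by apply/matrixP => i i'; rewrite !mxE; apply/eqP; exact: xchooseP (E i i').
have uA : A \in unitmx by rewrite unitmxE unitfE -(fmorph_eq0 j) -det_map_mx -gA.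
by exists (insubd (1%g : GL) (A : 'M_(2.-1.+1))); rewrite gA; congr map_mx; rewrite insubdK.
Qed.

Lemma scalarsGL_gen : H = scalarsGL Fq.
Proof.
apply: gen_set_id; apply/group_setP; split=> [|g h].
  by rewrite inE; apply/is_scalar_mxP; exists 1.
rewrite !inE => /is_scalar_mxP[a ga] /is_scalar_mxP[b hb]; apply/is_scalar_mxP.
by exists (a * b); rewrite -[LHS]/(GLval g *m GLval h) ga hb -scalar_mxM.
Qed.

Lemma norm_scalarsGL (g : GL) : g \in 'N(H)%g.
Proof.
apply: (subsetP (cent_sub _)); apply/centP => h; rewrite scalarsGL_gen inE.
move=> /is_scalar_mxP[a ha]; apply/val_inj.
by rewrite -[LHS]/(GLval g *m GLval h) -[RHS]/(GLval h *m GLval g) ha scalar_mxC.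
Qed.

(** A scalar c of K relating two nonzero matrices over F_q is fixed by Frobenius, hence lies in
    F_q. *)
Lemma coset_gmx (g h : GL) :
  coset H g = coset H h <-> exists2 c, c != 0 & gmx g = c *: gmx h.
Proof.
split.
  move/(rcoset_kercosetP (norm_scalarsGL g) (norm_scalarsGL h)).
  rewrite mem_rcoset /= scalarsGL_gen inE => /is_scalar_mxP[a e].
  have gE : GLval g = a *: GLval h.
    have -> : GLval g = GLval (g * h^-1)%g *m GLval h.
      by rewrite -[RHS]/(GLval (g * h^-1 * h)%g) mulgKV.
    by rewrite e mul_scalar_mx.
  exists (j a); last by rewrite gE map_mxZ.
  apply: contraTneq (det_gmx g) => a0.
  by rewrite gE map_mxZ a0 scale0r det0 ?eqxx.
case=> c c0 e; apply/(rcoset_kercosetP (norm_scalarsGL g) (norm_scalarsGL h)).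
rewrite mem_rcoset /= scalarsGL_gen inE.
have [|z cz] := @j_fixed c.
  have [i [i' hi]] : exists i, exists i', gmx h i i' != 0.
    have [/existsP[i /existsP[i' hi]]|] := boolP [exists i, exists i', gmx h i i' != 0].
      by exists i, i'.
    rewrite negb_exists => /forallP n; have := det_gmx h.
    rewrite (_ : gmx h = 0) ?det0 ?eqxx //; apply/matrixP => i i'; rewrite [RHS]mxE.
    by have := n i; rewrite negb_exists => /forallP/(_ i'); rewrite negbK => /eqP.
  have e1 := congr1 (fun A : 'M[K]_2 => A i i') e; rewrite [RHS]mxE in e1.
  apply: (mulIf hi); rewrite -e1 -[in LHS](frob_fixed_gmx h) -exprMn -e1.
  exact: frob_fixed_gmx.
apply/is_scalar_mxP; exists z.
have e' : GLval g = z *: GLval h.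
  apply/matrixP => i i'; apply: (fmorph_inj j); have := congr1 (fun A : 'M[K]_2 => A i i') e.
  by rewrite !mxE rmorphM -cz.
rewrite -[LHS]/(GLval g *m GLval (h^-1)%g) e' -scalemxAl.
rewrite -[GLval h *m _]/(GLval (h * h^-1)%g) mulgV.
by rewrite -[GLval 1]/(1%:M) scalemx1.
Qed.

Definition acts_as (C : coset_of H) (s : F -> F) := is_Kaut iota s /\
  exists2 g : GL, C = coset H g & conj_rel (gmx g) x y (s x) (s y).

Lemma acts_as_exists C : exists s, acts_as C s.
Proof.
have [g _ ->] := cosetP C.
have [x' [y' [chi' r]]] := conj_chart chi (frob_fixed_gmx g) (det_gmx g).
have [s sK [ex ey]] := chart_aut chi chi'.
by exists s; split=> //; exists g; rewrite // ex ey.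
Qed.

Lemma acts_as_uniq C s s' : acts_as C s -> acts_as C s' -> s =1 s'.
Proof.
move=> [sK [g Cg r]] [sK' [h Ch r']].
have /coset_gmx[c c0 e] : coset H h = coset H g by rewrite -Ch.
rewrite e in r'; have [ex ey] := conj_rel_uniq (det_gmx g) c0 r r'.
exact: Kaut_uniq chi sK sK' ex ey.
Qed.

(** Applying s to the relation of s' keeps its matrix h, so the composite belongs to g h in this
    order. *)
Lemma acts_asM C C' s s' : acts_as C s -> acts_as C' s' -> acts_as (C * C')%g (s \o s').
Proof.
move=> [sK [g -> r]] [sK' [h -> r']]; split; first exact: Kaut_comp.
exists (g * h)%g; first by rewrite morphM ?norm_scalarsGL.
by rewrite gmxM; apply: conj_rel_trans r _; apply: conj_rel_map.
Qed.

Lemma acts_as_inj C C' s s' : acts_as C s -> acts_as C' s' -> s =1 s' -> C = C'.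
Proof.
move=> [sK [g -> r]] [sK' [h -> r']] e; rewrite -!e in r'.
have [c hc] := conj_rel_inj chi (det_gmx g) (det_gmx h) r r'.
symmetry; apply/coset_gmx; exists c => //.
by apply: contraTneq (det_gmx h) => c0; rewrite hc c0 scale0r det0 ?eqxx.
Qed.

Lemma acts_as_surj s : is_Kaut iota s -> exists C, acts_as C s.
Proof.
move=> sK; have [g [fg dg r]] := charts_conj chi (Kaut_chart sK chi).
have [h hE] := gmx_surj fg dg; exists (coset H h); split=> //.
by exists h; rewrite // -hE.
Qed.

Lemma iso_PGL2 : iso_to_Kaut (PGL2 Fq) iota.
Proof.
pose phi C := proj1_sig (constructive_indefinite_description _ (acts_as_exists C)).
have phiP C : acts_as C (phi C).
  exact: (proj2_sig (constructive_indefinite_description _ (acts_as_exists C))).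
exists phi; split.
- by move=> C _; case: (phiP C).
- by move=> C C' _ _; apply: acts_as_uniq (phiP _) (acts_asM (phiP C) (phiP C')).
- by move=> C C' _ _; apply: acts_as_inj.
move=> s /acts_as_surj[C Cs]; exists C; last exact: acts_as_uniq (phiP C) Cs.
by have [g Ng ->] := cosetP C; apply: mem_quotient; rewrite inE.
Qed.

End PGLAction.

End Charts.

(** * Existence of the function field *)

Section Convert.
Variables (K F : fieldType) (iota : {rmorphism K -> F}) (q : nat) (lam : K).

Definition toB : {mpoly K[2]} -> {poly {poly K}} :=
  mmap (polyC \o polyC) (pt2 'X%:P 'X).

Definition ofB : {poly {poly K}} -> {mpoly K[2]} := evB (@mpolyC 2 K) (ax K) (ay K).

Definition toB_rmorph : {rmorphism {mpoly K[2]} -> {poly {poly K}}} :=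
  mmap (polyC \o polyC) (pt2 'X%:P 'X).

Lemma toBM g h : toB (g * h) = toB g * toB h.
Proof. exact: (rmorphM toB_rmorph). Qed.

Lemma toB_x : toB (ax K) = 'X%:P.
Proof. by rewrite /toB mmapX mmap1U /pt2 /= inordK. Qed.

Lemma toB_y : toB (ay K) = 'X.
Proof. by rewrite /toB mmapX mmap1U /pt2 /= inordK. Qed.

Lemma mmap_toB (A : comNzRingType) (phi : {rmorphism K -> A}) x y g :
  mmap phi (pt2 x y) g = evB phi x y (toB g).
Proof.
rewrite /toB /mmap rmorph_sum; apply: eq_bigr => mm _.
rewrite [RHS]evBM evB_CC; congr (_ * _); rewrite /mmap1 rmorph_prod.
apply: eq_bigr => i _; rewrite [RHS]evBX; congr (_ ^+ _).
by rewrite /pt2; case: ifP; rewrite ?evB_x ?evB_y.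
Qed.

Lemma ev2E x y g : ev2 iota x y g = evB iota x y (toB g).
Proof. exact: mmap_toB. Qed.

Lemma toBK g : ofB (toB g) = g.
Proof.
rewrite /ofB -(mmap_toB (@mpolyC 2 K)) /mmap [RHS]mpolyE.
apply: eq_bigr => mm _; rewrite -mul_mpolyC; congr (_ * _).
rewrite -(mmap1_id K mm); apply: mmap1_eq => i; rewrite /pt2 /ax /ay.
by case: i => [[|[|n]] lt] //=; congr 'X_(_); apply: val_inj; rewrite /= inordK.
Qed.

Lemma ofBK G : toB (ofB G) = G.
Proof.
elim/evB_ind: G => [c|||G H hG hH|G H hG hH].
- by rewrite /ofB evB_CC /toB mmapC.
- by rewrite /ofB evB_x toB_x.
- by rewrite /ofB evB_y toB_y.
- by rewrite /ofB evBD /toB rmorphD; congr (_ + _).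
by rewrite /ofB evBM /toB rmorphM; congr (_ * _).
Qed.

Lemma toB_curve : toB (curve_aff q lam) = fB q lam.
Proof.
have := @rmorph_fval {mpoly K[2]} {poly {poly K}} toB_rmorph q (mpolyC 2 lam) (ax K) (ay K).
have -> : toB_rmorph (mpolyC 2 lam) = lam%:P%:P by apply: mmapC.
by move=> e; apply: etrans e _; congr fval; [exact: toB_x | exact: toB_y].
Qed.

End Convert.

Lemma fracP (R : idomainType) (z : {fraction R}) :
  exists n d : R, d != 0 /\ z = @FracField.tofrac R n / @FracField.tofrac R d.
Proof.
elim/quotW: z => r; exists (\n_r), (\d_r); split; first exact: denom_ratioP.
have d0 : @FracField.tofrac R \d_r != 0.
  have := denom_ratioP r; apply: contraNneq => /eqP; rewrite -(rmorph0 (@FracField.tofrac R)).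
  by rewrite tofrac_eq0.
apply: (canRL (mulfK d0)).
rewrite -[LHS]/(FracField.mul _ _) !piE; apply/eqmodP.
rewrite /= FracField.equivfE /FracField.mulf !numden_Ratio ?mulf_neq0 ?denom_ratioP ?oner_eq0 //.
by rewrite !mulr1 mulrC.
Qed.

Lemma clear_denominators (R : idomainType) (P : {poly {fraction R}}) :
  exists c P0, c != 0 /\ map_poly (@FracField.tofrac R) P0 = @FracField.tofrac R c *: P.
Proof.
elim/poly_ind: P => [|P z [c [P0 [c0 E]]]].
  by exists 1, 0; rewrite oner_neq0 scaler0 rmorph0.
have [n [d [d0 ->]]] := fracP z.
have td : @FracField.tofrac R d != 0 by rewrite tofrac_eq0.
exists (c * d), (d%:P * P0 * 'X + (c * n)%:P); split; first by rewrite mulf_neq0.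
rewrite rmorphD !rmorphM /= !map_polyC map_polyX /= E scalerDr -!mul_polyC polyCM.
have dd : (@FracField.tofrac R d)%:P * (@FracField.tofrac R d)^-1%:P = 1.
  by rewrite -polyCM divff.
have aux1 (A : comNzRingType) (u v w t : A) : u * (v * w) * t = v * u * (w * t) by ring.
have aux2 (A : comNzRingType) (u v w t : A) : u * v = 1 -> w * t = w * u * (t * v).
  by move=> e; rewrite mulrACA e mulr1.
congr (_ + _); first exact: (@aux1 {poly {fraction R}}).
exact: (@aux2 {poly {fraction R}}).
Qed.

Section Existence.
Variables (q : nat) (K : fieldType) (lam : K).
Hypotheses (q_odd : odd q) (q_gt1 : (1 < q)%N) (lam1 : lam != 1).

Local Notation R := {poly K}.
Local Notation Fr := {fraction {poly K}}.
Local Notation tf := (@FracField.tofrac {poly K}).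

Lemma tofrac_inj : injective tf.
Proof. by move=> u w /eqP; rewrite tofrac_eq => /eqP. Qed.

Lemma size_map_tofrac (P : {poly R}) : size (map_poly tf P) = size P.
Proof. by rewrite size_map_inj_poly // ?rmorph0 //; apply: tofrac_inj. Qed.

(** Cleared of denominators, a factorisation over K(x) becomes one of N f in K[x][y], to which
    [mul_fB_factor] applies. *)
Lemma fB_frac_irreducible : irreducible_poly (map_poly tf (fB q lam)).
Proof.
have sf : size (map_poly tf (fB q lam)) = q.+2.
  by rewrite size_map_tofrac size_fB.
split=> [|P sP]; first by rewrite sf.
case/dvdpP => S E.
have fn : map_poly tf (fB q lam) != 0 by rewrite -size_poly_gt0 sf.
have Pn : P != 0 by apply: contraNneq fn => P0; rewrite E P0 mulr0.
have Sn : S != 0 by apply: contraNneq fn => S0; rewrite E S0 mul0r.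
have [c [P0 [c0 EP]]] := clear_denominators P; have [d [S0 [d0 ES]]] := clear_denominators S.
have tc : tf c != 0 by rewrite tofrac_eq0.
have td : tf d != 0 by rewrite tofrac_eq0.
have e : (c * d)%:P * fB q lam = P0 * S0.
  apply: (map_inj_poly tofrac_inj (rmorph0 _)).
  rewrite !rmorphM /= !map_polyC /= E EP ES -!mul_polyC.
  have aux (A : comNzRingType) (u v w t : A) : u * v * (w * t) = u * t * (v * w) by ring.
  exact: (@aux {poly Fr}).
have sP0 : size P0 = size P.
  by rewrite -(size_map_tofrac P0) EP; exact: (size_scale P tc).
have sS0 : size S0 = size S.
  by rewrite -(size_map_tofrac S0) ES; exact: (size_scale S td).
have := mul_fB_factor q_odd q_gt1 lam1 (mulf_neq0 c0 d0) e.
rewrite sP0 sS0.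
case/orP => [s1|s1]; first by case: (size P) (size_poly_gt0 P) sP s1 => [|[|u]] //; rewrite Pn.
have /size_poly1P[a a0 Sa] : size S == 1%N by rewrite eqn_leq s1 size_poly_gt0.
by rewrite E Sa mul_polyC eqp_sym eqp_scale.
Qed.

(** F is obtained from K(x) by adjoining a root of f. *)
Lemma chart_exists : exists (F : fieldType) (iota : {rmorphism K -> F}) (x y : F),
  chart q lam iota x y.
Proof.
have [L _ [z rz gz]] := irredp_FAdjoin fB_frac_irreducible.
pose al : {rmorphism Fr -> L} := in_alg L.
pose iota : {rmorphism K -> L} := (al \o tf) \o polyC.
pose x : L := al (tf 'X).
have evP (c : R) : (map_poly iota c).[x] = al (tf c).
  elim/poly_ind: c => [|c d IH]; first by rewrite !rmorph0 horner0.
  by rewrite !rmorphD !rmorphM /= map_polyX map_polyC hornerMXaddC IH.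
have evE (G : {poly R}) : evB iota x z G = (map_poly al (map_poly tf G)).[z].
  elim/poly_ind: G => [|G c IH]; first by rewrite evB0 !rmorph0 horner0.
  rewrite evBD evBM evB_y evB_C evP IH.
  by rewrite !rmorphD !rmorphM /= !map_polyX !map_polyC hornerMXaddC.
have rz0 : evB iota x z (fB q lam) = 0 by rewrite evE; exact: (eqP rz).
exists L, iota, x, z; split.
- by rewrite -(evB_fB q lam iota).
- move=> G G0; have [//|h] := excluded_middle_informative (exists H, G = fB q lam * H).
  have [U [W [N [N0 E]]]] := fB_bezout q_odd q_gt1 lam1 h.
  have : evB iota x z (U * fB q lam + W * G) = 0.
    by rewrite evBD !evBM G0 rz0 !mulr0 addr0.
  by rewrite E evB_C evP => /eqP; rewrite fmorph_eq0 tofrac_eq0 (negPf N0).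
move=> w; have : w \in <<1; z>>%VS by rewrite gz memvf.
case/Fadjoin1_polyP => P ->; have [c [P0 [c0 EP]]] := clear_denominators P.
have tc : al (tf c) != 0 by rewrite fmorph_eq0 tofrac_eq0.
exists P0, c%:P; rewrite evB_C evP; split=> //.
by apply: (canRL (mulfK tc)); rewrite evE EP linearZ /= hornerZ mulrC.
Qed.

End Existence.

(** * Embedding the finite field into K *)

Section Embed.
Variables (p : nat) (K : fieldType).
Hypotheses (charK : p \in [pchar K]).
Hypothesis closedK : forall P : {poly K}, size P != 1%N -> exists x, root P x.

Section FpMorph.
Variables (R : comNzRingType) (charR : p \in [pchar R]).

(* The proof argument lets the ring morphism instance be inferred. *)
Definition Fp_to of p \in [pchar R] := fun z : 'F_p => (z : nat)%:R : R.

Local Notation h := (Fp_to charR).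

Lemma Fp_to_nat n : h n%:R = n%:R.
Proof.
by rewrite /Fp_to val_Fp_nat ?(GRing.natr_mod_pchar charR) // (pcharf_prime charR).
Qed.

Lemma Fp_natE (z : 'F_p) : z = (z : nat)%:R.
Proof. by rewrite natr_Zp. Qed.

Lemma Fp_to_zmod : zmod_morphism h.
Proof.
have D u w : h (u + w) = h u + h w.
  by rewrite (Fp_natE u) (Fp_natE w) -natrD !Fp_to_nat natrD.
by move=> u w; apply/eqP; rewrite eq_sym subr_eq -D subrK.
Qed.

Lemma Fp_to_monoid : monoid_morphism h.
Proof.
split=> [|u w]; first by rewrite -[1]/(1%:R) Fp_to_nat.
by rewrite (Fp_natE u) (Fp_natE w) -natrM !Fp_to_nat natrM.
Qed.

HB.instance Definition _ := GRing.isZmodMorphism.Build 'F_p R h Fp_to_zmod.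
HB.instance Definition _ := GRing.isMonoidMorphism.Build 'F_p R h Fp_to_monoid.

End FpMorph.

Variables (Fq : finFieldType) (charFq : p \in [pchar Fq]).

Local Notation toFq := (Fp_to charFq).
Local Notation toK := (Fp_to charK).

Lemma finField_generator : exists al : Fq, forall z, z = 0 \/ exists i, z = al ^+ i.
Proof.
have /cyclicP[u uE] := field_unit_group_cyclic [set: {unit Fq}]%G.
exists (val u) => z; have [->|z0] := eqVneq z 0; [by left | right].
have zu : z \is a GRing.unit by rewrite unitfE.
have : FinRing.unit Fq zu \in [set: {unit Fq}]%g by rewrite inE.
rewrite uE => /cycleP[i e]; exists i.
by have := congr1 val e; rewrite FinRing.val_unitX.
Qed.

(** A generator [al] of the unit group generates Fq over F_p. It is sent to a root in K of its
    minimal polynomial, and every other element through any polynomial expression in [al]. *)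
Lemma finField_embed : exists j : {rmorphism Fq -> K}, True.
Proof.
have [al gen] := finField_generator.
pose evF (P : {poly 'F_p}) := (map_poly toFq P).[al].
have evFD P Q : evF (P + Q) = evF P + evF Q by rewrite /evF rmorphD hornerD.
have evFM P Q : evF (P * Q) = evF P * evF Q by rewrite /evF rmorphM hornerM.
have evF1 : evF 1 = 1 by rewrite /evF rmorph1 hornerC.
have evFX n : evF ('X^n) = al ^+ n by rewrite /evF rmorphXn /= map_polyX hornerXn.
have surj z : exists P, evF P == z.
  case: (gen z) => [->|[i ->]]; first by exists 0; rewrite /evF rmorph0 horner0.
  by exists 'X^i; rewrite evFX.
(* The minimal polynomial up to a scalar, as a nonzero polynomial of least size vanishing at [al]; X
   ^ |Fq| - X shows that such polynomials exist. *)
have [mu [mu0 muF mumin]] : exists mu, [/\ mu != 0, evF mu = 0 &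
    forall P, evF P = 0 -> P != 0 -> (size mu <= size P)%N].
  have ex : exists n, [exists P : n.-tuple 'F_p, (Poly P != 0) && (evF (Poly P) == 0)].
    pose P : {poly 'F_p} := 'X^#|Fq| - 'X.
    have P0 : P != 0.
      rewrite -size_poly_gt0 size_polyDl ?size_polyXn // size_polyN size_polyX.
      by rewrite ltnS finNzRing_gt1.
    exists (size P); apply/existsP; exists (in_tuple P).
    rewrite /= polyseqK P0 /= /P /evF rmorphB rmorphXn /= map_polyX hornerD hornerN hornerXn hornerX.
    by rewrite expf_card subrr.
  case: (ex_minnP ex) => n /existsP[P /andP[P0 /eqP PF]] nmin.
  exists (Poly P); split=> // Q QF Q0.
  apply: (@leq_trans n); first by rewrite (leq_trans (size_Poly _)) // size_tuple.
  by apply: nmin; apply/existsP; exists (in_tuple Q); rewrite /= polyseqK Q0 QF eqxx.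
have kerF P : evF P = 0 -> mu %| P.
  move=> PF; rewrite /dvdp; apply/negPn/negP => r0.
  have rF : evF (P %% mu) = 0.
    have := evFD (P %/ mu * mu) (P %% mu); rewrite -divp_eq evFM muF mulr0 add0r => <-.
    exact: PF.
  by have := mumin _ rF r0; rewrite leqNgt ltn_modp mu0.
have [be rbe] : exists be, root (map_poly toK mu) be.
  apply: closedK; rewrite size_map_poly; apply/negP => /size_poly1P[c c0 e].
  move: muF; rewrite /evF e map_polyC hornerC => /eqP.
  by rewrite fmorph_eq0 (negPf c0).
pose evK (P : {poly 'F_p}) := (map_poly toK P).[be].
have evKD P Q : evK (P + Q) = evK P + evK Q by rewrite /evK rmorphD hornerD.
have evKM P Q : evK (P * Q) = evK P * evK Q by rewrite /evK rmorphM hornerM.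
have evK_eq P Q : evF P = evF Q -> evK P = evK Q.
  move=> e; have : evF (P - Q) = 0.
    by rewrite /evF rmorphB hornerD hornerN -/(evF P) -/(evF Q) e subrr.
  move/kerF/dvdpP => [S E]; have -> : P = S * mu + Q by rewrite -E subrK.
  by rewrite evKD evKM [evK mu](eqP rbe) mulr0 add0r.
pose j : Fq -> K := fun z => evK (xchoose (surj z)).
have jE P : j (evF P) = evK P by apply: evK_eq; apply/eqP; exact: xchooseP (surj (evF P)).
have rep z : exists P, z = evF P by have [P /eqP <-] := surj z; exists P.
have jD u w : j (u + w) = j u + j w.
  by have [P ->] := rep u; have [Q ->] := rep w; rewrite -evFD !jE evKD.
have jz : zmod_morphism j.
  by move=> u w; apply/eqP; rewrite eq_sym subr_eq -jD subrK.
have jm : monoid_morphism j.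
  split=> [|u w]; first by rewrite -evF1 jE /evK rmorph1 hornerC.
  by have [P ->] := rep u; have [Q ->] := rep w; rewrite -evFM !jE evKM.
pose jr : {rmorphism Fq -> K} := HB.pack j
  (GRing.isZmodMorphism.Build Fq K j jz) (GRing.isMonoidMorphism.Build Fq K j jm).
by exists jr.
Qed.

End Embed.

(** * Nonsingularity *)

Section Nonsingular.
Variables (q : nat) (K : fieldType) (lam : K).
Hypotheses (frobD : forall u w : K, (u + w) ^+ q = u ^+ q + w ^+ q).
Hypotheses (q0 : q%:R = 0 :> K) (q_odd : odd q) (q_gt2 : (2 < q)%N).
Hypotheses (frobN : forall u : K, (- u) ^+ q = - u ^+ q).
Hypotheses (lam1 : lam != 1) (lamN1 : lam != -1).

Let m := (q.+1)./2.

Section Gradient.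
Variables (v : 'I_3 -> K) (i : 'I_3).
Let d (P : {mpoly K[3]}) := meval v P^`M(i).

Lemma mevalX_nat (P : {mpoly K[3]}) n : meval v (P ^+ n) = meval v P ^+ n.
Proof. exact: (rmorphXn (meval v)). Qed.

Lemma graD P Q : d (P + Q) = d P + d Q.
Proof. by rewrite /d mderivD mevalD. Qed.

Lemma graN P : d (- P) = - d P.
Proof. by rewrite /d mderivN mevalN. Qed.

Lemma graM P Q : d (P * Q) = d P * meval v Q + meval v P * d Q.
Proof. by rewrite /d mderivM mevalD !mevalM. Qed.

Lemma graC c : d c%:MP = 0.
Proof. by rewrite /d mderivC meval0. Qed.

Lemma graX P n : d (P ^+ n.+1) = n.+1%:R * meval v P ^+ n * d P.
Proof.
elim: n => [|n IH]; first by rewrite expr1 expr0; ring.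
rewrite exprS graM IH mevalX_nat -[in RHS]natr1 exprS; ring.
Qed.

Lemma graXq P : d (P ^+ q) = 0.
Proof.
have e : q = q.-1.+1 by move: q_gt2; clear; lia.
by rewrite e graX -e q0 !mul0r.
Qed.

Lemma gra_var (l : 'I_3) : d 'X_l = (l == i)%:R.
Proof.
rewrite /d mderivX mnm1E; case: eqP => [->|_]; last by rewrite scale0r meval0.
rewrite scale1r (_ : (_ - _)%MM = 0%MM) ?mpolyX0 ?meval1 //.
by apply/mnmP => w; rewrite mnmBE subnn mnm0E.
Qed.

End Gradient.

(** Since q = 0 and 2 m = 1 in K, each partial derivative has the form u ^ q - t u, up to sign, with
    the same t and u one of the coordinates. *)
Lemma curveF_gradient (v : 'I_3 -> K) (i : 'I_3) :
  let X := v (inord 0) in let Y := v (inord 1) in let Z := v (inord 2) in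
  let t := lam * (Y ^+ 2 - 2%:R * X * Z) ^+ m.-1 in
  meval v (curveF q lam)^`M(i) =
    (inord 1 == i)%:R * (Y ^+ q - t * Y) - (inord 2 == i)%:R * (X ^+ q - t * X)
    - (inord 0 == i)%:R * (Z ^+ q - t * Z).
Proof.
move=> X Y Z t; have two : (2 * m = q.+1)%N by rewrite mul2n even_halfK //= q_odd.
have m1 : m = m.-1.+1 by move: two; clear; lia.
have mm1 : 2%:R * m%:R = 1 :> K by rewrite -natrM two -addn1 natrD q0 add0r.
rewrite /curveF -/m !(graD, graN) exprS !graM !graXq graC m1 graX -m1 !(graD, graN).
rewrite (graM v i (2%:R * cX K)) (graM v i 2%:R) (graX v i (cY K) 1).
have -> : meval v (2%:R : {mpoly K[3]})^`M(i) = 0.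
  by rewrite -[2%:R]/((1 : {mpoly K[3]}) + 1) mderivD -mpolyC1 !mderivC addr0 meval0.
have eX : meval v (cX K) = X by apply: mevalXU.
have eY : meval v (cY K) = Y by apply: mevalXU.
have eZ : meval v (cZ K) = Z by apply: mevalXU.
have e2 : meval v 2%:R = 2%:R :> K by rewrite -[2%:R]/((1 : {mpoly K[3]}) + 1) mevalD meval1.
have eQ : meval v (cY K ^+ 2 - 2%:R * cX K * cZ K) = Y ^+ 2 - 2%:R * X * Z.
  by rewrite mevalB !mevalM e2 eX eY eZ.
rewrite !mevalX_nat eQ !mevalM e2 eX eY eZ mevalC.
have dX : meval v (cX K)^`M(i) = (inord 0 == i)%:R by apply: gra_var.
have dY : meval v (cY K)^`M(i) = (inord 1 == i)%:R by apply: gra_var.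
have dZ : meval v (cZ K)^`M(i) = (inord 2 == i)%:R by apply: gra_var.
rewrite dX dY dZ expr1 /t.
move: (m%:R) mm1 (_ ^+ m.-1) (_ == _)%:R (_ == _)%:R (_ == _)%:R => mm e S d1 d2 d3.
transitivity (d3 * Y ^+ q - d2 * X ^+ q - d1 * Z ^+ q -
  2%:R * mm * (lam * S * (Y * d3 - d1 * Z - X * d2))); first by ring.
by rewrite e; ring.
Qed.

(** Where the gradient vanishes, Frobenius multiplies the vector v by t, so Q ^ q = t ^ 2 Q. For
    nonzero Q this reads lam ^ 2 = 1; for Q = 0 it gives t = 0 and then v = 0. *)
Lemma curveF_nonsingular : proj_nonsingular (curveF q lam).
Proof.
move=> v [i0 vi0] [_ grad].
pose X := v (inord 0); pose Y := v (inord 1); pose Z := v (inord 2).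
pose Q := Y ^+ 2 - 2%:R * X * Z; pose t := lam * Q ^+ m.-1.
have two : (2 * m = q.+1)%N by rewrite mul2n even_halfK //= q_odd.
have ne (a b : nat) : (a < 3)%N -> (b < 3)%N -> ((inord a : 'I_3) == inord b) = (a == b).
  by move=> ha hb; rewrite -val_eqE /= !inordK.
have eY : Y ^+ q = t * Y.
  have := grad (inord 1); rewrite curveF_gradient !ne //= !mul0r !subr0 mul1r.
  by move/eqP; rewrite subr_eq0 => /eqP.
have eX : X ^+ q = t * X.
  have := grad (inord 2); rewrite curveF_gradient !ne //= !mul0r subr0 sub0r mul1r.
  by move/eqP; rewrite oppr_eq0 subr_eq0 => /eqP.
have eZ : Z ^+ q = t * Z.
  have := grad (inord 0); rewrite curveF_gradient !ne //= !mul0r subr0 sub0r mul1r.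
  by move/eqP; rewrite oppr_eq0 subr_eq0 => /eqP.
have two_q : 2%:R ^+ q = 2%:R :> K by rewrite -[2%:R]/(1 + 1 : K) frobD expr1n.
have Qq : Q ^+ q = t ^+ 2 * Q.
  rewrite /Q frobD frobN exprAC eY (exprMn 2 t Y) (exprMn q (2%:R * X) Z) (exprMn q 2%:R X) two_q eX eZ; ring.
have [Q0|Qn] := eqVneq Q 0.
  have t0 : t = 0.
    have mf : (m.-1 == 0)%N = false by move: two q_gt2; clear; lia.
    by rewrite /t Q0 expr0n mf mulr0.
  have z u : u ^+ q = t * u -> u = 0.
    by rewrite t0 mul0r => /eqP; rewrite expf_eq0 => /andP[_ /eqP].
  move/negP: vi0; apply; apply/eqP.
  have -> : i0 = inord i0 by rewrite inord_val.
  by case: i0 => [[|[|[|n]]] lt] //=; [apply: z eX | apply: z eY | apply: z eZ].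
have : lam ^+ 2 * Q ^+ q = 1 * Q ^+ q.
  rewrite mul1r [in RHS]Qq /t (exprMn 2 lam) -(exprM Q) -[RHS]mulrA -(exprSr Q); congr (_ * _ ^+ _).
  by move: two; clear; lia.
move/(mulIf (expf_neq0 q Qn))/eqP; rewrite sqrf_eq1 => /orP[]/eqP e.
  by move: lam1; rewrite e eqxx.
by move: lamN1; rewrite e eqxx.
Qed.

End Nonsingular.

(** * Passage to the stated notions and conclusion *)

Lemma function_field_chart (K F : fieldType) (q : nat) (lam : K) (iota : {rmorphism K -> F}) x y :
  is_function_field (curve_aff q lam) iota x y <-> chart q lam iota x y.
Proof.
split=> -[h1 h2 h3]; split.
- by move: h1; rewrite ev2E toB_curve evB_fB.
- move=> G G0; have [|h E] := h2 (ofB G); first by rewrite ev2E ofBK.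
  exists (toB h); by rewrite -(ofBK G) E -toB_curve toBM.
- move=> z; have [a [b [b0 zE]]] := h3 z; exists (toB a), (toB b).
  by rewrite -!ev2E.
- by rewrite ev2E toB_curve evB_fB.
- move=> g; rewrite ev2E => /h2[H E]; exists (ofB H).
  apply: (can_inj (@toBK K)); rewrite toBM E.
  by rewrite toB_curve ofBK.
move=> z; have [G [H [H0 zE]]] := h3 z; exists (ofB G), (ofB H).
by rewrite !ev2E !ofBK.
Qed.

(** The image of [Fq] already exhausts the roots of X ^ |Fq| - X in K. *)
Lemma frobenius_fixed_embed (Fq : finFieldType) (K : fieldType) (j : {rmorphism Fq -> K}) (t : K) :
  t ^+ #|Fq| = t -> exists z, t = j z.
Proof.
move=> tq; have q1 := finNzRing_gt1 Fq.
pose P : {poly K} := 'X^#|Fq| - 'X.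
have sP : size P = #|Fq|.+1.
  by rewrite size_polyDl ?size_polyXn // size_polyN size_polyX.
have P0 : P != 0 by rewrite -size_poly_gt0 sP.
have rP u : u ^+ #|Fq| = u -> root P u.
  by move=> e; rewrite /root hornerD hornerN hornerXn hornerX e subrr.
have [/imageP[z _ ->]|nt] := boolP (t \in image j Fq); first by exists z.
have rts : all (root P) (t :: image j Fq).
  rewrite /= rP //; apply/allP => _ /imageP[z _ ->].
  by apply: rP; rewrite -rmorphXn expf_card.
have unq : uniq (t :: image j Fq).
  by rewrite cons_uniq nt map_inj_uniq ?enum_uniq //; apply: fmorph_inj.
by have := max_poly_roots P0 rts unq; rewrite /= size_image sP ltnn.
Qed.

Theorem mainTheorem15 (p k q : nat) (K : closedFieldType) (lam : K) :
  prime p -> odd p -> (0 < k)%N -> q = (p ^ k)%N ->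
  p \in [pchar K] ->
  (* K is algebraic over the prime field F_p (so K is an algebraic closure of F_q) *)
  (forall a : K, exists P : {poly K},
     [/\ P != 0, forall i : nat, exists n : nat, P`_i = n%:R & root P a]) ->
  lam != 0 -> lam != 1 -> lam != -1 ->
  proj_nonsingular (curveF q lam) /\
  (exists (F : fieldType) (iota : {rmorphism K -> F}) (x y : F),
      is_function_field (curve_aff q lam) iota x y) /\
  (forall (F : fieldType) (iota : {rmorphism K -> F}) (x y : F),
      is_function_field (curve_aff q lam) iota x y ->
      forall Fq : finFieldType, #|Fq| = q ->
        iso_to_Kaut (PGL2 Fq) iota).
Proof.
move=> p_pr p_odd k0 q_def charK _ lam0 lam1 lamN1.
pose idK : {rmorphism K -> K} := idfun.
have qo := q_odd p_odd q_def; have q2 := q_gt2 p_pr p_odd k0 q_def.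
have q1 := ltnW q2.
have closedK (P : {poly K}) : size P != 1%N -> exists x, root P x by move/closed_rootP.
have fD := frobD p_pr q_def charK idK.
have fN (u : K) : (- u) ^+ q = - u ^+ q.
  by rewrite (exprNn_pchar _ (q_pnat p_pr q_def charK idK)).
split; first exact: (curveF_nonsingular fD (natq0 k0 q_def charK idK) qo q2 fN lam1 lamN1).
split.
  have [F [iota [x [y chi]]]] := chart_exists qo q1 lam1.
  by exists F, iota, x, y; apply/function_field_chart.
move=> F iota x y /function_field_chart chi Fq cFq.
have charFq : p \in [pchar Fq] by apply: (card_finPcharP (n := k)); rewrite ?cFq.
have [j _] := finField_embed charK closedK charFq.
have jq z : j z ^+ q = j z by rewrite -rmorphXn -cFq expf_card.
have jfix t : t ^+ q = t -> exists z, t = j z.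
  by rewrite -cFq; apply: frobenius_fixed_embed.
exact: (iso_PGL2 p_pr p_odd k0 q_def closedK charK lam0 lam1 lamN1 jq jfix chi).
Qed.
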